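(* Let $\nu$ be a rotationally invariant, compactly supported probability measure on $\mathbb{C}$ with $\int_{\mathbb{C}} |\log|z||\,d\nu(z)<\infty$, and let $R=\max\{|z|:z\in\mathrm{supp}\,\nu\}$ be the outer radius of its support. For each $n\ge1$ let $(x_1,\dots,x_n)$ be a jellium associated to $\nu$. Then $$\max_{k\in\{1,\dots,n\}}|x_k|\xrightarrow[n\to\infty]{\mathrm{law}} R\,x_\infty,$$ where $x_\infty$ is a random variable with values in $[1,\infty)$ such that $\mathbb{P}(x_\infty<t)=\prod_{k=1}^\infty(1-t^{-2k})$ for $t\ge 1$. Moreover, the law of $R\,x_\infty$ is the law of the maximum modulus of the points of the Bergman point process of $\mathbb{C}\setminus\bar D_R$.
   Context: $D_R$ is the open disk of radius $R$ centered at $0$. Potential: $V^{\nu}(z)=\int_{\mathbb{C}}\log|z-w|\,d\nu(w)$. Jellium: a random vector $(x_1,\dots,x_n)\in\mathbb{C}^n$ (depending on $n$) with law $\frac{1}{Z_n}\exp\left(-2\left[-\sum_{i<j}\log|x_i-x_j|+(n+1)\sum_{i=1}^n V^{\nu}(x_i)\right]\right)d\ell_{\mathbb{C}^n}(x_1,\dots,x_n)$, where $\ell_{\mathbb{C}^n}$ is Lebesgue measure on $\mathbb{C}^n$ and $Z_n$ is the normalizing constant. A point process (random locally finite configuration of points with multiplicity) on an open set $U\subset\mathbb{C}$ is determinantal with kernel $K:U\times U\to\mathbb{C}$ if for all $m\ge1$ and disjoint measurable $A_1,\dots,A_m\subset U$, $\mathbb{E}[\#A_1\cdots\#A_m]=\int_{A_1\times\cdots\times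 A_m}\det(K(x_i,x_j))_{1\le i,j\le m}\,d\ell_{\mathbb{C}^m}(x_1,\dots,x_m)$, where $\#A_i$ is the number of points in $A_i$. The Bergman point process of $\mathbb{C}\setminus\bar D_R$ is the determinantal point process on $\mathbb{C}\setminus\bar D_R$ with kernel its Bergman kernel $K(z,w)=\frac{R^2}{\pi(z\bar w-R^2)^2}$.
   Formalization: The Bergman point process is additionally taken to be almost surely simple: with multiplicities allowed, the identities for disjoint sets do not determine its law (doubling the points of the process with kernel K/2 satisfies them but changes the maximum). *)

(* Defs.v *)
From HB Require Import structures.
From mathcomp Require Import all_boot all_order all_algebra.
From mathcomp Require Import all_classical all_reals all_analysis.
From mathcomp Require Import measurable_realfun.
From mathcomp Require Import complex.

Set Implicit Arguments.
Unset Strict Implicit.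
Unset Printing Implicit Defensive.

Import Order.TTheory GRing.Theory Num.Theory.
Import numFieldNormedType.Exports.
Import Normc.

Local Open Scope classical_set_scope.
Local Open Scope ring_scope.
Local Open Scope ereal_scope.

(* [R[i]] is the complex plane; [normc z : R] is the modulus of [z].  The
   topology used on the plane is that of [R[i]^o], given by the modulus. *)

Definition complex_of_pair (R : realType)
    (p : measurableTypeR R * measurableTypeR R) : R[i] :=
  Complex p.1 p.2.

Definition pair_of_complex (R : realType) (z : R[i]) :
    measurableTypeR R * measurableTypeR R :=
  (complex.Re z, complex.Im z).

Lemma complex_of_pairK (R : realType) :
  cancel (@complex_of_pair R) (@pair_of_complex R).
Proof. by case. Qed.

Lemma pair_of_complexK (R : realType) :
  cancel (@pair_of_complex R) (@complex_of_pair R).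
Proof. by case. Qed.

(* The sigma-algebra of the plane is transported from the product (Borel)
   sigma-algebra of [R * R]. *)
Definition complex_display : measure_display.
Proof. exact: default_measure_display. Qed.

Section complex_measurable.
Variable R : realType.

Definition complex_measurable : set (set R[i]) :=
  [set A | measurable (@complex_of_pair R @^-1` A)].

Let complex_measurable0 : complex_measurable set0.
Proof. by rewrite /complex_measurable /= preimage_set0. Qed.

Let complex_measurableC A :
  complex_measurable A -> complex_measurable (~` A).
Proof.
by rewrite /complex_measurable /= preimage_setC; exact: measurableC.
Qed.

Let complex_measurable_bigcup (F : (set R[i])^nat) :
  (forall i, complex_measurable (F i)) ->
  complex_measurable (\bigcup_i (F i)).
Proof.
move=> mF; rewrite /complex_measurable /= preimage_bigcup.
exact: bigcupT_measurable.
Qed.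

HB.instance Definition _ := isPointed.Build R[i] 0%R.

HB.instance Definition _ := @isMeasurable.Build complex_display R[i]
  complex_measurable complex_measurable0 complex_measurableC
  complex_measurable_bigcup.

End complex_measurable.

Lemma measurable_complex_of_pair (R : realType) :
  measurable_fun setT (@complex_of_pair R).
Proof. by move=> _ A mA; rewrite setTI. Qed.

Lemma measurable_pair_of_complex (R : realType) :
  measurable_fun setT (@pair_of_complex R).
Proof.
move=> _ A mA; rewrite setTI /measurable /= /complex_measurable /=.
rewrite -comp_preimage (_ : _ \o _ = id) //.
by apply/funext => p /=; rewrite complex_of_pairK.
Qed.

Lemma pushforward_sigma_finite d d' (T : measurableType d)
    (T' : measurableType d') (R : realType)
    (mu : set T -> \bar R) (f : T -> T') (g : T' -> T) :
  measurable_fun setT g -> cancel f g -> sigma_finite setT mu ->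
  sigma_finite setT (pushforward mu f).
Proof.
move=> mg fK [F TF Foo].
exists (fun n => g @^-1` F n).
  by rewrite -preimage_bigcup -TF preimage_setT.
move=> n; have [mF Fy] := Foo n; split.
  by rewrite -[X in measurable X]setTI; exact: mg.
rewrite /pushforward -comp_preimage (_ : _ \o _ = id) //.
by apply/funext => x /=; rewrite fK.
Qed.

Lemma product_sigma_finite d1 d2 (T1 : measurableType d1)
    (T2 : measurableType d2) (R : realType)
    (m1 : {sigma_finite_measure set T1 -> \bar R})
    (m2 : {sigma_finite_measure set T2 -> \bar R}) :
  sigma_finite setT (m1 \x m2).
Proof.
have /sigma_finiteP[F [TF ndF Foo]] := sigma_finiteT m1.
have /sigma_finiteP[G [TG ndG Goo]] := sigma_finiteT m2.
exists (fun n => F n `*` G n).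
  rewrite -setXTT TF TG predeqE => -[x y]; split.
    move=> [/= [n _ Fnx] [k _ Gky]]; exists (maxn n k) => //; split.
    - by move: x Fnx; exact/subsetPset/ndF/leq_maxl.
    - by move: y Gky; exact/subsetPset/ndG/leq_maxr.
  by move=> [n _ []/= ? ?]; split; exists n.
move=> k; have [? ?] := Foo k; have [? ?] := Goo k.
split; first exact: measurableX.
by rewrite product_measure1E// lte_mul_pinfty// ge0_fin_numE.
Qed.

Section complex_lebesgue.
Variable R : realType.

Definition complex_lebesgue : set R[i] -> \bar R :=
  pushforward (@lebesgue_measure R \x @lebesgue_measure R)
    (@complex_of_pair R).

Let complex_lebesgue0 : complex_lebesgue set0 = 0.
Proof. by rewrite /complex_lebesgue /pushforward preimage_set0 measure0. Qed.

Let complex_lebesgue_ge0 A : 0 <= complex_lebesgue A.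
Proof. exact: (measure_ge0 (_ \x _)). Qed.

Let complex_lebesgue_sigma_additive : semi_sigma_additive complex_lebesgue.
Proof.
by apply: (@measure_semi_sigma_additive _ _ _ (pushforward _ _));
  exact: measurable_complex_of_pair.
Qed.

HB.instance Definition _ := isMeasure.Build _ _ _ complex_lebesgue
  complex_lebesgue0 complex_lebesgue_ge0 complex_lebesgue_sigma_additive.

Let complex_lebesgue_sigma_finite : sigma_finite setT complex_lebesgue.
Proof.
exact: (pushforward_sigma_finite (@measurable_pair_of_complex R)
  (@complex_of_pairK R) (product_sigma_finite _ _)).
Qed.

HB.instance Definition _ := Measure_isSigmaFinite.Build _ _ _ complex_lebesgue
  complex_lebesgue_sigma_finite.

End complex_lebesgue.

Arguments complex_lebesgue R : clear implicits.

Section lebesgue_tuple.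
Variable R : realType.

Definition cons_pair (n : nat) (p : R[i] * n.-tuple R[i]) : n.+1.-tuple R[i] :=
  [tuple of p.1 :: p.2].

Definition uncons_pair (n : nat) (t : n.+1.-tuple R[i]) :
    R[i] * n.-tuple R[i] :=
  (thead t, [tuple of behead t]).

Lemma cons_pairK n : cancel (@cons_pair n) (@uncons_pair n).
Proof.
by move=> [x t]; rewrite /uncons_pair theadE; congr pair; exact: val_inj.
Qed.

Lemma measurable_cons_pair n : measurable_fun setT (@cons_pair n).
Proof. exact: measurable_cons. Qed.

Lemma measurable_uncons_pair n : measurable_fun setT (@uncons_pair n).
Proof.
by apply/measurable_fun_pair; [exact: measurable_tnth|exact: measurable_behead].
Qed.

Fixpoint lebesgue_Cn (n : nat) : set (n.-tuple R[i]) -> \bar R :=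
  match n return set (n.-tuple R[i]) -> \bar R with
  | 0 => \d_[tuple]
  | n'.+1 => pushforward (complex_lebesgue R \x @lebesgue_Cn n') (@cons_pair n')
  end.

Arguments lebesgue_Cn : clear implicits.

Let lebesgue_Cn_subproof n : [/\ lebesgue_Cn n set0 = 0,
  forall A, 0 <= lebesgue_Cn n A, semi_sigma_additive (lebesgue_Cn n) &
  sigma_finite setT (lebesgue_Cn n)].
Proof.
elim: n => [|n [mu0 mu_ge0 mu_sadd mu_sfin]].
  split; [exact: measure0|exact: measure_ge0|
    exact: measure_semi_sigma_additive|exact: sigma_finiteT].
pose a := isMeasure.Build _ _ _ (lebesgue_Cn n) mu0 mu_ge0 mu_sadd.
pose m : {measure set _ -> \bar R} := HB.pack (lebesgue_Cn n) a.
pose b := Measure_isSigmaFinite.Build _ _ _ m mu_sfin.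
pose mu : {sigma_finite_measure set _ -> \bar R} := HB.pack (lebesgue_Cn n) a b.
rewrite /= -[lebesgue_Cn n]/(mu : set _ -> \bar R); split.
- by rewrite /pushforward preimage_set0 measure0.
- by move=> A; exact: (measure_ge0 (_ \x _)).
- by apply: (@measure_semi_sigma_additive _ _ _ (pushforward _ _));
    exact: measurable_cons_pair.
- exact: (pushforward_sigma_finite (@measurable_uncons_pair n) (@cons_pairK n)
    (product_sigma_finite _ mu)).
Qed.

HB.instance Definition _ n :=
  let: And4 mu0 mu_ge0 mu_sadd _ := lebesgue_Cn_subproof n in
  isMeasure.Build _ _ _ (lebesgue_Cn n) mu0 mu_ge0 mu_sadd.

HB.instance Definition _ n :=
  let: And4 _ _ _ mu_sfin := lebesgue_Cn_subproof n in
  Measure_isSigmaFinite.Build _ _ _ (lebesgue_Cn n) mu_sfin.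

End lebesgue_tuple.

Arguments lebesgue_Cn R n : clear implicits.

Definition is_max (R : realType) (A : set R) (x : R) : Prop :=
  A x /\ ubound A x.

Section measures_on_the_plane.
Variables (R : realType) (nu : probability R[i] R).

Definition measure_support : set R[i]^o :=
  [set z | forall U : set R[i]^o, open_nbhs z U -> 0 < nu U].

Definition rotation_invariant : Prop :=
  forall u : R[i], normc u = 1%R ->
  forall A : set R[i], measurable A ->
    pushforward nu (fun z => u * z)%R A = nu A.

(* [lne] is the logarithm with [lne 0 = -oo], whereas [ln 0 = 0]. *)
Definition log_modulus (z : R[i]) : \bar R := lne (normc z)%:E.

Definition potential (z : R[i]) : \bar R :=
  \int[nu]_w log_modulus (z - w)%R.

Definition jellium_weight (n : nat) (x : n.-tuple R[i]) : \bar R :=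
  expeR (- 2%:E *
    (- (\sum_(i < n) \sum_(j < n | (i < j)%N)
          log_modulus (tnth x i - tnth x j)%R)
     + n.+1%:R%:E * \sum_(i < n) potential (tnth x i))).

Definition jellium_constant (n : nat) : \bar R :=
  \int[lebesgue_Cn R n]_x jellium_weight x.

Definition is_jellium (n : nat) d (T : measurableType d) (P : probability T R)
    (X : {RV P >-> n.-tuple R[i]}) : Prop :=
  forall A : set (n.-tuple R[i]), measurable A ->
    distribution P X A =
      (jellium_constant n)^-1 * \int[lebesgue_Cn R n]_(x in A) jellium_weight x.

End measures_on_the_plane.

(* The maximum is taken with [0], which is harmless as soon as [0 < n]. *)
Definition max_modulus (R : realType) (n : nat) (x : n.-tuple R[i]) : R :=
  \big[Num.max/0%R]_(k < n) normc (tnth x k).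

Definition cvg_in_law (R : realType)
    (d : nat -> measure_display) (T : forall n, measurableType (d n))
    (P : forall n, probability (T n) R) (X : forall n, T n -> R)
    (d' : measure_display) (T' : measurableType d') (P' : probability T' R)
    (Y : T' -> R) : Prop :=
  forall f : R -> R, continuous f -> bounded_fun f ->
    'E_(P n)[f \o X n] @[n --> \oo] --> 'E_P'[f \o Y].

Section point_process.
Variables (R : realType) (d : measure_display) (T : measurableType d).
Variable P : probability T R.

(* A configuration is given by the multiplicity of each point of the plane. *)
Definition number_of_points (N : R[i] -> nat) (A : set R[i]) : \bar R :=
  \esum_(z in A) (N z)%:R%:E.

Definition is_point_process (U : set R[i]^o) (X : T -> R[i] -> nat) : Prop :=
  [/\ open U,
      forall w z, (0 < X w z)%N -> U z,
      forall w (K : set R[i]^o), compact K -> K `<=` U ->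
        finite_set (K `&` [set z | (0 < X w z)%N]) &
      forall A : set R[i], measurable A -> A `<=` U ->
        measurable_fun setT (fun w => number_of_points (X w) A : \bar R)].

Definition kernel_det (K : R[i] -> R[i] -> R[i]) (m : nat)
    (x : m.-tuple R[i]) : R[i] :=
  \det (\matrix_(i < m, j < m) K (tnth x i) (tnth x j)).

(* The integral of the complex-valued determinant is taken componentwise. *)
Definition is_determinantal (U : set R[i]^o) (K : R[i] -> R[i] -> R[i])
    (X : T -> R[i] -> nat) : Prop :=
  is_point_process U X /\
  forall (m : nat) (A : 'I_m -> set R[i]), (0 < m)%N ->
    (forall i, measurable (A i)) -> (forall i, A i `<=` U) ->
    trivIset setT A ->
    let box := [set x : m.-tuple R[i] | forall i, A i (tnth x i)] in
    \int[P]_w (\prod_(i < m) number_of_points (X w) (A i)) =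
      \int[lebesgue_Cn R m]_(x in box) (complex.Re (kernel_det K x))%:E /\
    \int[lebesgue_Cn R m]_(x in box) (complex.Im (kernel_det K x))%:E = 0.

Definition almost_surely_simple (X : T -> R[i] -> nat) : Prop :=
  {ae P, forall w, forall z, (X w z <= 1)%N}.

End point_process.

Definition bergman_kernel (R : realType) (r : R) (z w : R[i]) : R[i] :=
  ((r ^+ 2)%:C / (pi%:C * (z * conjc w - (r ^+ 2)%:C) ^+ 2))%C%R.

Definition outer_domain (R : realType) (r : R) : set R[i]^o :=
  [set z | (r < normc z)%R].

(* For disjoint sets the correlation identities only see the multiplicities
   linearly: doubling every point of a half-thinned determinantal process
   preserves them.  Simplicity is what makes them determine the process. *)
Definition is_bergman_process (R : realType) (r : R) d (T : measurableType d)
    (P : probability T R) (X : T -> R[i] -> nat) : Prop :=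
  is_determinantal P (outer_domain r) (@bergman_kernel R r) X /\
  almost_surely_simple P X.

(* Main.v *)
Require Import Defs.
From HB Require Import structures.
From mathcomp Require Import all_boot all_order all_algebra.
From mathcomp Require Import all_classical all_reals all_analysis.
From mathcomp Require Import measurable_realfun.
From mathcomp Require Import complex.
From mathcomp Require Import ring lra perm.

(** Both the jellium and the Bergman process are built from powers of one
    complex variable, and powers of different degrees are orthogonal for every
    radial weight.  Everything rests on the resulting formula
    [integral_sqr_det]: for a radial weight, the integral over a power of the
    plane of the squared modulus of the determinant of powers is [m`!] times
    the product of the one-dimensional integrals.  Orthogonality is obtained by
    averaging over roots of unity, since Lebesgue measure is invariant under
    rotations ([ge0_integral_rotation]).

    Jellium.  The weight is the squared modulus of a Vandermonde determinant
    times a radial product ([jellium_weightE]), so that the probability that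
    the maximum modulus is smaller than [t] is a product over the degrees
    ([jellium_max_modulus]).  A rotation-invariant potential equals log |z|
    outside the disc of radius [r] and is larger than log |z| inside
    ([potential_outer], [potential_gt_log]): this comes from averaging
    log |z - w| over circles, which is done by repeatedly squaring the points of
    the circle.  Therefore, for the [i]-th degree counted from the top, the
    mass inside the disc becomes negligible as the number of particles grows
    ([cvg_inner_mass]), and the corresponding factor tends to
    1 - (r/t)^(2(i+1)).  The factors are dominated by a geometric sequence, and
    the product tends to the Euler product ([cvg_prod_onem]).  Convergence of
    distribution functions then gives convergence in law ([cvg_in_law_cdf]).

    Bergman process.  Outside the disc of radius [t > r] the kernel expands in
    monomials 1/z^(k+2), and the determinants of its truncations are increasing
    sums of squared determinants ([det_bergman_trunc]).  Their integrals are
    elementary symmetric functions of the numbers (r/t)^(2k)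
    ([integral_trunc_det]).  These integrals are the factorial moments of the
    number of points outside the disc ([factorial_moment]): the correlation
    identities concern disjoint sets, so the plane is cut into finer and finer
    cells, and simplicity together with the vanishing of the determinant on the
    diagonals lets the cells shrink.  By inclusion and exclusion the
    probability that no point lies outside the disc is the product of the
    numbers 1 - (r/t)^(2k) ([probability_no_outer_point]), the same Euler
    product as for the jellium. *)

Set Implicit Arguments.
Unset Strict Implicit.
Unset Printing Implicit Defensive.
Import Order.TTheory GRing.Theory Num.Theory.
Import numFieldNormedType.Exports.
Import Normc.
Local Open Scope classical_set_scope.
Local Open Scope ring_scope.

(** * Measurable functions with values in the plane *)

Section measurability.
Context d (T : measurableType d) (R : realType).
Implicit Types f g : T -> R[i].

Lemma measurable_Re : measurable_fun setT (@complex.Re R).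
Proof.
exact: (measurableT_comp measurable_fst (@measurable_pair_of_complex R)).
Qed.

Lemma measurable_Im : measurable_fun setT (@complex.Im R).
Proof.
exact: (measurableT_comp measurable_snd (@measurable_pair_of_complex R)).
Qed.

Lemma measurable_Complex (f g : T -> R) :
  measurable_fun setT f -> measurable_fun setT g ->
  measurable_fun setT (fun x => Complex (f x) (g x)).
Proof.
move=> mf mg.
rewrite (_ : (fun x => _) = @complex_of_pair R \o (fun x => (f x, g x))) //.
apply: measurableT_comp; first exact: measurable_complex_of_pair.
exact: measurable_fun_pair.
Qed.

Lemma measurable_complexP f :
  measurable_fun setT (@complex.Re R \o f) ->
  measurable_fun setT (@complex.Im R \o f) -> measurable_fun setT f.
Proof.
move=> mr mi; rewrite (_ : f = fun x => Complex (complex.Re (f x)) (complex.Im (f x))).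
  exact: measurable_Complex.
by apply/funext => x; case: (f x).
Qed.

Lemma measurable_Re_comp f :
  measurable_fun setT f -> measurable_fun setT (@complex.Re R \o f).
Proof. by move=> mf; apply: measurableT_comp => //; exact: measurable_Re. Qed.

Lemma measurable_Im_comp f :
  measurable_fun setT f -> measurable_fun setT (@complex.Im R \o f).
Proof. by move=> mf; apply: measurableT_comp => //; exact: measurable_Im. Qed.

Lemma normc_Re_Im (z : R[i]) :
  normc z = Num.sqrt (complex.Re z ^+ 2 + complex.Im z ^+ 2).
Proof. by case: z. Qed.

Lemma measurable_normc_comp f :
  measurable_fun setT f -> measurable_fun setT (fun x => normc (f x)).
Proof.
move=> mf; under eq_fun do rewrite normc_Re_Im.
apply: (measurableT_comp (continuous_measurable_fun (@sqrt_continuous R))).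
apply: measurable_funD; apply: measurable_funX.
  exact: measurable_Re_comp.
exact: measurable_Im_comp.
Qed.

Lemma measurable_complexD f g : measurable_fun setT f ->
  measurable_fun setT g -> measurable_fun setT (fun x => f x + g x).
Proof.
move=> mf mg; apply: measurable_complexP.
  rewrite (_ : _ \o _ = (@complex.Re R \o f) \+ (@complex.Re R \o g)); last first.
    by apply/funext => x /=; case: (f x) (g x) => ? ? [].
  by apply: measurable_funD; exact: measurable_Re_comp.
rewrite (_ : _ \o _ = (@complex.Im R \o f) \+ (@complex.Im R \o g)); last first.
  by apply/funext => x /=; case: (f x) (g x) => ? ? [].
by apply: measurable_funD; exact: measurable_Im_comp.
Qed.

Lemma measurable_complexN f : measurable_fun setT f ->
  measurable_fun setT (fun x => - f x).
Proof.
move=> mf; apply: measurable_complexP.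
  rewrite (_ : _ \o _ = \- (@complex.Re R \o f)); last first.
    by apply/funext => x /=; case: (f x).
  by apply: measurableT_comp => //; exact: measurable_Re_comp.
rewrite (_ : _ \o _ = \- (@complex.Im R \o f)); last first.
  by apply/funext => x /=; case: (f x).
by apply: measurableT_comp => //; exact: measurable_Im_comp.
Qed.

Lemma measurable_complexM f g : measurable_fun setT f ->
  measurable_fun setT g -> measurable_fun setT (fun x => f x * g x).
Proof.
move=> mf mg; have mRf := measurable_Re_comp mf.
have mIf := measurable_Im_comp mf; have mRg := measurable_Re_comp mg.
have mIg := measurable_Im_comp mg.
apply: measurable_complexP.
  rewrite (_ : _ \o _ = ((@complex.Re R \o f) \* (@complex.Re R \o g)) \-
      ((@complex.Im R \o f) \* (@complex.Im R \o g))); last first.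
    by apply/funext => x /=; case: (f x) (g x) => ? ? [].
  by apply: measurable_funB; apply: measurable_funM.
rewrite (_ : _ \o _ = ((@complex.Re R \o f) \* (@complex.Im R \o g)) \+
    ((@complex.Im R \o f) \* (@complex.Re R \o g))); last first.
  by apply/funext => x /=; case: (f x) (g x) => ? ? [].
by apply: measurable_funD; apply: measurable_funM.
Qed.

Lemma measurable_complexX f n : measurable_fun setT f ->
  measurable_fun setT (fun x => f x ^+ n).
Proof.
move=> mf; elim: n => [|n IH]; first exact: measurable_cst.
by under eq_fun do rewrite exprS; exact: measurable_complexM.
Qed.

Lemma measurable_complex_sum (I : Type) (s : seq I) (P : pred I)
    (F : I -> T -> R[i]) : (forall i, measurable_fun setT (F i)) ->
  measurable_fun setT (fun x => \sum_(i <- s | P i) F i x).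
Proof.
move=> mF; elim: s => [|i s IH].
  by under eq_fun do rewrite big_nil; exact: measurable_cst.
under eq_fun do rewrite big_cons.
by case: (P i) => //; exact: measurable_complexD.
Qed.

Lemma measurable_complex_prod (I : Type) (s : seq I) (P : pred I)
    (F : I -> T -> R[i]) : (forall i, measurable_fun setT (F i)) ->
  measurable_fun setT (fun x => \prod_(i <- s | P i) F i x).
Proof.
move=> mF; elim: s => [|i s IH].
  by under eq_fun do rewrite big_nil; exact: measurable_cst.
under eq_fun do rewrite big_cons.
by case: (P i) => //; exact: measurable_complexM.
Qed.

Lemma measurable_det n (F : 'I_n -> 'I_n -> T -> R[i]) :
  (forall i j, measurable_fun setT (F i j)) ->
  measurable_fun setT (fun x => \det (\matrix_(i, j) F i j x)).
Proof.
move=> mF; apply: measurable_complex_sum => s.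
apply: measurable_complexM; first exact: measurable_cst.
apply: measurable_complex_prod => i; under eq_fun do rewrite mxE.
exact: mF.
Qed.

Lemma measurable_inv_ge0 (f : T -> R) : (forall x, 0 <= f x) ->
  measurable_fun setT f -> measurable_fun setT (fun x => (f x)^-1).
Proof.
move=> f0 mf; under eq_fun do rewrite -powR_inv1//.
by apply: (measurableT_comp (measurable_powR (-1))).
Qed.

End measurability.

Section modulus.
Variable R : realType.
Implicit Types z w u : R[i].

Lemma measurable_normc : measurable_fun setT (@normc R).
Proof. by apply: measurable_normc_comp; exact: measurable_id. Qed.

Lemma normc_ge0 z : 0 <= normc z.
Proof. by rewrite normc_Re_Im sqrtr_ge0. Qed.

Lemma normcX z n : normc (z ^+ n) = normc z ^+ n.
Proof.
by elim: n => [|n IH]; rewrite ?expr0 ?normc1// !exprS normcM IH.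
Qed.

Lemma sqr_normc_Re_Im z :
  normc z ^+ 2 = complex.Re z ^+ 2 + complex.Im z ^+ 2.
Proof. by rewrite normc_Re_Im sqr_sqrtr// addr_ge0 ?sqr_ge0. Qed.

Lemma sqr_normcE z : ((normc z ^+ 2)%:C)%C = z * conjc z.
Proof.
rewrite sqr_normc_Re_Im; case: z => a b /=; apply/eqP; rewrite eq_complex /=.
by apply/andP; split; apply/eqP; ring.
Qed.

Lemma normc_real (x : R) : normc (x%:C)%C = `|x|.
Proof. by rewrite normc_Re_Im /= expr0n addr0 sqrtr_sqr. Qed.

Lemma normc_conj z : normc (conjc z) = normc z.
Proof. by rewrite !normc_Re_Im; case: z => a b /=; rewrite sqrrN. Qed.

Lemma normc_eq0 z : (normc z == 0) = (z == 0).
Proof. by apply/eqP/eqP => [/eq0_normc//|->]; rewrite normc0. Qed.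

Lemma normc_gt0 z : (0 < normc z) = (z != 0).
Proof. by rewrite lt_def normc_ge0 normc_eq0 andbT. Qed.

End modulus.

(** * Rotations and the law of the squared modulus under Lebesgue measure *)

Section lebesgue_affine.
Variable R : realType.
Notation leb := (@lebesgue_measure R).
Local Open Scope ereal_scope.

Lemma ge0_integral_affine (c a : R) (f : R -> \bar R) : (0 < c)%R ->
  measurable_fun setT f -> (forall x, 0 <= f x) ->
  c%:E * \int[leb]_x f (c * x + a)%R = \int[leb]_x f x.
Proof.
move=> c0 mf f0.
pose phi (x : measurableTypeR R) : measurableTypeR R := (c * x + a)%R.
have mphi : measurable_fun setT phi.
  by apply: measurable_funD => //; apply: measurable_funM.
have c0' : (0 <= c)%R by exact: ltW.
have E := ge0_integral_pushforward mphi leb measurableT mf (fun x _ => f0 x).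
rewrite preimage_setT in E; rewrite -[X in _ * X]E.
rewrite -[c%:E]/((NngNum c0')%:num%:E) -ge0_integral_mscale//.
apply: eq_measure_integral => A mA _; apply/esym/lebesgue_measure_unique => //.
move=> _ [[p q]] _ <-.
transitivity (c%:E * leb (phi @^-1` `]p, q]%classic)); last by [].
have -> : phi @^-1` `]p, q] = `]((p - a) / c)%R, ((q - a) / c)%R]%classic.
  apply/seteqP; split => x /=; rewrite !in_itv /= ltr_pdivrMr// ler_pdivlMr//;
    by rewrite /phi ltrBlDr lerBrDr (mulrC x).
rewrite !lebesgue_measure_itv/= !lte_fin ltr_pM2r ?invr_gt0// ltrD2r.
case: ifPn => pq; last by rewrite mule0.
by rewrite -!EFinB -EFinM; congr EFin; field; rewrite gt_eqF.
Qed.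

Lemma ge0_integral_translation (a : R) (f : R -> \bar R) :
  measurable_fun setT f -> (forall x, 0 <= f x) ->
  \int[leb]_x f (x + a)%R = \int[leb]_x f x.
Proof.
move=> mf f0; have := @ge0_integral_affine 1 a f ltr01 mf f0.
by rewrite mul1e => <-; apply: eq_integral => x _; rewrite mul1r.
Qed.

End lebesgue_affine.

Section complex_lebesgue_invariance.
Variable R : realType.
Notation leb := (@lebesgue_measure R).
Notation cleb := (complex_lebesgue R).
Local Open Scope ereal_scope.

Lemma ge0_integral_complex_lebesgue (f : R[i] -> \bar R) :
  measurable_fun setT f -> (forall z, 0 <= f z) ->
  \int[cleb]_z f z = \int[leb]_y \int[leb]_x f (Complex x y).
Proof.
move=> mf f0.
have mg : measurable_fun setT (f \o @complex_of_pair R).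
  by apply: measurableT_comp => //; exact: measurable_complex_of_pair.
transitivity (\int[leb \x leb]_p (f \o @complex_of_pair R) p).
  have := @ge0_integral_pushforward _ _ _ _ R (@complex_of_pair R)
    (@measurable_complex_of_pair R) (leb \x leb) setT f measurableT mf.
  by rewrite preimage_setT; apply => // z _; exact: f0.
by rewrite fubini_tonelli2// => p; exact: f0.
Qed.

Lemma ge0_integral_complex_lebesgue' (f : R[i] -> \bar R) :
  measurable_fun setT f -> (forall z, 0 <= f z) ->
  \int[cleb]_z f z = \int[leb]_x \int[leb]_y f (Complex x y).
Proof.
move=> mf f0; rewrite (ge0_integral_complex_lebesgue mf f0).
have mg : measurable_fun setT (f \o @complex_of_pair R).
  by apply: measurableT_comp => //; exact: measurable_complex_of_pair.
by have /= <- := @fubini_tonelli _ _ _ _ R leb leb _ mg (fun p => f0 _).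
Qed.

Let measurable_section_x (f : R[i] -> \bar R) y : measurable_fun setT f ->
  measurable_fun setT (fun x => f (Complex x y)).
Proof.
by move=> mf; apply: measurableT_comp => //; exact: measurable_Complex.
Qed.

Let measurable_section_y (f : R[i] -> \bar R) x : measurable_fun setT f ->
  measurable_fun setT (fun y => f (Complex x y)).
Proof.
by move=> mf; apply: measurableT_comp => //; exact: measurable_Complex.
Qed.

Definition shear_x (a : R) (z : R[i]) : R[i] :=
  Complex (complex.Re z + a * complex.Im z)%R (complex.Im z).
Definition shear_y (a : R) (z : R[i]) : R[i] :=
  Complex (complex.Re z) (complex.Im z + a * complex.Re z)%R.

Lemma measurable_shear_x a : measurable_fun setT (shear_x a).
Proof.
apply: measurable_Complex; last exact: measurable_Im.
by apply: measurable_funD; [exact: measurable_Re|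
  apply: measurable_funM => //; exact: measurable_Im].
Qed.

Lemma measurable_shear_y a : measurable_fun setT (shear_y a).
Proof.
apply: measurable_Complex; first exact: measurable_Re.
by apply: measurable_funD; [exact: measurable_Im|
  apply: measurable_funM => //; exact: measurable_Re].
Qed.

Lemma ge0_integral_shear_x a (f : R[i] -> \bar R) :
  measurable_fun setT f -> (forall z, 0 <= f z) ->
  \int[cleb]_z f (shear_x a z) = \int[cleb]_z f z.
Proof.
move=> mf f0.
have mfs : measurable_fun setT (f \o shear_x a).
  by apply: measurableT_comp => //; exact: measurable_shear_x.
rewrite (ge0_integral_complex_lebesgue mf f0).
rewrite (ge0_integral_complex_lebesgue mfs (fun z => f0 _)).
apply: eq_integral => y _ /=; rewrite /shear_x /=.
exact: (ge0_integral_translation (a * y) (measurable_section_x y mf)).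
Qed.

Lemma ge0_integral_shear_y a (f : R[i] -> \bar R) :
  measurable_fun setT f -> (forall z, 0 <= f z) ->
  \int[cleb]_z f (shear_y a z) = \int[cleb]_z f z.
Proof.
move=> mf f0.
have mfs : measurable_fun setT (f \o shear_y a).
  by apply: measurableT_comp => //; exact: measurable_shear_y.
rewrite (ge0_integral_complex_lebesgue' mf f0).
rewrite (ge0_integral_complex_lebesgue' mfs (fun z => f0 _)).
apply: eq_integral => y _ /=; rewrite /shear_y /=.
exact: (ge0_integral_translation (a * y) (measurable_section_y y mf)).
Qed.

Lemma measurable_mulc (u : R[i]) : measurable_fun setT (fun z => u * z)%R.
Proof.
by apply: measurable_complexM; [exact: measurable_cst|exact: measurable_id].
Qed.

(** A rotation which is not a homothety is a product of three shears, and
    each shear acts by translations on the lines of one direction. *)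
Lemma ge0_integral_rotation (u : R[i]) (f : R[i] -> \bar R) : normc u = 1%R ->
  measurable_fun setT f -> (forall z, 0 <= f z) ->
  \int[cleb]_z f (u * z)%R = \int[cleb]_z f z.
Proof.
have rot (v : R[i]) (g : R[i] -> \bar R) : normc v = 1%R ->
    complex.Im v != 0%R ->
    measurable_fun setT g -> (forall z, 0 <= g z) ->
    \int[cleb]_z g (v * z)%R = \int[cleb]_z g z.
  move=> v1 s0 mg g0; have := sqr_normc_Re_Im v; rewrite v1 expr1n.
  case: v s0 {v1} => c s /= s0 cs.
  pose a := ((c - 1) / s)%R.
  have E z : (Complex c s * z)%R = shear_x a (shear_y s (shear_x a z)).
    case: z => x y; rewrite /shear_x /shear_y /=.
    apply/eqP; rewrite eq_complex /=; apply/andP; split; apply/eqP; last first.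
      by rewrite /a; field.
    rewrite /a; apply/eqP; rewrite -subr_eq0; apply/eqP.
    transitivity ((y / s) * (1 - (c ^+ 2 + s ^+ 2)))%R; first by field.
    by rewrite -cs subrr mulr0.
  under eq_integral do rewrite E.
  have m1 : measurable_fun setT (g \o shear_x a).
    by apply: measurableT_comp => //; exact: measurable_shear_x.
  have m2 : measurable_fun setT ((g \o shear_x a) \o shear_y s).
    by apply: measurableT_comp => //; exact: measurable_shear_y.
  rewrite (@ge0_integral_shear_x a _ m2) => [|z]; last exact: g0.
  rewrite (@ge0_integral_shear_y s _ m1) => [|z]; last exact: g0.
  exact: ge0_integral_shear_x.
move=> u1 mf f0.
have [Imu|] := eqVneq (complex.Im u) 0%R; last by move=> ?; exact: rot.
(* a real unit is the product of i and of a unit which is not real *)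
pose i : R[i] := Complex 0%R 1%R; pose v : R[i] := (- i * u)%R.
have i1 : normc i = 1%R by rewrite normc_Re_Im /= expr0n expr1n add0r sqrtr1.
have uE z : (u * z)%R = (i * (v * z))%R.
  rewrite /v !mulrA (_ : i * (- i) = 1)%R ?mul1r//.
  by apply/eqP; rewrite eq_complex /=; apply/andP; split; apply/eqP; ring.
under eq_integral do rewrite uE.
rewrite (rot v (fun z => f (i * z)%R)) => //.
- by rewrite rot//= oner_eq0.
- by rewrite /v normcM normcN i1 u1 mulr1.
- move: u1; rewrite /v; case: u Imu {v uE} => a b /= ->.
  move=> /= a1; have : a != 0%R by apply/eqP => a0; move: a1; rewrite a0 !expr0n addr0 sqrtr0 => /esym/eqP; rewrite oner_eq0.
  by rewrite mulr0 add0r mulNr mul1r oppr_eq0.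
- by apply: measurableT_comp => //; exact: measurable_mulc.
Qed.

Lemma ge0_integral_homothety (c : R) (f : R[i] -> \bar R) : (0 < c)%R ->
  measurable_fun setT f -> (forall z, 0 <= f z) ->
  (c ^+ 2)%:E * \int[cleb]_z f (c%:C%C * z)%R = \int[cleb]_z f z.
Proof.
move=> c0 mf f0; have mfc : measurable_fun setT (fun z => f (c%:C%C * z)%R).
  by apply: measurableT_comp => //; exact: measurable_mulc.
rewrite (ge0_integral_complex_lebesgue mf f0).
rewrite (ge0_integral_complex_lebesgue mfc (fun z => f0 _)).
have inner y : c%:E * \int[leb]_x f (c%:C%C * Complex x y)%R =
    \int[leb]_x f (Complex x (c * y + 0))%R.
  have msec : measurable_fun setT (fun x => f (Complex x (c * y + 0)%R)).
    exact: measurable_section_x.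
  rewrite -(ge0_integral_affine 0 c0 msec (fun x => f0 _)).
  congr (_ * _); apply: eq_integral => x _; congr f.
  by apply/eqP; rewrite eq_complex /=; apply/andP; split; apply/eqP; ring.
have mF : measurable_fun setT (fun y => \int[leb]_x f (Complex x y)).
  have mg : measurable_fun setT (f \o @complex_of_pair R).
    by apply: measurableT_comp => //; exact: measurable_complex_of_pair.
  exact: (measurable_fun_fubini_tonelli_G (f \o @complex_of_pair R) mg
    (fun p => f0 _)).
have mFc : measurable_fun setT (fun y => \int[leb]_x f (c%:C%C * Complex x y)%R).
  have mg : measurable_fun setT
     ((fun z => f (c%:C%C * z)%R) \o @complex_of_pair R).
    by apply: measurableT_comp => //; exact: measurable_complex_of_pair.
  exact: (measurable_fun_fubini_tonelli_G _ mg (fun p => f0 _)).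
rewrite -(ge0_integral_affine 0 c0 mF (fun y => integral_ge0 _ (fun x _ => f0 _))).
rewrite expr2 EFinM -muleA.
rewrite -(ge0_integralZl leb measurableT mFc
  (fun y _ => integral_ge0 _ (fun x _ => f0 _))); last by rewrite lee_fin ltW.
by congr (_ * _); apply: eq_integral => y _; exact: inner.
Qed.

End complex_lebesgue_invariance.

Section radial.
Variable R : realType.
Notation leb := (@lebesgue_measure R).
Notation cleb := (complex_lebesgue R).
Local Open Scope ereal_scope.

Definition sqr_disc (s : R) : set R[i] := [set z | (normc z ^+ 2 <= s)%R].

Lemma measurable_sqr_normc :
  measurable_fun setT (fun z : R[i] => normc z ^+ 2 : measurableTypeR R)%R.
Proof. by apply: measurable_funX; exact: measurable_normc. Qed.

Lemma measurable_sqr_disc s : measurable (sqr_disc s).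
Proof.
rewrite (_ : sqr_disc s = setT `&`
    (fun z : R[i] => normc z ^+ 2 : measurableTypeR R)%R @^-1` `]-oo, s]).
  by apply: measurable_sqr_normc => //; exact: measurable_itv.
by apply/seteqP; split => z /=; rewrite in_itv /=; [split|case].
Qed.

Lemma sqr_disc1_fin : cleb (sqr_disc 1) < +oo.
Proof.
pose I := `[(-1)%R, 1%R]%classic : set (measurableTypeR R).
apply: (@le_lt_trans _ _ ((leb \x leb) (I `*` I))).
  rewrite /complex_lebesgue /pushforward; apply: le_measure; rewrite ?inE.
  - rewrite -[X in measurable X]setTI.
    by apply: measurable_complex_of_pair => //; exact: measurable_sqr_disc.
  - by apply: measurableX; exact: measurable_itv.
  - move=> [x y]; rewrite /preimage /sqr_disc /mkset sqr_normc_Re_Im /= => h.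
    split; rewrite /I /= in_itv /= -ler_norml -(@ler_pXn2r _ 2)// ?nnegrE//;
      rewrite expr1n real_normK ?num_real//; apply: le_trans h.
      by rewrite lerDl sqr_ge0.
    by rewrite lerDr sqr_ge0.
have lI : leb I = (1 - -1)%:E.
  by rewrite /I lebesgue_measure_itv /= lte_fin gtrN//.
rewrite product_measure1E; try exact: measurable_itv.
by change (leb I * leb I < +oo); rewrite lI -EFinM ltry.
Qed.

Definition disc_area : R := fine (cleb (sqr_disc 1)).

Lemma disc_area_ge0 : (0 <= disc_area)%R.
Proof. exact: fine_ge0. Qed.

Lemma disc_areaE : cleb (sqr_disc 1) = disc_area%:E.
Proof. by rewrite fineK// ge0_fin_numE//; exact: sqr_disc1_fin. Qed.

Lemma integral_indic_complex_lebesgue (A : set R[i]) : measurable A ->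
  \int[cleb]_z (\1_A z)%:E = cleb A.
Proof. by move=> mA; rewrite integral_indic// setIT. Qed.

Lemma complex_lebesgue_sqr_disc s :
  cleb (sqr_disc s) = (disc_area * Num.max s 0)%:E.
Proof.
have [s0|s0|->] := ltgtP s 0%R.
- rewrite mulr0 (_ : sqr_disc s = set0) ?measure0//.
  by apply/seteqP; split => z //=; rewrite /sqr_disc /= leNgt (lt_le_trans s0)// sqr_ge0.
- have [c c0 cs] : exists2 c : R, (0 < c)%R & (c ^+ 2 = s)%R.
    by exists (Num.sqrt s); rewrite ?sqrtr_gt0// sqr_sqrtr// ltW.
  have := @ge0_integral_homothety R c (fun z => (\1_(sqr_disc s) z)%:E) c0.
  have ms := measurable_sqr_disc s; have m1 := measurable_sqr_disc 1.
  rewrite (integral_indic_complex_lebesgue ms) cs => <-; last 2 first.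
    by apply/measurable_EFinP; exact: measurable_indic.
    by move=> z; rewrite lee_fin.
  rewrite (eq_integral (fun z => (\1_(sqr_disc 1) z)%:E)).
    by rewrite (integral_indic_complex_lebesgue m1) disc_areaE -EFinM mulrC.
  move=> z _; rewrite !indicE; congr (_%:R%:E); congr (nat_of_bool _).
  have nE : (normc (c%:C%C * z) ^+ 2 = s * normc z ^+ 2)%R.
    by rewrite normcM exprMn normc_real (ger0_norm (ltW c0)) cs.
  by apply/idP/idP; rewrite !inE /sqr_disc /mkset nE ger_pMr.
- rewrite mulr0 (_ : sqr_disc 0 = [set 0%R]); last first.
    apply/seteqP; split => z; rewrite /sqr_disc /=.
      by rewrite exprn_even_le0//= => /eqP/eq0_normc.
    by move=> ->; rewrite normc0 expr0n.
  rewrite /complex_lebesgue /pushforward /=.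
  rewrite (_ : _ @^-1` _ = [set 0%R] `*` [set 0%R]); last first.
    by apply/seteqP; split => -[x y] /= => [[-> ->]//|[-> ->]].
  rewrite product_measure1E//.
  by change (leb [set 0%R] * leb [set 0%R] = 0); rewrite lebesgue_measure_set1 mul0e.
Qed.

(** By homothety the area of an annulus is proportional to the difference of the
    squared radii, so that the image of the area by the squared modulus is a
    multiple of Lebesgue measure on the half-line. *)
Lemma ge0_integral_sqr_normc (h : R -> \bar R) :
  measurable_fun setT h -> (forall q, 0 <= h q) ->
  \int[cleb]_z h (normc z ^+ 2)%R =
  disc_area%:E * \int[leb]_(q in `[0%R, +oo[) h q.
Proof.
move=> mh h0; have mq := measurable_sqr_normc.
pose D := `[0%R, +oo[%classic : set (measurableTypeR R).
have mD : measurable D by exact: measurable_itv.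
have mhD : measurable_fun D h by exact: measurable_funTS.
have E := ge0_integral_pushforward mq cleb mD mhD (fun x _ => h0 x).
transitivity (\int[cleb]_(z in (fun z => normc z ^+ 2 : measurableTypeR R)%R @^-1` D)
    h (normc z ^+ 2)%R).
  congr (integral _ _ _); apply/seteqP; split => z // _.
  by rewrite /D /= in_itv /= sqr_ge0.
rewrite -[LHS]E -[disc_area%:E]/((NngNum disc_area_ge0)%:num%:E).
rewrite -ge0_integral_mscale//.
apply: eq_measure_integral => A mA AD.
transitivity (mscale (NngNum disc_area_ge0) (mrestr leb mD) A); last first.
  by rewrite /mscale /= /mrestr setIidl.
apply: (@measure_unique _ R (measurableTypeR R) (@ocitv R) (fun k => `](- k%:R)%R, k%:R]%classic)) => //.
- exact: ocitvI.
- by move=> k; exact: is_ocitv.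
- rewrite -subTset => x _; exists (Num.truncn `|x|).+1 => //=; rewrite in_itv /=.
  have : (`|x| < (Num.truncn `|x|).+1%:R)%R by exact: truncnS_gt.
  by rewrite ltr_norml => /andP[-> /ltW ->].
- move=> _ [[a b]] _ <- /=.
  have [ab|ba] := ltP a b; last by rewrite set_itv_ge ?bnd_simp -?leNgt// !measure0.
  have -> : pushforward cleb (fun z => normc z ^+ 2 : measurableTypeR R)%R `]a, b] =
      cleb (sqr_disc b `\` sqr_disc a).
    congr (cleb _); apply/seteqP; split => z; rewrite /sqr_disc /= in_itv /=.
      by move=> /andP[az ->]; split => //; apply/negP; rewrite -ltNge.
    by move=> [-> /negP]; rewrite -ltNge => ->.
  rewrite measureD//; try exact: measurable_sqr_disc; last first.
    by have := complex_lebesgue_sqr_disc b; rewrite /= => ->; exact: ltry.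
  change (cleb (sqr_disc b) - cleb (sqr_disc b `&` sqr_disc a) =
    mscale (NngNum disc_area_ge0) (mrestr leb mD) `]a, b]).
  rewrite setIidr; last first.
    by move=> z; rewrite /sqr_disc /= => /le_trans; apply; exact: ltW.
  rewrite !complex_lebesgue_sqr_disc -EFinB -mulrBr /mscale /= EFinM.
  congr (_ * _); rewrite /mrestr.
  have [b0|b0] := ltP b 0%R.
    rewrite (max_r (ltW (lt_trans ab b0))) subrr.
    rewrite (_ : _ `&` _ = set0) ?measure0//; apply/seteqP; split => x //=.
    by rewrite /D /= !in_itv /= andbT => -[/andP[_ xb] /(le_trans)/(_ xb)]; rewrite leNgt b0.
  have [a0|a0] := ltP a 0%R.
    rewrite (_ : _ `&` _ = `[0%R, b]%classic).
      rewrite lebesgue_measure_itv /= lte_fin subr0 oppr0 addr0.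
      by case: ltgtP b0 => // <-.
    apply/seteqP; split => x /=; rewrite /D /= !in_itv /= ?andbT.
      by move=> [/andP[_ ->] ->].
    by move=> /andP[x0 ->]; rewrite x0 andbT (lt_le_trans a0).
  rewrite (_ : _ `&` _ = `]a, b]%classic).
    by rewrite lebesgue_measure_itv /= lte_fin ab.
  apply/seteqP; split => x /=; rewrite /D /= !in_itv /= ?andbT; first by case.
  by move=> /andP[ax ->]; rewrite ax ltW// (le_lt_trans a0).
- move=> k; apply: (@le_lt_trans _ _ (cleb (sqr_disc k%:R))); last first.
    by rewrite complex_lebesgue_sqr_disc ltry.
  change (cleb ((fun z => normc z ^+ 2 : measurableTypeR R)%R @^-1` `](- k%:R)%R, k%:R]%classic)
    <= cleb (sqr_disc k%:R)).
  apply: le_measure; rewrite ?inE; last 2 first.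
  + exact: measurable_sqr_disc.
  + by move=> z; rewrite /sqr_disc /= in_itv /= => /andP[].
  by rewrite -[X in measurable X]setTI; apply: measurable_sqr_normc.
Qed.

(** The area of the unit disc is read off the Gaussian integral. *)
Lemma disc_area_pi : disc_area = pi.
Proof.
have mexp : measurable_fun setT (fun q : R => (expR (- q))%:E).
  apply/measurable_EFinP; apply: continuous_measurable_fun => x.
  by apply: continuous_comp; [exact: opp_continuous|exact: continuous_expR].
have e0 (q : R) : 0 <= (expR (- q))%:E by rewrite lee_fin expR_ge0.
have := ge0_integral_sqr_normc mexp e0.
have -> : \int[leb]_(q in `[0%R, +oo[) (expR (- q))%:E = 1.
  rewrite -(@integral_exponential_pdf R 1)// integral_mkcond.
  apply: eq_integral => q _; rewrite /exponential_pdf /= !patchE.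
  by case: ifP => // _; rewrite mul1r mulN1r.
have mgauss : measurable_fun setT (fun x : R => (gauss_fun x)%:E).
  by apply/measurable_EFinP; exact: measurable_gauss_fun.
have g0 (q : R) : 0 <= (gauss_fun q)%:E by rewrite lee_fin gauss_fun_ge0.
rewrite ge0_integral_complex_lebesgue//; last first.
  by apply: (measurableT_comp mexp); exact: measurable_sqr_normc.
under eq_integral => y _.
  rewrite (_ : integral _ _ _ = (gauss_fun y)%:E * (Num.sqrt pi)%:E); last first.
    rewrite -integralT_gauss -ge0_integralZl//.
    apply: eq_integral => x _; rewrite sqr_normc_Re_Im /= opprD expRD EFinM muleC.
    by rewrite /gauss_fun.
  over.
rewrite ge0_integralZr//.
rewrite integralT_gauss mule1 -EFinM -expr2 sqr_sqrtr ?pi_ge0//.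
by move=> [].
Qed.

Lemma is_derive_powerN (x : R) (j : nat) : x != 0%R ->
  is_derive x 1%R (fun q : R => q ^- j)%R (- (j%:R * x ^- j.+1))%R.
Proof.
move=> x0.
have dX : is_derive x 1%R (fun q : R => q ^+ j)%R (j%:R * x ^+ j.-1)%R.
  apply: is_derive_eq; first by rewrite -[X in is_derive _ _ X](exprfctE id);
    exact: is_deriveX.
  by rewrite /= /GRing.scale /= mulr1.
apply: is_derive_eq; first by apply: is_deriveV; exact: expf_neq0.
rewrite /GRing.scale /=; case: j {dX} => [|j]; first by rewrite mulr0n !mul0r mulr0 oppr0.
rewrite mulNr /=; congr (- _)%R; rewrite !exprS; field.
by rewrite x0 expf_neq0.
Qed.

Lemma integral_powerN_itv (a : R) (j : nat) : (0 < a)%R -> (0 < j)%N ->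
  \int[leb]_(q in `[a, +oo[) (q ^- j.+1)%:E = (a ^- j / j%:R)%:E.
Proof.
move=> a0 j0.
have jn0 : j%:R != 0%R :> R by rewrite pnatr_eq0 -lt0n.
pose F : R -> R := (- j%:R^-1)%R \*: (fun q : R => q ^- j)%R.
have dF (x : R) : (0 < x)%R -> is_derive x 1%R F (x ^- j.+1)%R.
  move=> x0; apply: is_derive_eq.
    by apply: is_deriveZ; apply: is_derive_powerN; rewrite gt_eqF.
  by rewrite /GRing.scale /= mulrNN mulrA mulVf// mul1r.
rewrite (@ge0_continuous_FTC2y R _ F a 0%R).
- by rewrite -EFinB sub0r /F /= /GRing.scale /= mulNr opprK mulrC.
- by move=> x ax; rewrite invr_ge0 exprn_ge0// (le_trans (ltW a0)).
- apply: derivable_within_continuous => x; rewrite in_itv /= andbT => ax.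
  have x0 : x != 0%R by rewrite gt_eqF// (lt_le_trans a0).
  by have [] := is_derive_powerN j.+1 x0.
- rewrite -[X in _ --> X](scaler0 _ (- j%:R^-1)%R); apply: cvgZl_tmp.
  apply/gtr0_cvgV0; first by near=> x; rewrite exprn_gt0.
  apply/cvgryPge => A; near=> x.
  apply: (@le_trans _ _ x); first by near: x; apply: nbhs_pinfty_ge; exact: num_real.
  by rewrite ler_eXnr//; near: x; apply: nbhs_pinfty_ge; exact: num_real.
- by move=> x ax; have [] := dF x (lt_trans a0 ax).
- apply: cvg_at_right_filter; apply: differentiable_continuous.
  by apply/derivable1_diffP; have [] := dF a a0.
- move=> x; rewrite in_itv /= andbT => ax.
  by rewrite derive1E; apply: derive_val; exact: (dF x (lt_trans a0 ax)).
Unshelve. all: by end_near. Qed.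

(** The squared norm, outside a disc, of a negative power of the variable; it
    gives both the tails of the jellium outside the support and the correlation
    integrals of the Bergman kernel. *)
Lemma integral_outer_power (t : R) (j : nat) : (0 < t)%R -> (0 < j)%N ->
  \int[cleb]_(z in [set z | (t <= normc z)%R]) (normc z ^- (2 * j.+1))%:E =
  (pi / j%:R * t ^- (2 * j))%:E.
Proof.
move=> t0 j0.
pose D := `[(t ^+ 2)%R, +oo[%classic : set (measurableTypeR R).
have mD : measurable D by exact: measurable_itv.
have t20 : (0 < t ^+ 2)%R by rewrite exprn_gt0.
pose h := (fun q : R => (q ^- j.+1)%:E) \_ D.
have h0 q : 0 <= h q.
  rewrite /h patchE; case: ifPn => //; rewrite inE /D /= in_itv /= andbT => tq.
  by rewrite lee_fin invr_ge0 exprn_ge0// (le_trans (ltW t20)).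
have mh : measurable_fun setT h.
  rewrite /h; apply/(measurable_restrictT _ mD).
  apply: (@eq_measurable_fun _ _ _ _ _ (fun q : R => ((`|q|^-1) ^+ j.+1)%:E)).
    move=> q; rewrite inE /D /= in_itv /= andbT => tq.
    by rewrite ger0_norm ?exprVn// (le_trans (ltW t20)).
  apply/measurable_EFinP; apply: measurable_funX; apply: measurable_funTS.
  by apply: measurable_inv_ge0 => //; exact: measurableT_comp.
have hE : \int[leb]_(q in `[0%R, +oo[) h q = (t ^- (2 * j) / j%:R)%:E.
  rewrite /h -integral_mkcondr setIidr; last first.
    by move=> q; rewrite /D /= !in_itv /= !andbT => /(le_trans (ltW t20)).
  by rewrite integral_powerN_itv// exprM.
have := ge0_integral_sqr_normc mh h0; rewrite disc_area_pi hE -EFinM mulrA mulrAC.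
move=> <-; rewrite integral_mkcond /h; apply: eq_integral => z _.
rewrite !patchE; congr (if _ then _ else _); last by rewrite -exprM.
apply/idP/idP; rewrite !inE /D /= in_itv /= andbT ler_pXn2r// nnegrE ?normc_ge0//;
  exact: ltW.
Qed.

End radial.

(** * Integration over the powers of the plane *)

Section lebesgue_Cn.
Variable R : realType.
Notation cleb := (complex_lebesgue R).
Notation leb n := (lebesgue_Cn R n).

Lemma ge0_integral_lebesgue_C0 (f : 0.-tuple R[i] -> \bar R) :
  measurable_fun setT f -> (forall x, (0 <= f x)%E) ->
  (\int[leb 0]_x f x = f [tuple])%E.
Proof.
move=> mf f0; transitivity (\int[\d_([tuple] : 0.-tuple R[i])]_x f x)%E.
  exact: eq_measure_integral.
by rewrite integral_dirac// diracT mul1e.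
Qed.

Lemma ge0_integral_lebesgue_CnS n (f : n.+1.-tuple R[i] -> \bar R) :
  measurable_fun setT f -> (forall x, (0 <= f x)%E) ->
  (\int[leb n.+1]_x f x = \int[cleb]_z \int[leb n]_x f (cons_pair (z, x)))%E.
Proof.
move=> mf f0.
have mg : measurable_fun setT (f \o @cons_pair R n).
  by apply: measurableT_comp => //; exact: measurable_cons_pair.
have E := ge0_integral_pushforward (@measurable_cons_pair R n)
  (cleb \x leb n)%E measurableT mf (fun x _ => f0 x).
rewrite preimage_setT in E.
rewrite -(fubini_tonelli1 (f \o @cons_pair R n) mg (fun p => f0 _)) -E.
by apply: eq_measure_integral; [exact: measurable_cons_pair|].
Qed.

Lemma measurable_cons_r n z :
  measurable_fun setT (fun x => @cons_pair R n (z, x)).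
Proof.
apply: (measurableT_comp (@measurable_cons_pair R n)).
by apply: measurable_fun_pair => //; exact: measurable_id.
Qed.

Lemma measurable_integral_cons n (f : n.+1.-tuple R[i] -> \bar R) :
  measurable_fun setT f -> (forall x, (0 <= f x)%E) ->
  measurable_fun setT (fun z => \int[leb n]_x f (cons_pair (z, x)))%E.
Proof.
move=> mf f0.
have mg : measurable_fun setT (f \o @cons_pair R n).
  by apply: measurableT_comp => //; exact: measurable_cons_pair.
exact: (measurable_fun_fubini_tonelli_F (f \o @cons_pair R n) mg (fun p => f0 _)).
Qed.

Lemma measurable_eprod d (T : measurableType d) (I : Type) (s : seq I)
    (F : I -> T -> \bar R) : (forall i, measurable_fun setT (F i)) ->
  measurable_fun setT (fun x => \prod_(i <- s) F i x)%E.
Proof.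
move=> mF; elim: s => [|i s IH].
  by under eq_fun do rewrite big_nil; exact: measurable_cst.
by under eq_fun do rewrite big_cons; exact: emeasurable_funM.
Qed.

Lemma measurable_prod_tnth n (g : 'I_n -> R[i] -> \bar R) :
  (forall i, measurable_fun setT (g i)) ->
  measurable_fun setT (fun x : n.-tuple R[i] => \prod_(i < n) g i (tnth x i))%E.
Proof.
move=> mg; apply: measurable_eprod => i.
by apply: measurableT_comp => //; exact: measurable_tnth.
Qed.

Lemma ge0_integral_prod n (g : 'I_n -> R[i] -> \bar R) :
  (forall i, measurable_fun setT (g i)) -> (forall i z, (0 <= g i z)%E) ->
  (\int[leb n]_x \prod_(i < n) g i (tnth x i) =
   \prod_(i < n) \int[cleb]_z g i z)%E.
Proof.
elim: n g => [|n IH] g mg g0.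
  rewrite ge0_integral_lebesgue_C0; first by rewrite !big_ord0.
    exact: measurable_prod_tnth.
  by move=> x; rewrite prode_ge0.
have mp := measurable_prod_tnth mg.
rewrite (ge0_integral_lebesgue_CnS mp); last by move=> x; rewrite prode_ge0.
rewrite big_ord_recl -IH//.
have mp' := measurable_prod_tnth (fun i => mg (lift ord0 i)).
have p0 (x : n.-tuple R[i]) : (0 <= \prod_(i < n) g (lift ord0 i) (tnth x i))%E.
  by rewrite prode_ge0.
rewrite -(ge0_integralZr _ measurableT (mg ord0)); [|by []|exact: integral_ge0].
apply: eq_integral => z _.
rewrite -(ge0_integralZl _ measurableT mp') => [|x _|]; [|exact: p0|exact: g0].
apply: eq_integral => x _; rewrite big_ord_recl; congr (_ * _)%E.
by apply: eq_bigr => i _; congr (g _ _); rewrite tnthS.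
Qed.

Definition rotate_tuple n (u : 'I_n -> R[i]) (x : n.-tuple R[i]) : n.-tuple R[i] :=
  [tuple u i * tnth x i | i < n].

Lemma measurable_rotate_tuple n (u : 'I_n -> R[i]) :
  measurable_fun setT (rotate_tuple u).
Proof.
apply/measurable_fun_tnthP => i.
rewrite (_ : _ \o _ = fun x => u i * tnth x i); last first.
  by apply/funext => x; rewrite /= tnth_mktuple.
by apply: measurable_complexM; [exact: measurable_cst|exact: measurable_tnth].
Qed.

Lemma ge0_integral_rotate_tuple n (u : 'I_n -> R[i]) (f : n.-tuple R[i] -> \bar R) :
  (forall i, normc (u i) = 1) ->
  measurable_fun setT f -> (forall x, (0 <= f x)%E) ->
  (\int[leb n]_x f (rotate_tuple u x) = \int[leb n]_x f x)%E.
Proof.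
elim: n u f => [|n IH] u f u1 mf f0.
  by apply: eq_integral => x _; congr f; apply: eq_from_tnth => -[].
have mfu : measurable_fun setT (f \o rotate_tuple u).
  by apply: measurableT_comp => //; exact: measurable_rotate_tuple.
rewrite (ge0_integral_lebesgue_CnS mfu (fun x => f0 _)).
rewrite (ge0_integral_lebesgue_CnS mf f0).
have mF := measurable_integral_cons mf f0.
rewrite -(ge0_integral_rotation (u1 ord0) mF); last first.
  by move=> z; apply: integral_ge0.
apply: eq_integral => z _.
pose fz x := f (cons_pair (u ord0 * z, x)).
have mfz : measurable_fun setT fz.
  by apply: measurableT_comp => //; exact: measurable_cons_r.
rewrite -(IH (fun i => u (lift ord0 i)) fz) => //; last first.
  by move=> x; exact: f0.
apply: eq_integral => x _; congr f; apply: eq_from_tnth => i.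
rewrite tnth_mktuple; case: (unliftP ord0 i) => [j|] ->; last by [].
by rewrite !tnthS tnth_mktuple.
Qed.

End lebesgue_Cn.

(** * Averages over roots of unity *)

Section roots_of_unity.
Variable R : realType.

(** Iterated square roots give roots of unity whose orders are powers of two. *)
Lemma exists_sqrt_chain (k : nat) : exists z : R[i], z ^+ (2 ^ k)%N = -1.
Proof.
suff [z] : exists z : R[i], z ^+ (2 ^ k)%N = -1 by exists z.
elim: k => [|k [z zk]]; first by exists (-1); rewrite expr1.
by exists (sqrtc z); rewrite expnS exprM sqr_sqrtc.
Qed.

Lemma normc_of_power1 (z : R[i]) n : (0 < n)%N -> normc (z ^+ n) = 1 ->
  normc z = 1.
Proof.
by move=> n0; rewrite normcX => /eqP; rewrite pexprn_eq1 ?normc_ge0// => /orP[|/eqP//];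
  rewrite eqn0Ngt n0.
Qed.

Lemma exists_root_of_unity (k : nat) :
  exists2 z : R[i], normc z = 1 & (2 ^ k.+1)%N.-primitive_root z.
Proof.
have [z zk] := exists_sqrt_chain k.
exists z.
  by apply: (@normc_of_power1 _ (2 ^ k)%N); rewrite ?expn_gt0// zk normcN normc1.
have zN : z ^+ (2 ^ k.+1)%N = 1 by rewrite expnSr exprM zk sqrrN expr1n.
have [m mz mN] := prim_order_exists (expn_gt0 2 k.+1) zN.
have /(dvdn_pfactor m k.+1 (isT : prime 2))[j jk mE] := mN.
suff jE : j = k.+1 by rewrite -jE -mE.
apply/eqP; rewrite eqn_leq jk ltnNge; apply/negP => jlek.
have : z ^+ (2 ^ k)%N = 1.
  by apply/eqP; rewrite -(prim_order_dvd mz) mE dvdn_exp2l.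
by rewrite zk => /eqP; rewrite -subr_eq0 -opprD oppr_eq0 (_ : 1 + 1 = 2%:R)// pnatr_eq0.
Qed.

Lemma sum_root_of_unity N (z : R[i]) (k l : nat) : normc z = 1 ->
  N.-primitive_root z -> (k < N)%N -> (l < N)%N ->
  \sum_(a < N) (z ^+ k * conjc z ^+ l) ^+ a = if k == l then N%:R else 0.
Proof.
move=> z1 zN kN lN; have zz : z * conjc z = 1.
  by rewrite -sqr_normcE z1 expr1n.
case: eqP => [->|kl].
  rewrite -exprMn zz expr1n.
  by under eq_bigr do rewrite expr1n; rewrite sumr_const card_ord.
set w := _ * _; have wN : w ^+ N = 1.
  have cN : conjc z ^+ N = 1 by rewrite -rmorphXn /= (prim_expr_order zN) rmorph1.
  rewrite exprMn [z ^+ k ^+ N]exprAC [conjc z ^+ l ^+ N]exprAC cN.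
  by rewrite (prim_expr_order zN) !expr1n mulr1.
have w1 : w != 1.
  apply/eqP => w1; apply: kl; apply/eqP; rewrite -(modn_small kN) -(modn_small lN).
  rewrite -[_ == _](eq_prim_root_expr zN); apply/eqP.
  transitivity (z ^+ k * (z * conjc z) ^+ l); first by rewrite zz expr1n mulr1.
  by rewrite exprMn mulrCA -/w w1 mulr1.
apply/eqP; have := subrX1 w N; rewrite wN subrr => /esym/eqP.
by rewrite mulf_eq0 subr_eq0 (negbTE w1).
Qed.

Lemma mul_exprM_exprM (A : comPzRingType) (w c v d : A) (a p q : nat) :
  (w ^+ a * v) ^+ p * (c ^+ a * d) ^+ q =
  (v ^+ p * d ^+ q) * (w ^+ p * c ^+ q) ^+ a.
Proof.
rewrite !exprMn -!exprM (mulnC p a) (mulnC q a) mulrACA mulrC.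
by [].
Qed.

(** Parseval: averaging a squared determinant over the finite torus kills
    the products of two different terms of its expansion. *)
Lemma sum_sqr_det_root_of_unity m N (z : R[i]) (y : 'I_m -> R[i])
    (e : 'I_m -> nat) : normc z = 1 -> N.-primitive_root z ->
  injective e -> (forall j, (e j < N)%N) ->
  \sum_(a : {ffun 'I_m -> 'I_N})
    normc (\det (\matrix_(i, j) (z ^+ a i * y i) ^+ e j)) ^+ 2 =
  (N ^ m)%:R * \sum_(s : 'S_m) \prod_(i < m) normc (y i) ^+ (2 * e (s i)) :> R.
Proof.
move=> z1 zN e_inj eN; apply: complexI.
rewrite rmorphM !rmorph_sum rmorph_nat mulr_sumr /=.
transitivity (\sum_(a : {ffun 'I_m -> 'I_N}) \sum_(s : 'S_m) \sum_(t : 'S_m)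
   ((-1) ^+ s * (-1) ^+ t) * \prod_(i < m)
     ((y i ^+ e (s i) * conjc (y i) ^+ e (t i)) *
      (z ^+ e (s i) * conjc z ^+ e (t i)) ^+ a i)).
  apply: eq_bigr => a _; rewrite sqr_normcE.
  rewrite /determinant rmorph_sum big_distrlr /=.
  apply: eq_bigr => s _; apply: eq_bigr => t _.
  rewrite rmorphM rmorph_sign rmorph_prod /= mulrACA -big_split /=.
  congr (_ * _); apply: eq_bigr => i _; rewrite !mxE rmorphXn rmorphM rmorphXn /=.
  exact: mul_exprM_exprM.
rewrite exchange_big; apply: eq_bigr => s _ /=; rewrite exchange_big /=.
have E (t : 'S_m) : \sum_(a : {ffun 'I_m -> 'I_N})
    (-1) ^+ s * (-1) ^+ t * \prod_(i < m)
     ((y i ^+ e (s i) * conjc (y i) ^+ e (t i)) *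
      (z ^+ e (s i) * conjc z ^+ e (t i)) ^+ a i) =
   if t == s then (N ^ m)%:R * \prod_(i < m) (normc (y i) ^+ (2 * e (s i)))%:C%C
   else 0 :> R[i].
  rewrite -mulr_sumr -(bigA_distr_bigA (fun i (a : 'I_N) =>
    (y i ^+ e (s i) * conjc (y i) ^+ e (t i)) *
      (z ^+ e (s i) * conjc z ^+ e (t i)) ^+ a)) /=.
  under eq_bigr => i _ do rewrite -mulr_sumr (sum_root_of_unity z1 zN)// (inj_eq e_inj).
  case: eqP => [->|/eqP ts].
    rewrite -expr2 sqrr_sign mul1r.
    under eq_bigr => i _ do rewrite eqxx -exprMn -sqr_normcE -rmorphXn -exprM mulrC /=.
    by rewrite big_split /= prodr_const card_ord natrX.
  have /existsP[i sti] : [exists i, s i != t i].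
    rewrite -negb_forall; apply: contra ts => /forallP st.
    by apply/eqP/permP => i; apply/esym/eqP.
  by rewrite (bigD1 i)//= (negbTE sti) mulr0 mul0r mulr0.
rewrite (eq_bigr _ (fun t _ => E t)) -big_mkcond big_pred1_eq.
by rewrite rmorph_prod.
Qed.

End roots_of_unity.

(** * Squared determinants of powers *)

Section andreief.
Variable R : realType.

Lemma sume_cst (I : finType) (x : \bar R) :
  (\sum_(i : I) x = #|I|%:R%:E * x)%E.
Proof. by rewrite sumr_const; exact/esym/mule_natl. Qed.

Notation cleb := (complex_lebesgue R).
Notation leb n := (lebesgue_Cn R n).

(** For a radial weight the powers of an equivariant function are orthogonal,
    so that the integral of the squared determinant is the permanent of a
    matrix with equal rows up to reordering. *)
Lemma integral_sqr_det m (psi : R[i] -> R[i]) (g : R[i] -> \bar R)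
    (e : 'I_m -> nat) :
  measurable_fun setT psi ->
  (forall u z, normc u = 1 -> psi (u * z) = u * psi z) ->
  measurable_fun setT g -> (forall z, (0 <= g z)%E) ->
  (forall u z, normc u = 1 -> g (u * z) = g z) ->
  injective e ->
  (\int[leb m]_x
    ((normc (\det (\matrix_(i, j) psi (tnth x i) ^+ e j)) ^+ 2)%:E *
     \prod_(i < m) g (tnth x i)) =
   m`!%:R%:E *
   \prod_(j < m) \int[cleb]_z ((normc (psi z) ^+ (2 * e j))%:E * g z))%E.
Proof.
move=> mpsi psi_rot mg g0 g_rot e_inj.
pose k := \max_j e j; pose N := (2 ^ k.+1)%N.
have eN j : (e j < N)%N.
  by rewrite (leq_ltn_trans (leq_bigmax j))// -/k (ltn_trans _ (ltn_expl k.+1 _)).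
have [z z1 zN] := exists_root_of_unity R k; rewrite -/N in zN.
have N0 : (0 < N)%N by rewrite expn_gt0.
pose F (x : m.-tuple R[i]) : \bar R :=
  ((normc (\det (\matrix_(i, j) psi (tnth x i) ^+ e j)) ^+ 2)%:E *
     \prod_(i < m) g (tnth x i))%E.
have F0 x : (0 <= F x)%E by rewrite mule_ge0// ?lee_fin ?sqr_ge0// prode_ge0.
have mF : measurable_fun setT F.
  apply: emeasurable_funM; last exact: (measurable_prod_tnth (fun=> mg)).
  apply/measurable_EFinP; apply: measurable_funX; apply: measurable_normc_comp.
  apply: measurable_det => i j; apply: measurable_complexX.
  by apply: measurableT_comp => //; exact: measurable_tnth.
have h0 (s : 'S_m) i w : (0 <= (normc (psi w) ^+ (2 * e (s i)))%:E * g w)%E.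
  by rewrite mule_ge0// lee_fin exprn_ge0// normc_ge0.
have mh (s : 'S_m) i :
    measurable_fun setT (fun w => (normc (psi w) ^+ (2 * e (s i)))%:E * g w)%E.
  apply: emeasurable_funM => //; apply/measurable_EFinP; apply: measurable_funX.
  exact: measurable_normc_comp.
pose u (a : {ffun 'I_m -> 'I_N}) i := z ^+ a i.
have u1 a i : normc (u a i) = 1 by rewrite normcX z1 expr1n.
suff E : ((N ^ m)%:R%:E * \int[leb m]_x F x = (N ^ m)%:R%:E * (m`!%:R%:E *
   \prod_(j < m) \int[cleb]_w ((normc (psi w) ^+ (2 * e j))%:E * g w)))%E.
  have n0 : (N ^ m)%:R != 0 :> R by rewrite pnatr_eq0 -lt0n expn_gt0 N0.
  move/(congr1 (fun t => ((N ^ m)%:R^-1)%:E * t)%E): E.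
  by rewrite !muleA -!EFinM mulVf// mul1e mul1r.
transitivity (\sum_(a : {ffun 'I_m -> 'I_N}) \int[leb m]_x F (rotate_tuple (u a) x))%E.
  rewrite (eq_bigr (fun=> \int[leb m]_x F x)%E) => [|a _]; last first.
    exact: ge0_integral_rotate_tuple.
  by rewrite sume_cst card_ffun !card_ord.
have mFu a : measurable_fun setT (fun x => F (rotate_tuple (u a) x)).
  by apply: measurableT_comp => //; exact: measurable_rotate_tuple.
rewrite -(ge0_integral_sum _ measurableT mFu (fun a x _ => F0 _)).
transitivity (\int[leb m]_x ((N ^ m)%:R%:E * \sum_(s : 'S_m)
   \prod_(i < m) ((normc (psi (tnth x i)) ^+ (2 * e (s i)))%:E * g (tnth x i))))%E.
  apply: eq_integral => x _.
  have := sum_sqr_det_root_of_unity (fun i => psi (tnth x i)) z1 zN e_inj eN.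
  move=> /(congr1 (fun t => (t%:E * \prod_(i < m) g (tnth x i))%E)).
  rewrite -sumEFin ge0_sume_distrl; last by move=> a _; rewrite lee_fin sqr_ge0.
  rewrite EFinM -muleA -sumEFin ge0_sume_distrl; last first.
    by move=> s _; rewrite lee_fin prodr_ge0// => i _; rewrite exprn_ge0// normc_ge0.
  under [in X in _ = X -> _]eq_bigr => s _.
    rewrite -prodEFin -big_split; over.
  move=> <-; apply: eq_bigr => a _; rewrite /F; congr (_ * _)%E.
    congr ((normc (\det _) ^+ 2)%:E); apply/matrixP => i j.
    by rewrite !mxE tnth_mktuple psi_rot.
  by apply: eq_bigr => i _; rewrite tnth_mktuple g_rot.
have ms (s : 'S_m) := measurable_prod_tnth (mh s).
have s0 (s : 'S_m) (x : m.-tuple R[i]) : (0 <= \prod_(i < m)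
    ((normc (psi (tnth x i)) ^+ (2 * e (s i)))%:E * g (tnth x i)))%E.
  by rewrite prode_ge0.
rewrite (ge0_integralZl _ measurableT); last 3 first.
- exact: emeasurable_sum.
- by move=> x _; rewrite sume_ge0.
- by rewrite lee_fin.
rewrite (ge0_integral_sum _ measurableT ms (fun s x _ => s0 s x)).
congr (_ * _)%E; rewrite (eq_bigr (fun=> \prod_(j < m) \int[cleb]_w
   ((normc (psi w) ^+ (2 * e j))%:E * g w))%E) => [|s _]; last first.
  rewrite (ge0_integral_prod (mh s) (h0 s)).
  by rewrite [RHS](reindex_inj (@perm_inj _ s)).
by rewrite sume_cst card_Sn.
Qed.

End andreief.

(** * The support of a measure on the plane *)

Section support.
Variable R : realType.

Lemma norm_complexE (z : R[i]^o) : `|z| = (normc z)%:C%C.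
Proof. by rewrite normc_def normc_Re_Im. Qed.

Lemma normc_le_Re_Im (z : R[i]) :
  normc z <= `|complex.Re z| + `|complex.Im z|.
Proof.
have -> : z = (complex.Re z)%:C%C + Complex 0 (complex.Im z).
  by case: z => x y; apply/eqP; rewrite eq_complex /= addr0 add0r !eqxx.
apply: le_trans (le_normcD _ _) _; rewrite normc_real /= addr0 add0r lerD2l.
by rewrite expr0n add0r sqrtr_sqr.
Qed.

Lemma open_normcP (U : set R[i]^o) :
  open U <-> forall z, U z -> exists2 e : R, 0 < e &
    forall w, normc (z - w) < e -> U w.
Proof.
rewrite openE; split => [oU z /oU|H z /H[e e0 eU]].
  move=> /nbhs_ballP[e /= e0 eU]; exists (complex.Re e).
    by move: e0; rewrite ltcE => /andP[].
  move=> w zw; apply: eU; rewrite -ball_normE /= norm_complexE.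
  by move: e0; rewrite !ltcE /= => /andP[-> _]; rewrite zw.
apply/nbhs_ballP; exists e%:C%C; first by rewrite /= ltcR.
by move=> w; rewrite -ball_normE /= norm_complexE ltcR; exact: eU.
Qed.

Definition rational_ball (i : rat * rat * nat) : set R[i] :=
  [set w | normc (Complex (ratr i.1.1) (ratr i.1.2) - w) < i.2.+1%:R^-1].

Lemma measurable_rational_ball i : measurable (rational_ball i).
Proof.
rewrite (_ : rational_ball i = setT `&`
    (fun w => normc (Complex (ratr i.1.1) (ratr i.1.2) - w)) @^-1`
    `]-oo, i.2.+1%:R^-1[%classic); last first.
  by apply/seteqP; split => w; rewrite /rational_ball /= in_itv /=; [split|case].
apply: measurable_normc_comp => //.
apply: measurable_complexD; first exact: measurable_cst.
by apply: measurable_complexN; exact: measurable_id.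
Qed.

Lemma exists_rational_ball (z : R[i]) (e : R) : 0 < e ->
  exists i, rational_ball i z /\ forall w, rational_ball i w -> normc (z - w) < e.
Proof.
move=> e0; pose n := Num.truncn (e / 2)^-1; pose dl : R := n.+1%:R^-1.
have dl0 : 0 < dl by rewrite invr_gt0.
have dle : dl < e / 2.
  rewrite /dl -[ltRHS]invrK ltf_pV2 ?posrE ?invr_gt0 ?divr_gt0//.
  exact: truncnS_gt.
have [p pz] : exists p : rat, `|ratr p - complex.Re z| < dl / 2.
  have /rat_in_itvoo[p] : complex.Re z - dl / 2 < complex.Re z + dl / 2 by lra.
  by rewrite in_itv /= => /andP[? ?]; exists p; rewrite ltr_norml; lra.
have [q qz] : exists q : rat, `|ratr q - complex.Im z| < dl / 2.
  have /rat_in_itvoo[p'] : complex.Im z - dl / 2 < complex.Im z + dl / 2 by lra.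
  by rewrite in_itv /= => /andP[? ?]; exists p'; rewrite ltr_norml; lra.
have zB : rational_ball (p, q, n) z.
  rewrite /rational_ball /= (le_lt_trans (normc_le_Re_Im _))// -/dl.
  by case: z pz qz => x y /= pz qz; lra.
exists (p, q, n); split => // w.
move: zB; rewrite /rational_ball /=; set c := Complex _ _ => cz cw.
rewrite (_ : z - w = (c - w) - (c - z)); last by ring.
apply: le_lt_trans (le_normcD _ _) _; rewrite normcN.
by move: cz cw dle; rewrite -/dl; lra.
Qed.

Lemma open_bigcup_rational_ball (U : set R[i]^o) : open U ->
  U = \bigcup_(i in [set i | rational_ball i `<=` U]) rational_ball i.
Proof.
move=> /open_normcP oU; apply/seteqP; split => [z /oU[e e0 eU]|z [k kU]];
  last exact: kU.
have [i [iz iU]] := exists_rational_ball z e0.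
by exists i => // w /iU; exact: eU.
Qed.

Lemma measurable_open_complex (U : set R[i]^o) : open U ->
  measurable (U : set R[i]).
Proof.
move=> oU; rewrite (open_bigcup_rational_ball oU) bigcup_mkcond.
apply: countable_bigcupT_measurable; first exact: countableP.
by move=> i; case: ifP => // _; exact: measurable_rational_ball.
Qed.

(** The complement of the support is a countable union of rational balls of
    measure zero. *)
Lemma negligible_measure_supportC (nu : probability R[i] R) :
  nu.-negligible [set z | ~ measure_support nu z].
Proof.
pose F (n : nat) : set R[i] := if unpickle n is Some i then
  if nu (rational_ball i) == 0%E then rational_ball i else set0
  else set0.
apply: (@negligibleS _ _ _ _ (\bigcup_n F n)).
  move=> z /= /existsNP[U] /not_implyP[[oU Uz]] /negP; rewrite -leNgt => nuU.
  have /open_normcP/(_ _ Uz)[e e0 eU] := oU.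
  have [i [iz iU]] := exists_rational_ball z e0.
  exists (pickle i); first by [].
  rewrite /F pickleK.
  suff -> : nu (rational_ball i) == 0%E by [].
  rewrite eq_le measure_ge0 andbT; apply: le_trans nuU; apply: le_measure; rewrite ?inE.
  - exact: measurable_rational_ball.
  - exact: measurable_open_complex.
  - by move=> w /iU; exact: eU.
apply: negligible_bigcup => n; rewrite /F.
case: unpickle => [i|]; last exact: negligible_set0.
case: eqP => [nu0|_]; last exact: negligible_set0.
by exists (rational_ball i); split => //; exact: measurable_rational_ball.
Qed.

End support.

Section outer_radius.
Variables (R : realType) (nu : probability R[i] R) (r : R).
Hypothesis nu_log : (\int[nu]_z `| log_modulus z | < +oo)%E.
Hypothesis r_outer : is_max [set normc z | z in measure_support nu] r.

Lemma measurable_normc_le (t : R) : measurable [set z : R[i] | normc z <= t].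
Proof.
rewrite (_ : [set z | _] = setT `&` @normc R @^-1` `]-oo, t]%classic); last first.
  by apply/seteqP; split => w; rewrite /= in_itv /=; [split|case].
by apply: measurable_normc => //; exact: measurable_itv.
Qed.

Lemma measurable_normc_lt (t : R) : measurable [set z : R[i] | normc z < t].
Proof.
rewrite (_ : [set z | _] = setT `&` @normc R @^-1` `]-oo, t[%classic); last first.
  by apply/seteqP; split => w; rewrite /= in_itv /=; [split|case].
by apply: measurable_normc => //; exact: measurable_itv.
Qed.

Lemma measurable_normc_gt (t : R) : measurable [set z : R[i] | t < normc z].
Proof.
rewrite (_ : [set z | _] = ~` [set z : R[i] | normc z <= t]).
  by apply: measurableC; exact: measurable_normc_le.
by apply/seteqP; split => z /=; rewrite ltNge => /negP.
Qed.

Lemma measurable_normc_ge (t : R) : measurable [set z : R[i] | t <= normc z].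
Proof.
rewrite (_ : [set z | _] = ~` [set z : R[i] | normc z < t]).
  by apply: measurableC; exact: measurable_normc_lt.
by apply/seteqP; split => z /=; rewrite leNgt => /negP.
Qed.

Lemma ae_normc_le_outer : {ae nu, forall w, normc w <= r}.
Proof.
apply: negligibleS (negligible_measure_supportC nu).
by move=> z /= zr sz; apply: zr; apply: r_outer.2; exists z.
Qed.

Lemma measure_normc_gt (rho : R) : rho < r ->
  (0 < nu [set w | (rho < normc w)%R])%E.
Proof.
move=> rhor; have [[z sz zr] _] := r_outer; apply: sz; split; last by rewrite /= zr.
apply/open_normcP => w /= rw; exists (normc w - rho); first by rewrite subr_gt0.
move=> v vw; rewrite -(ltrD2l (normc (w - v))).
have : normc w <= normc (w - v) + normc v.
  by rewrite -{1}(subrK v w); exact: le_normcD.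
by move: vw; lra.
Qed.

Lemma measurable_set1_complex (a : R[i]) : measurable [set a].
Proof.
rewrite (_ : [set a] = (fun z => a - z) @^-1` [set z : R[i] | normc z <= 0]).
  rewrite -[X in measurable X]setTI.
  have ma : measurable_fun setT (fun z : R[i] => a - z).
    apply: measurable_complexD; first exact: measurable_cst.
    by apply: measurable_complexN; exact: measurable_id.
  exact: (ma measurableT _ (measurable_normc_le 0)).
apply/seteqP; split => z /= => [->|]; first by rewrite subrr normc0.
move=> z0; apply/esym/eqP; rewrite -subr_eq0; apply/eqP; apply: eq0_normc.
by apply/eqP; rewrite eq_le z0 normc_ge0.
Qed.

Lemma measurable_log_modulus : measurable_fun setT (@log_modulus R).
Proof.
rewrite (_ : @log_modulus R = fun z => if normc z <= 0 then -oo%E else (ln (normc z))%:E)//.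
apply: measurable_fun_if => //.
- apply: (measurable_fun_ler (f := @normc R) (g := cst 0)) => //.
  exact: measurable_normc.
- apply/measurable_EFinP; apply: measurable_funTS.
  by apply: measurableT_comp => //; exact: measurable_normc.
Qed.

(** A mass at the origin would make the logarithm non-integrable. *)
Lemma measure_set1_0 : nu [set 0] = 0%E.
Proof.
have m0 := measurable_set1_complex 0.
apply/eqP; rewrite eq_le measure_ge0 andbT leNgt; apply/negP => nu0.
move: nu_log; rewrite ltNge => /negP; apply.
have mabs : measurable_fun setT (fun z : R[i] => `|log_modulus z|)%E.
  by apply: measurableT_comp => //; exact: measurable_log_modulus.
apply: (@le_trans _ _ (\int[nu]_(z in [set 0%R : R[i]]) `| log_modulus z |)%E); last first.
  exact: ge0_subset_integral.
rewrite (eq_integral (cst +oo%E)); last first.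
  by move=> z; rewrite inE /= => ->; rewrite /log_modulus normc0 /= lexx.
by rewrite integral_cst// gt0_mulye.
Qed.

Lemma outer_radius_gt0 : 0 < r.
Proof.
rewrite ltNge; apply/negP => r0.
have m0 := measurable_set1_complex 0.
have : nu.-negligible (~` [set 0]).
  apply: negligibleS ae_normc_le_outer => w /= w0 wr; apply: w0.
  by apply: eq0_normc; apply/eqP; rewrite eq_le normc_ge0 andbT (le_trans wr).
move/(measure_negligible (measurableC m0)) => nuC.
have := probability_setC nu m0; rewrite nuC measure_set1_0 sube0 => /eqP.
by rewrite eq_sym onee_eq0.
Qed.

End outer_radius.

(** * Averages of the logarithm over a rotation-invariant law *)

Lemma integral_cst_probability d (T : measurableType d) (R : realType)
    (P : probability T R) (x : \bar R) : (\int[P]_y cst x y = x)%E.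
Proof.
rewrite integral_cst//; transitivity (x * 1)%E; last by rewrite mule1.
by congr (_ * _)%E; exact: probability_setT.
Qed.

Section circle_average.
Variables (R : realType) (nu : probability R[i] R).
Hypothesis nu_rotation : rotation_invariant nu.
Hypothesis nu_0 : nu [set 0] = 0%E.

(** The value at the origin keeps the phase on the unit circle everywhere. *)
Definition phase (y : R[i]) : R[i] :=
  if normc y <= 0 then 1 else y * ((normc y)^-1)%:C%C.

Lemma normc_phase y : normc (phase y) = 1.
Proof.
rewrite /phase; case: ifPn => [_|]; first by rewrite normc1.
rewrite -ltNge => y0; rewrite normcM normc_real ger0_norm ?invr_ge0 ?ltW//.
by rewrite mulfV// gt_eqF.
Qed.

Lemma phaseM u y : normc u = 1 -> y != 0 -> phase (u * y) = u * phase y.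
Proof.
move=> u1; rewrite -normc_gt0 => y0; rewrite /phase normcM u1 mul1r.
by rewrite leNgt y0 /= mulrA.
Qed.

Lemma measurable_phase : measurable_fun setT phase.
Proof.
apply: measurable_fun_if => //.
- apply: (measurable_fun_ler (f := @normc R) (g := cst 0)) => //.
  exact: measurable_normc.
- apply: measurable_funTS; apply: measurable_complexM; first exact: measurable_id.
  apply: measurable_Complex => //; apply: measurable_inv_ge0.
    by move=> y; exact: normc_ge0.
  exact: measurable_normc.
Qed.

Lemma ge0_integral_nu_rotation u (f : R[i] -> \bar R) : normc u = 1 ->
  measurable_fun setT f -> (forall z, (0 <= f z)%E) ->
  (\int[nu]_z f (u * z)%R = \int[nu]_z f z)%E.
Proof.
move=> u1 mf f0.
have E := ge0_integral_pushforward (measurable_mulc u) nu measurableT mf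
  (fun x _ => f0 x).
rewrite preimage_setT in E; rewrite -[LHS]E.
apply: eq_measure_integral => [|m A mA _]; first exact: measurable_mulc.
exact: nu_rotation.
Qed.

Lemma ge0_integral_phase_rotation u (f : R[i] -> \bar R) : normc u = 1 ->
  measurable_fun setT f -> (forall z, (0 <= f z)%E) ->
  (\int[nu]_y f (u * phase y)%R = \int[nu]_y f (phase y))%E.
Proof.
move=> u1 mf f0.
have mfp : measurable_fun setT (f \o phase).
  by apply: measurableT_comp => //; exact: measurable_phase.
rewrite -(ge0_integral_nu_rotation u1 mfp (fun z => f0 _)).
apply: ge0_ae_eq_integral => //.
- apply: (measurableT_comp mf); apply: (measurableT_comp (measurable_mulc u)).
  exact: measurable_phase.
- by apply: (measurableT_comp mfp); exact: measurable_mulc.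
- by move=> x _; exact: f0.
- exists [set 0]; split; [exact: measurable_set1_complex|exact: nu_0|].
  move=> y /= H; apply/eqP; apply: contrapT => /negP y0; apply: H => _.
  by rewrite /= phaseM.
Qed.

Section distinct_moduli.
Variables (z w : R[i]).
Hypothesis zw : normc z != normc w.
Let M := Num.max (normc z) (normc w).
Let q := Num.min (normc z) (normc w) / M.

Let M_gt0 : 0 < M.
Proof.
rewrite /M lt_max !normc_gt0 -negb_and; apply/negP => /andP[/eqP z0 /eqP w0].
by move: zw; rewrite z0 w0 eqxx.
Qed.

Let min_lt : Num.min (normc z) (normc w) < M.
Proof.
by rewrite /M lt_max !gt_min !ltxx orbF orbC -neq_lt.
Qed.

Let q_ge0 : 0 <= q.
Proof. by rewrite divr_ge0 ?(ltW M_gt0)// le_min !normc_ge0. Qed.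

Let q_lt1 : q < 1.
Proof. by rewrite ltr_pdivrMr// mul1r. Qed.

Let dist N (u : R[i]) := normc (z ^+ N - (u * w) ^+ N).

Let dist_le N u : normc u = 1 -> dist N u <= 2 * M ^+ N.
Proof.
move=> u1; rewrite /dist; apply: le_trans (le_normcD _ _) _.
rewrite normcN !normcX normcM u1 mul1r mulrDl mul1r.
by apply: lerD; apply: lerXn2r; rewrite ?nnegrE ?normc_ge0 ?(ltW M_gt0)// /M
  le_max lexx ?orbT.
Qed.

Let dist_ge N u : (0 < N)%N -> normc u = 1 -> (1 - q) * M ^+ N <= dist N u.
Proof.
move=> N0 u1; apply: (@le_trans _ _ (M ^+ N - (q * M) ^+ N)).
  rewrite mulrBl mul1r lerD2l lerN2 exprMn ler_wpM2r ?exprn_ge0 ?(ltW M_gt0)//.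
  by rewrite -[leRHS]expr1 ler_wiXn2l// ltW.
rewrite /q divfK ?gt_eqF// /dist.
set x := z ^+ N; set y := (u * w) ^+ N.
have xE : normc x = normc z ^+ N by rewrite /x normcX.
have yE : normc y = normc w ^+ N by rewrite /y normcX normcM u1 mul1r.
have xy : normc x <= normc (x - y) + normc y.
  by rewrite -{1}(subrK y x); exact: le_normcD.
have yx : normc y <= normc (x - y) + normc x.
  rewrite -{1}(subrK x y); apply: le_trans (le_normcD _ _) _.
  by rewrite -(normcN (y - x)) opprB.
rewrite /M; case: (ltgtP (normc z) (normc w)) zw => // h _.
  by rewrite -xE -yE lerBlDr.
by rewrite -xE -yE lerBlDr.
Qed.

Let dist_gt0 N u : (0 < N)%N -> normc u = 1 -> 0 < dist N u.
Proof.
move=> N0 u1; apply: lt_le_trans (dist_ge N0 u1).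
by rewrite mulr_gt0 ?subr_gt0// exprn_gt0.
Qed.

Variable C : R.
Hypothesis MC : ln 2 + ln M <= C.

(** Squaring merges opposite points of the circle, so that the average of [G k]
    over the phases does not depend on [k]; for large [k] the power of the
    larger modulus dominates the distance. *)
Let G k u : R := C - ln (dist (2 ^ k) u) / (2 ^ k)%:R.

Let k2 k : 0 < (2 ^ k)%:R :> R.
Proof. by rewrite ltr0n expn_gt0. Qed.

Let ln_pow N (c : R) : 0 < c -> ln (c * M ^+ N) = ln c + N%:R * ln M.
Proof.
by move=> c0; rewrite lnM ?posrE ?exprn_gt0// lnXn// mulr_natl.
Qed.

Let G_ge k u : normc u = 1 -> C - ln M - ln 2 / (2 ^ k)%:R <= G k u.
Proof.
move=> u1; rewrite /G -addrA lerD2l -opprD lerN2.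
rewrite ler_pdivrMr// mulrDl divfK ?gt_eqF// addrC [ln M * _]mulrC -ln_pow//.
rewrite ler_ln ?posrE ?dist_le ?dist_gt0 ?expn_gt0//.
by rewrite mulr_gt0 ?exprn_gt0.
Qed.

Let G_le k u : normc u = 1 -> G k u <= C - ln M - ln (1 - q) / (2 ^ k)%:R.
Proof.
move=> u1; rewrite /G -addrA lerD2l -opprD lerN2.
have q1 : 0 < 1 - q by rewrite subr_gt0.
rewrite ler_pdivlMr// mulrDl divfK ?gt_eqF// addrC [ln M * _]mulrC -ln_pow//.
rewrite ler_ln ?posrE ?dist_gt0 ?expn_gt0//; last by rewrite mulr_gt0 ?exprn_gt0.
by rewrite dist_ge// expn_gt0.
Qed.

Let G_ge0 k u : normc u = 1 -> 0 <= G k u.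
Proof.
move=> u1; apply: le_trans (G_ge k u1).
rewrite subr_ge0 lerBrDr; apply: le_trans MC; rewrite lerD2r.
rewrite ler_pdivrMr// ler_peMr// ?ln_ge0 ?ler1n ?expn_gt0//.
Qed.

Let measurable_G k : measurable_fun setT (G k).
Proof.
apply: measurable_funB => //; apply: measurable_funM => //.
apply: measurableT_comp => //; apply: measurable_normc_comp.
apply: measurable_complexD; first exact: measurable_cst.
apply: measurable_complexN; apply: measurable_complexX.
by apply: measurable_complexM; [exact: measurable_id|exact: measurable_cst].
Qed.

Let J k := (\int[nu]_y (G k (phase y))%:E)%E.

Let measurable_Gphase k : measurable_fun setT (fun y => (G k (phase y))%:E).
Proof.
apply/measurable_EFinP; apply: (measurableT_comp (measurable_G k)).
exact: measurable_phase.
Qed.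

Let J_ge k : ((C - ln M - ln 2 / (2 ^ k)%:R)%:E <= J k)%E.
Proof.
have c0 : 0 <= C - ln M - ln 2 / (2 ^ k)%:R.
  rewrite subr_ge0 lerBrDr; apply: le_trans MC; rewrite lerD2r.
  by rewrite ler_pdivrMr// ler_peMr// ?ln_ge0 ?ler1n ?expn_gt0.
have <- : (\int[nu]_y (cst (C - ln M - ln 2 / (2 ^ k)%:R)%:E y) =
    (C - ln M - ln 2 / (2 ^ k)%:R)%:E)%E.
  exact: integral_cst_probability.
apply: ge0_le_integral => //.
by move=> y _; rewrite lee_fin G_ge// normc_phase.
Qed.

Let J_le k : (J k <= (C - ln M - ln (1 - q) / (2 ^ k)%:R)%:E)%E.
Proof.
have <- : (\int[nu]_y (cst (C - ln M - ln (1 - q) / (2 ^ k)%:R)%:E y) =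
    (C - ln M - ln (1 - q) / (2 ^ k)%:R)%:E)%E.
  exact: integral_cst_probability.
apply: ge0_le_integral => //.
- by move=> y _; rewrite lee_fin G_ge0// normc_phase.
- by move=> y _; rewrite lee_fin G_le// normc_phase.
Qed.

Let J_fin k : J k \is a fin_num.
Proof.
rewrite ge0_fin_numE; first by apply: le_lt_trans (J_le k) _; rewrite ltry.
by apply: integral_ge0 => y _; rewrite lee_fin G_ge0// normc_phase.
Qed.

(** Two opposite points on the circle are merged by squaring. *)
Let J_step k : J k.+1 = J k.
Proof.
have [a ak] := exists_sqrt_chain R k.
have a1 : normc a = 1.
  by apply: (@normc_of_power1 _ _ (2 ^ k)%N); rewrite ?expn_gt0// ak normcN normc1.
pose f u := (Num.max 0 (G k u))%:E.
have mf : measurable_fun setT f.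
  by apply/measurable_EFinP; exact: measurable_maxr.
have f0 u : (0 <= f u)%E by rewrite lee_fin le_max lexx.
have fE u : normc u = 1 -> f u = (G k u)%:E.
  by move=> u1; rewrite /f max_r// G_ge0.
have mfp : measurable_fun setT (fun y => f (phase y)).
  by apply: (measurableT_comp mf); exact: measurable_phase.
have mfa : measurable_fun setT (fun y => f (a * phase y)).
  apply: (measurableT_comp mf); apply: (measurableT_comp (measurable_mulc a)).
  exact: measurable_phase.
have E1 : (\int[nu]_y f (phase y) = J k)%E.
  by apply: eq_integral => y _; rewrite fE ?normc_phase.
have E2 : (\int[nu]_y f (a * phase y)%R = J k)%E.
  by rewrite (ge0_integral_phase_rotation a1 mf f0).
have dE u : dist (2 ^ k.+1) u = dist (2 ^ k) u * dist (2 ^ k) (a * u).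
  rewrite /dist -normcM; congr normc.
  by rewrite -(mulrA a) [(a * _) ^+ _]exprMn ak mulN1r opprK -subr_sqr -!exprM expnSr.
have GE u : normc u = 1 -> 2 * G k.+1 u = G k u + G k (a * u).
  move=> u1; have au1 : normc (a * u) = 1 by rewrite normcM a1 u1 mulr1.
  rewrite /G dE lnM ?posrE ?dist_gt0 ?expn_gt0// expnSr natrM.
  by field; rewrite gt_eqF.
have : (2%:E * J k.+1 = J k + J k)%E.
  rewrite -{1}E1 -E2 -(ge0_integralD _ measurableT _ mfp _ mfa)//.
  rewrite /J -(ge0_integralZl_EFin _ measurableT)//; last first.
    by move=> y _; rewrite lee_fin G_ge0// normc_phase.
  apply: eq_integral => y _; rewrite !fE ?normcM ?a1 ?normc_phase ?mulr1//.
  by rewrite -EFinM -EFinD GE// normc_phase.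
rewrite -(fineK (J_fin k)) -(fineK (J_fin k.+1)) -EFinM -EFinD => -[H].
by congr EFin; lra.
Qed.

Lemma ler_exp2_inv (a b D : R) : (forall k, a <= b + D / (2 ^ k)%:R) -> a <= b.
Proof.
move=> H; rewrite leNgt; apply/negP => ba.
pose k := Num.truncn (D / (a - b)); have ab : 0 < a - b by rewrite subr_gt0.
have := H k.+1; apply/negP; rewrite -ltNge -ltrBrDl ltr_pdivrMr ?ltr0n ?expn_gt0//.
rewrite mulrC -ltr_pdivrMr//; apply: lt_trans (truncnS_gt _) _.
by rewrite ltr_nat ltn_expl.
Qed.

Lemma integral_phase_log_neq :
  (\int[nu]_y (C - ln (normc (z - phase y * w)))%:E = (C - ln M)%:E)%E.
Proof.
have -> : (\int[nu]_y (C - ln (normc (z - phase y * w)))%:E)%E = J 0.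
  by apply: eq_integral => y _; rewrite /G /dist expn0 !expr1 divr1.
have JE k : J k = J 0 by elim: k => // k <-.
have JF := J_fin 0; rewrite -(fineK JF); congr EFin; apply/eqP.
rewrite eq_le; apply/andP; split.
  apply: (@ler_exp2_inv _ _ (- ln (1 - q))) => k.
  by have := J_le k; rewrite JE -(fineK JF) lee_fin mulNr.
rewrite -lerN2; apply: (@ler_exp2_inv _ _ (ln 2)) => k.
have := J_ge k; rewrite JE -(fineK JF) lee_fin; lra.
Qed.

End distinct_moduli.

(** Truncated to be nonnegative, so that its integrals make sense
    unconditionally; [C] is taken so large that nothing is cut on the support. *)
Definition neg_log (C : R) (t : R[i]) : \bar R :=
  maxe 0%E (C%:E - log_modulus t)%E.

Lemma neg_log_ge0 C t : (0 <= neg_log C t)%E.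
Proof. by rewrite /neg_log le_max lexx. Qed.

Lemma measurable_neg_log C : measurable_fun setT (neg_log C).
Proof.
apply: measurable_maxe => //; apply: emeasurable_funB => //.
exact: measurable_log_modulus.
Qed.

Lemma log_modulusE (t : R[i]) : t != 0 -> log_modulus t = (ln (normc t))%:E.
Proof. by rewrite -normc_gt0 => t0; rewrite /log_modulus lne_EFin. Qed.

Lemma neg_logE C t : t != 0 -> ln (normc t) <= C ->
  neg_log C t = (C - ln (normc t))%:E.
Proof.
move=> t0 tC; rewrite /neg_log log_modulusE// -EFinB max_r// lee_fin subr_ge0//.
Qed.

Lemma neg_log0 C : neg_log C 0 = +oo%E.
Proof. by rewrite /neg_log /log_modulus normc0 /= lexx /= max_r// leey. Qed.

Let ln_dist_le (z w u : R[i]) C : normc u = 1 -> 0 < Num.max (normc z) (normc w) ->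
  ln 2 + ln (Num.max (normc z) (normc w)) <= C -> z - u * w != 0 ->
  ln (normc (z - u * w)) <= C.
Proof.
move=> u1 M0 MC d0; apply: le_trans MC.
rewrite -lnM ?posrE// ler_ln ?posrE ?normc_gt0 ?mulr_gt0//.
apply: le_trans (le_normcD _ _) _.
rewrite normcN normcM u1 mul1r mulrDl mul1r.
by apply: lerD; rewrite le_max lexx ?orbT.
Qed.

Lemma integral_phase_neg_log_neq z w C : normc z != normc w ->
  ln 2 + ln (Num.max (normc z) (normc w)) <= C ->
  (\int[nu]_y neg_log C (z - phase y * w)%R =
   (C - ln (Num.max (normc z) (normc w)))%:E)%E.
Proof.
move=> zw MC; rewrite -(integral_phase_log_neq zw MC).
have M0 : 0 < Num.max (normc z) (normc w).
  rewrite lt_max !normc_gt0 -negb_and; apply/negP => /andP[/eqP z0 /eqP w0].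
  by move: zw; rewrite z0 w0 eqxx.
apply: eq_integral => y _.
have d0 : z - phase y * w != 0.
  rewrite subr_eq0; apply: contra zw => /eqP ->.
  by rewrite normcM normc_phase mul1r.
by rewrite neg_logE// ln_dist_le// normc_phase.
Qed.

(** On the circle through z, Fatou's lemma along the points (1 - 1/n) w gives
    the inequality without integrability of the logarithmic singularity. *)
Lemma integral_phase_neg_log_le z w C : 0 < Num.max (normc z) (normc w) ->
  ln 2 + ln (Num.max (normc z) (normc w)) <= C ->
  (\int[nu]_y neg_log C (z - phase y * w)%R <=
   (C - ln (Num.max (normc z) (normc w)))%:E)%E.
Proof.
move=> M0 MC.
have [zw|zw] := eqVneq (normc z) (normc w); last first.
  by rewrite integral_phase_neg_log_neq.
move: M0 MC; rewrite -zw maxxx => z0 zC.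
pose s (n : nat) : R := 1 - n.+1%:R^-1.
have s1 n : s n < 1 by rewrite /s gtrBl invr_gt0.
have s0 n : 0 <= s n by rewrite /s subr_ge0 invf_le1 ?ler1n.
pose ws n := (s n)%:C%C * w.
have wsE n : normc (ws n) = s n * normc z.
  by rewrite /ws normcM normc_real ger0_norm// zw.
have wsz n : normc (ws n) < normc z by rewrite wsE gtr_pMl.
have maxE n : Num.max (normc z) (normc (ws n)) = normc z.
  by rewrite max_l// ltW.
have IE n : (\int[nu]_y neg_log C (z - phase y * ws n)%R = (C - ln (normc z))%:E)%E.
  by rewrite integral_phase_neg_log_neq ?maxE// gt_eqF.
pose g n y := neg_log C (z - phase y * ws n).
have mg n : measurable_fun setT (g n).
  apply: (measurableT_comp (measurable_neg_log C)).
  apply: measurable_complexD; first exact: measurable_cst.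
  apply: measurable_complexN; apply: measurable_complexM; last exact: measurable_cst.
  exact: measurable_phase.
have := fatou nu measurableT mg (fun n y _ => neg_log_ge0 C _).
rewrite (_ : (fun n => \int[nu]_y g n y)%E = cst (C - ln (normc z))%:E); last first.
  by apply/funext => n; exact: IE.
rewrite (cvg_limn_einf_sup (cvg_cst _)).1; apply: le_trans.
rewrite le_eqVlt; apply/orP; left; apply/eqP; apply: eq_integral => y _.
suff cv : g ^~ y @ \oo --> neg_log C (z - phase y * w).
  by rewrite (cvg_limn_einf_sup cv).1.
set u := phase y; have u1 : normc u = 1 by exact: normc_phase.
pose t n := z - u * ws n.
have t0 n : t n != 0.
  rewrite subr_eq0; apply/eqP => E; have := wsz n.
  by rewrite E (normcM u) u1 mul1r ltxx.
have gE n : g n y = (C - ln (normc (t n)))%:E.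
  rewrite /g neg_logE//; first exact: t0.
  by apply: ln_dist_le; rewrite ?maxE// t0.
rewrite (_ : g ^~ y = EFin \o (fun n => C - ln (normc (t n)))); last first.
  by apply/funext => n; rewrite gE.
have [tz|tz] := eqVneq (z - u * w) 0.
  (* the limit point is the singularity itself *)
  have tE n : normc (t n) = normc z / n.+1%:R.
    rewrite /t /ws mulrCA (_ : u * w = z); last by apply/esym/eqP; rewrite -subr_eq0 tz.
    rewrite (_ : _ - _ = (n.+1%:R^-1)%:C%C * z); last first.
      rewrite /s rmorphB /= rmorph1; ring.
    by rewrite normcM normc_real ger0_norm ?invr_ge0// mulrC.
  rewrite tz neg_log0; apply/cvgeryP/cvgryPge => A; near=> n.
  rewrite tE lerBrDl -lerBrDr -ler_expR lnK ?posrE ?divr_gt0//.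
  rewrite ler_pdivrMr// -ler_pdivrMl ?expR_gt0//.
  apply: (@le_trans _ _ n%:R); last by rewrite ler_nat.
  by near: n; exact: nbhs_infty_ger.
rewrite neg_logE//; last by apply: ln_dist_le; rewrite -?zw ?maxxx.
apply: cvg_EFin; first by near=> n.
apply: cvgB; first exact: cvg_cst.
apply: (@continuous_cvg _ _ _ _ _ _ (@ln R)); first by apply: continuous_ln; rewrite normc_gt0.
apply: (@cvg_sub0 _ _ _ _ _ _ (cst (normc (z - u * w)))); last exact: cvg_cst.
have tE n : normc (t n - (z - u * w)) = normc z * n.+1%:R^-1.
  rewrite (_ : _ - _ = (n.+1%:R^-1)%:C%C * (u * w)); last first.
    rewrite /t /ws /s rmorphB /= rmorph1; ring.
  by rewrite normcM normc_real ger0_norm ?invr_ge0// normcM u1 mul1r -zw mulrC.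
have h0 : (fun n => normc z * n.+1%:R^-1) @ \oo --> (0 : R).
  by rewrite -[X in _ --> X](mulr0 (normc z)); apply: cvgMl_tmp; exact: cvg_harmonic.
apply: (@squeeze_cvgr _ _ _ _ (fun n => - (normc z * n.+1%:R^-1)) (fun n => normc z * n.+1%:R^-1)) => //.
  near=> n; rewrite -tE.
  change (- normc (t n - (z - u * w)) <= normc (t n) - normc (z - u * w) <=
    normc (t n - (z - u * w))).
  have := le_normcD (t n - (z - u * w)) (z - u * w); rewrite subrK.
  have := le_normcD (- (t n - (z - u * w))) (t n); rewrite normcN opprB subrK.
  by move=> ? ?; apply/andP; split; lra.
by rewrite -oppr0; apply: cvgN.
Unshelve. all: by end_near. Qed.

End circle_average.

(** * The potential of a rotation-invariant measure *)

Section potential.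
Variables (R : realType) (nu : probability R[i] R) (r : R).
Hypothesis nu_rotation : rotation_invariant nu.
Hypothesis nu_log : (\int[nu]_z `| log_modulus z | < +oo)%E.
Hypothesis r_outer : is_max [set normc z | z in measure_support nu] r.

Let nu_0 : nu [set 0] = 0%E.
Proof. exact: measure_set1_0. Qed.

Let r_gt0 : 0 < r.
Proof. exact: (outer_radius_gt0 nu_log r_outer). Qed.

Let ae_neq0 : {ae nu, forall w, w != 0}.
Proof.
exists [set 0]; split; [exact: measurable_set1_complex|exact: nu_0|].
by move=> w /= /negP; rewrite negbK => /eqP.
Qed.

Let integrable_log : nu.-integrable setT (@log_modulus R).
Proof. by apply/integrableP; split; [exact: measurable_log_modulus|]. Qed.

Let measurable_sub (z : R[i]) : measurable_fun setT (fun w : R[i] => z - w).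
Proof.
apply: measurable_complexD; first exact: measurable_cst.
by apply: measurable_complexN; exact: measurable_id.
Qed.

(** A bound of log |z - w| + log 2 for w in the support. *)
Definition log_bound (z : R[i]) : R := ln 2 + ln (Num.max (normc z) r).

Let mx (z w : R[i]) := Num.max (normc z) (normc w).

Let mx_le z w : normc w <= r -> 0 < mx z w -> ln 2 + ln (mx z w) <= log_bound z.
Proof.
move=> wr m0; have M0 : 0 < Num.max (normc z) r by rewrite lt_max r_gt0 orbT.
rewrite lerD2l ler_ln ?posrE//.
by rewrite /mx ge_max !le_max lexx wr orbT.
Qed.

Let measurable_neg_log_sub (c : R) z :
  measurable_fun setT (fun w : R[i] => neg_log c (z - w)).
Proof. exact: (measurableT_comp (measurable_neg_log c)). Qed.

(** By invariance, w may be rotated by the phase of an independent copy. *)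
Let integral_neg_log_average c z : (\int[nu]_w neg_log c (z - w)%R =
  \int[nu]_w \int[nu]_y neg_log c (z - phase y * w)%R)%E.
Proof.
pose F (p : R[i] * R[i]) := neg_log c (z - phase p.2 * p.1).
have mF : measurable_fun setT F.
  apply: (measurableT_comp (measurable_neg_log_sub c z)); apply: measurable_complexM.
    by apply: (measurableT_comp (@measurable_phase R)); exact: measurable_snd.
  exact: measurable_fst.
have F0 p : (0 <= F p)%E by exact: neg_log_ge0.
rewrite [RHS](fubini_tonelli F mF F0) /F /=.
transitivity (\int[nu]_y (cst (\int[nu]_w neg_log c (z - w)%R) y))%E.
  by rewrite integral_cst_probability.
apply: eq_integral => y _; apply: esym.
exact: (ge0_integral_nu_rotation nu_rotation (normc_phase y)
  (measurable_neg_log_sub c z) (fun w => neg_log_ge0 _ _)).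
Qed.

Let measurable_average c z :
  measurable_fun setT (fun w : R[i] => (\int[nu]_y neg_log c (z - phase y * w)%R)%E).
Proof.
pose F (p : R[i] * R[i]) := neg_log c (z - phase p.2 * p.1).
have mF : measurable_fun setT F.
  apply: (measurableT_comp (measurable_neg_log_sub c z)); apply: measurable_complexM.
    by apply: (measurableT_comp (@measurable_phase R)); exact: measurable_snd.
  exact: measurable_fst.
exact: (measurable_fun_fubini_tonelli_F F mF (fun p => neg_log_ge0 _ _)).
Qed.

Lemma integrable_ln : nu.-integrable setT (fun w : R[i] => (ln (normc w))%:E).
Proof.
apply: le_integrable integrable_log => //.
  apply/measurable_EFinP; apply: measurableT_comp => //; exact: measurable_normc.
move=> w _; have [->|w0] := eqVneq w 0; last by rewrite log_modulusE.
by rewrite /log_modulus normc0 /= lexx leey.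
Qed.

Let measurable_ln_max z : measurable_fun setT (fun w : R[i] => (ln (mx z w))%:E).
Proof.
apply/measurable_EFinP; apply: measurableT_comp => //.
by apply: measurable_maxr => //; exact: measurable_normc.
Qed.

Let integrable_ln_max z : nu.-integrable setT (fun w : R[i] => (ln (mx z w))%:E).
Proof.
have int_cst : nu.-integrable setT (fun=> (ln (normc z))%:E).
  by apply: finite_measure_integrable_cst.
apply: le_integrable (integrableD measurableT (integrable_abse int_cst)
  (integrable_abse integrable_ln)) => //= w _.
rewrite lee_fin [leRHS]ger0_norm ?addr_ge0// /mx.
by case: (leP (normc z) (normc w)) => _; rewrite ?lerDl ?lerDr.
Qed.

Let integrable_bound z :
  nu.-integrable setT (fun w : R[i] => (log_bound z - ln (mx z w))%:E).
Proof.
have int_cst : nu.-integrable setT (fun=> (log_bound z)%:E).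
  by apply: finite_measure_integrable_cst.
by have := integrableB measurableT int_cst (integrable_ln_max z).
Qed.

Let bound_ge0 z w : normc w <= r -> w != 0 -> 0 <= log_bound z - ln (mx z w).
Proof.
move=> wr w0; have m0 : 0 < mx z w by rewrite lt_max !normc_gt0 w0 orbT.
rewrite subr_ge0; apply: le_trans (mx_le wr m0).
by rewrite lerDr ln_ge0// ler1n.
Qed.

Let integral_neg_log_le z :
  (\int[nu]_w neg_log (log_bound z) (z - w)%R <=
   \int[nu]_w (log_bound z - ln (mx z w))%:E)%E.
Proof.
have mb : measurable_fun setT (fun w : R[i] => (log_bound z - ln (mx z w))%:E).
  exact: (measurable_int nu (integrable_bound z)).
rewrite integral_neg_log_average.
apply: (@le_trans _ _ (\int[nu]_w maxe 0 (log_bound z - ln (mx z w))%:E)%E).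
  apply: ae_ge0_le_integral => //.
  - by move=> w _; apply: integral_ge0 => y _; exact: neg_log_ge0.
  - by move=> w _; rewrite le_max lexx.
  - exact: measurable_maxe.
  - apply: filterS2 ae_neq0 (ae_normc_le_outer r_outer) => w w0 wr _.
    rewrite le_max; apply/orP; right; apply: integral_phase_neg_log_le => //.
      by rewrite lt_max !normc_gt0 w0 orbT.
    by apply: mx_le => //; rewrite lt_max !normc_gt0 w0 orbT.
rewrite le_eqVlt; apply/orP; left; apply/eqP.
apply: ae_eq_integral => //; first exact: measurable_maxe.
apply: filterS2 ae_neq0 (ae_normc_le_outer r_outer) => w w0 wr _.
by rewrite max_r// lee_fin bound_ge0.
Qed.

Let integrable_neg_log z :
  nu.-integrable setT (fun w : R[i] => neg_log (log_bound z) (z - w)).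
Proof.
apply/integrableP; split; first exact: measurable_neg_log_sub.
under eq_integral do rewrite gee0_abs ?neg_log_ge0//.
apply: le_lt_trans (integral_neg_log_le z) _.
have := integrable_fin_num measurableT (integrable_bound z).
by rewrite fin_numElt => /andP[].
Qed.

Lemma potentialE z : potential nu z =
  ((log_bound z)%:E - \int[nu]_w neg_log (log_bound z) (z - w)%R)%E.
Proof.
have int_cst : nu.-integrable setT (fun=> (log_bound z)%:E).
  by apply: finite_measure_integrable_cst.
transitivity (\int[nu]_w ((log_bound z)%:E - neg_log (log_bound z) (z - w)%R))%E.
  apply: ae_eq_integral => //.
  - apply: (measurableT_comp (@measurable_log_modulus R)); exact: measurable_sub.
  - by apply: emeasurable_funB => //; exact: measurable_neg_log_sub.
  - apply: filterS2 ae_neq0 (ae_normc_le_outer r_outer) => w w0 wr _.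
    have [->|zw] := eqVneq z w.
      by rewrite subrr neg_log0 /log_modulus normc0 /= lexx.
    have zw0 : z - w != 0 by rewrite subr_eq0.
    rewrite neg_logE ?log_modulusE// -?EFinB; first by congr EFin; ring.
    rewrite /log_bound -lnM ?posrE ?lt_max ?r_gt0 ?orbT//.
    rewrite ler_ln ?posrE ?normc_gt0 ?mulr_gt0 ?lt_max ?r_gt0 ?orbT//.
    apply: le_trans (le_normcD _ _) _; rewrite normcN mulrDl mul1r.
    by apply: lerD; rewrite le_max ?lexx ?wr ?orbT.
rewrite (integralB measurableT int_cst (integrable_neg_log z)).
by congr (_ - _)%E; exact: integral_cst_probability.
Qed.

Lemma potential_fin z : potential nu z \is a fin_num.
Proof.
rewrite potentialE fin_numB /=.
exact: (integrable_fin_num measurableT (integrable_neg_log z)).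
Qed.

Let integral_boundE z : (\int[nu]_w (log_bound z - ln (mx z w))%:E =
  (log_bound z)%:E - \int[nu]_w (ln (mx z w))%:E)%E.
Proof.
have int_cst : nu.-integrable setT (fun=> (log_bound z)%:E).
  by apply: finite_measure_integrable_cst.
have := integralB measurableT int_cst (integrable_ln_max z).
have -> : (\int[nu]_x (cst (log_bound z)%:E x) = (log_bound z)%:E)%E.
  exact: integral_cst_probability.
by [].
Qed.

(** The average of log |z - w| over the circle of [w] is at least the logarithm
    of the larger modulus. *)
Lemma potential_ge z :
  (\int[nu]_w (ln (Num.max (normc z) (normc w)))%:E <= potential nu z)%E.
Proof.
rewrite potentialE; have := integral_neg_log_le z; rewrite integral_boundE.
have := integrable_fin_num measurableT (integrable_neg_log z).
have := integrable_fin_num measurableT (integrable_ln_max z).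
rewrite /mx; set a := (\int[nu]_w _)%E; set b := (\int[nu]_w _)%E.
by move=> /fineK <- /fineK <-; rewrite -!EFinB !lee_fin; lra.
Qed.

(** Almost every [w] has a smaller modulus than [z], and the average over the
    circle of [w] is then exactly log |z|. *)
Lemma potential_outer z : r < normc z -> potential nu z = (ln (normc z))%:E.
Proof.
move=> rz; rewrite potentialE integral_neg_log_average.
rewrite (@ae_eq_integral _ _ _ nu setT (cst (log_bound z - ln (normc z))%:E)) //.
- have -> : (\int[nu]_y (cst (log_bound z - ln (normc z))%:E) y =
      (log_bound z - ln (normc z))%:E)%E.
    exact: integral_cst_probability.
  by rewrite -EFinB; congr EFin; ring.
- apply: filterS2 ae_neq0 (ae_normc_le_outer r_outer) => w w0 wr _.
  have wz : normc w < normc z by exact: le_lt_trans rz.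
  have mE : Num.max (normc z) (normc w) = normc z by rewrite max_l// ltW.
  rewrite integral_phase_neg_log_neq ?mE//; first by rewrite gt_eqF.
  by rewrite -mE; apply: mx_le; rewrite // /mx mE (lt_trans r_gt0).
Qed.

Let ln_max_ge z w : w != 0 -> ln (normc w) <= ln (mx z w).
Proof.
move=> w0; rewrite ler_ln ?posrE ?normc_gt0//; last by rewrite lt_max !normc_gt0 w0 orbT.
by rewrite le_max lexx orbT.
Qed.

Lemma potential_ge_cst z : (\int[nu]_w (ln (normc w))%:E <= potential nu z)%E.
Proof.
apply: le_trans (potential_ge z).
have := integrable_fin_num measurableT integrable_ln.
have [f1 f2] := (integrable_ln, integrable_ln_max z).
rewrite -sube_ge0 ?(integrable_fin_num measurableT integrable_ln) => [_|]; last first.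
  by apply/orP; left.
have := integralB measurableT f2 f1; rewrite /mx => <-.
rewrite (_ : integral _ _ _ =
    \int[nu]_w maxe 0 ((ln (mx z w))%:E - (ln (normc w))%:E))%E.
  by apply: integral_ge0 => w _; rewrite le_max lexx.
have mf1 := measurable_int nu f1; have mf2 := measurable_int nu f2.
apply: ae_eq_integral => //.
- exact: emeasurable_funB.
- by apply: measurable_maxe => //; exact: emeasurable_funB.
- apply: filterS ae_neq0 => w w0 _.
  by apply/esym/max_r; rewrite -EFinB lee_fin subr_ge0 ln_max_ge.
Qed.

(** The points [w] with modulus close to [r] have positive measure, and for them
    the average over the circle is larger than log |z| by a fixed amount. *)
Lemma potential_gt_log z : z != 0 -> normc z < r ->
  ((ln (normc z))%:E < potential nu z)%E.
Proof.
rewrite -normc_gt0 => z0 zr; apply: lt_le_trans (potential_ge z).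
pose rho := (normc z + r) / 2.
have zrho : normc z < rho by rewrite /rho; lra.
have rhor : rho < r by rewrite /rho; lra.
pose A := [set w : R[i] | rho < normc w].
have mA : measurable A by exact: measurable_normc_gt.
pose c := ln rho - ln (normc z).
have c0 : 0 < c by rewrite subr_gt0 ltr_ln// posrE// (lt_trans z0).
have int_cst : nu.-integrable setT (fun=> (ln (normc z))%:E).
  by apply: finite_measure_integrable_cst.
have ms0 w : 0 <= ln (mx z w) - ln (normc z).
  by rewrite subr_ge0 ler_ln ?posrE ?lt_max ?z0// le_max lexx.
have : (0 < \int[nu]_w ((ln (mx z w))%:E - (ln (normc z))%:E))%E.
  apply: (@lt_le_trans _ _ (c%:E * nu A)%E).
    by apply: mule_gt0 => //; exact: (measure_normc_gt r_outer rhor).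
  rewrite -(setIT A) -integral_indic// -(ge0_integralZl_EFin _ measurableT _ _ (ltW c0))//; last first.
    by apply/measurable_EFinP; exact: measurable_indic.
  apply: ge0_le_integral => //.
  - by move=> w _; rewrite mule_ge0// lee_fin ltW.
  - apply: emeasurable_funM => //; apply/measurable_EFinP; exact: measurable_indic.
  - by apply: emeasurable_funB.
  - move=> w _; rewrite indicE -EFinB -EFinM lee_fin.
    have [|_] := boolP (w \in A); last by rewrite mulr0 ms0.
    rewrite inE /A /= mulr1 lerD2r => rw; have rho0 : 0 < rho by exact: lt_trans zrho.
    rewrite ler_ln ?posrE// ?lt_max ?z0//.
    by rewrite le_max (ltW rw) orbT.
rewrite integralB//.
have -> : (\int[nu]_x (cst (ln (normc z))%:E x) = (ln (normc z))%:E)%E.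
  exact: integral_cst_probability.
by rewrite sube_gt0.
Qed.

Lemma potential_rotation u z : normc u = 1 -> potential nu (u * z) = potential nu z.
Proof.
move=> u1; rewrite !potentialE.
have -> : log_bound (u * z) = log_bound z by rewrite /log_bound normcM u1 mul1r.
congr (_ - _)%E.
rewrite -(ge0_integral_nu_rotation nu_rotation u1 (measurable_neg_log_sub _ _)
  (fun w => neg_log_ge0 _ _)).
apply: eq_integral => w _.
by rewrite /neg_log /log_modulus -mulrBr normcM u1 mul1r.
Qed.

Lemma measurable_potential : measurable_fun setT (potential nu).
Proof.
rewrite (_ : potential nu = fun z => ((log_bound z)%:E -
  \int[nu]_w neg_log (log_bound z) (z - w)%R)%E); last first.
  by apply/funext => z; exact: potentialE.
have mB : measurable_fun setT log_bound.
  apply: measurable_funD => //; apply: measurableT_comp => //.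
  by apply: measurable_maxr => //; exact: measurable_normc.
apply: emeasurable_funB; first exact/measurable_EFinP.
pose F (p : R[i] * R[i]) := neg_log (log_bound p.1) (p.1 - p.2).
have mF : measurable_fun setT F.
  apply: measurable_maxe => //; apply: emeasurable_funB.
    by apply/measurable_EFinP; exact: (measurableT_comp mB measurable_fst).
  apply: (measurableT_comp (@measurable_log_modulus R)).
  apply: measurable_complexD; first exact: measurable_fst.
  by apply: measurable_complexN; exact: measurable_snd.
exact: (measurable_fun_fubini_tonelli_F F mF (fun p => neg_log_ge0 _ _)).
Qed.

End potential.

(** * Euler products and the limit law *)

Section euler.
Variable R : realType.
Implicit Types (x y : R) (n K : nat).

Lemma prod_onem_itv (I : Type) (s : seq I) (P : pred I) (x : I -> R) :
  (forall i, 0 <= x i <= 1) -> 0 <= \prod_(i <- s | P i) (1 - x i) <= 1.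
Proof.
move=> x01; elim/big_ind : _ => [|a b /andP[a0 a1] /andP[b0 b1]|i _].
- by rewrite ler01 lexx.
- by rewrite mulr_ge0// mulr_ile1.
- by have /andP[? ?] := x01 i; rewrite subr_ge0 gerBl; apply/andP.
Qed.

(** Each new factor [1 - x k] multiplies a number of the unit interval, hence
    lowers the product by at most [x k]. *)
Lemma prod_onem_cut (x : nat -> R) K n : (forall i, 0 <= x i <= 1) -> (K <= n)%N ->
  0 <= \prod_(0 <= k < K) (1 - x k) - \prod_(0 <= k < n) (1 - x k) <=
  \sum_(K <= k < n) x k.
Proof.
move=> x01; elim: n => [|n IH].
  by rewrite leqn0 => /eqP ->; rewrite subrr big_geq// lexx.
rewrite leq_eqVlt => /predU1P[->|Kn]; first by rewrite subrr big_geq// lexx.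
have /andP[IH0 IH1] := IH Kn.
have /andP[p0 p1] := prod_onem_itv (index_iota 0 n) xpredT x01.
have /andP[x0 x1] := x01 n.
rewrite (big_nat_recr n) //= [X in _ <= _ <= X](big_nat_recr n)//=.
set p := \prod_(0 <= k < n) _ in p0 p1 IH0 IH1 *.
have : 0 <= p * x n <= x n by rewrite mulr_ge0//= ler_piMl.
move=> /andP[px0 px1]; rewrite mulrBr mulr1; apply/andP; split; lra.
Qed.

Definition euler_prod n x : R := \prod_(0 <= k < n) (1 - x ^+ k.+1).

Let pow01 x k : 0 <= x <= 1 -> 0 <= x ^+ k.+1 <= 1.
Proof. by move=> /andP[x0 x1]; rewrite exprn_ge0//= exprn_ile1. Qed.

Lemma euler_prod_itv n x : 0 <= x <= 1 -> 0 <= euler_prod n x <= 1.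
Proof. by move=> x01; apply: prod_onem_itv => k; exact: pow01. Qed.

Lemma euler_prod_nonincreasing x : 0 <= x <= 1 ->
  nonincreasing_seq (euler_prod ^~ x).
Proof.
move=> x01 m n mn; rewrite -subr_ge0.
by have /andP[] := prod_onem_cut (fun k => pow01 k x01) mn.
Qed.

Lemma geometric_tail x K n : 0 <= x < 1 ->
  \sum_(K <= k < n) x ^+ k.+1 <= x ^+ K.+1 / (1 - x).
Proof.
move=> /andP[x0 x1]; have x1' : 0 < 1 - x by rewrite subr_gt0.
rewrite ler_pdivlMr//.
have [nK|Kn] := leqP n K; first by rewrite big_geq// mul0r exprn_ge0.
rewrite mulr_suml (eq_bigr (fun k => - x ^+ k.+2 - - x ^+ k.+1)); last first.
  by move=> k _; rewrite mulrBr mulr1 -exprSr opprK addrC.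
rewrite (telescope_sumr (fun k => - x ^+ k.+1)) ?(ltnW Kn)//.
by rewrite opprK addrC gerBl exprn_ge0.
Qed.

(** Euler's function, the product of the numbers 1 - x^k over k > 0. *)
Definition euler x : R := limn (euler_prod ^~ x).

Lemma cvg_euler x : 0 <= x <= 1 -> euler_prod ^~ x @ \oo --> euler x.
Proof.
move=> x01; apply: nonincreasing_is_cvgn; first exact: euler_prod_nonincreasing.
by exists 0 => _ [n _ <-]; have /andP[] := euler_prod_itv n x01.
Qed.

Lemma euler_le_prod n x : 0 <= x <= 1 -> euler x <= euler_prod n x.
Proof.
move=> x01; apply: limr_le; first by apply/cvg_ex; exists (euler x); exact: cvg_euler.
by near=> m; apply: euler_prod_nonincreasing => //; near: m; exact: nbhs_infty_ge.
Unshelve. all: by end_near. Qed.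

Lemma euler_ge0 x : 0 <= x <= 1 -> 0 <= euler x.
Proof.
move=> x01; apply: limr_ge; first by apply/cvg_ex; exists (euler x); exact: cvg_euler.
by near=> m; have /andP[] := euler_prod_itv m x01.
Unshelve. all: by end_near. Qed.

Lemma euler_le1 x : 0 <= x <= 1 -> euler x <= 1.
Proof.
move=> x01; apply: (le_trans (euler_le_prod 0 x01)).
by have /andP[] := euler_prod_itv 0 x01.
Qed.

Lemma euler_tail n x : 0 <= x < 1 ->
  euler_prod n x - euler x <= x ^+ n.+1 / (1 - x).
Proof.
move=> x01; have x01' : 0 <= x <= 1 by case/andP: x01 => -> /ltW.
rewrite lerBlDl -lerBlDr; apply: limr_ge.
  by apply/cvg_ex; exists (euler x); exact: cvg_euler.
near=> m; have nm : (n <= m)%N by near: m; exact: nbhs_infty_ge.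
have /andP[_] := prod_onem_cut (fun k => pow01 k x01') nm.
rewrite -/(euler_prod n x) -/(euler_prod m x) => H.
by rewrite lerBlDr -lerBlDl (le_trans H)// geometric_tail.
Unshelve. all: by end_near. Qed.

Lemma euler_prod_antitone n x y : 0 <= x -> x <= y -> y <= 1 ->
  euler_prod n y <= euler_prod n x.
Proof.
move=> x0 xy y1; have y0 := le_trans x0 xy.
apply: ler_prod => k _; have /andP[_ h] := pow01 k (introT andP (conj y0 y1)).
by rewrite subr_ge0 h lerD2l lerN2 lerXn2r ?nnegrE.
Qed.

Lemma euler_antitone x y : 0 <= x -> x <= y -> y <= 1 -> euler y <= euler x.
Proof.
move=> x0 xy y1; have y0 := le_trans x0 xy; have x1 := le_trans xy y1.
apply: ler_lim.
- by apply/cvg_ex; exists (euler y); apply: cvg_euler; rewrite y0.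
- by apply/cvg_ex; exists (euler x); apply: cvg_euler; rewrite x0.
- by near=> n; exact: euler_prod_antitone.
Unshelve. all: by end_near. Qed.

Lemma euler1 : euler 1 = 0.
Proof.
apply/eqP; rewrite eq_le euler_ge0 ?ler01 ?lexx// andbT.
apply: le_trans (euler_le_prod 1 _) _; first by rewrite ler01 lexx.
by rewrite /euler_prod big_nat1 expr1 subrr.
Qed.

Lemma continuous_euler_prod n : continuous (euler_prod n).
Proof.
move=> x; elim: n => [|n IH].
  by rewrite /euler_prod; under eq_fun do rewrite big_geq//; exact: cvg_cst.
rewrite /continuous_at /euler_prod big_nat_recr//=.
under eq_fun do rewrite big_nat_recr//=.
apply: cvgM; first exact: IH.
by apply: cvgB; [exact: cvg_cst|exact: exprn_continuous].
Qed.

Lemma exists_exp_lt x e : 0 <= x < 1 -> 0 < e -> exists K, x ^+ K.+1 <= e.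
Proof.
move=> /andP[x0 x1] e0.
have : x ^+ n @[n --> \oo] --> 0 by apply: cvg_expr; rewrite ger0_norm.
move=> /cvgrPdist_le/(_ _ e0)[K _ HK]; exists K.
by have := HK K.+1 (leqnSn K); rewrite sub0r normrN ger0_norm// exprn_ge0.
Qed.

(** The partial products are continuous and converge uniformly on a
    neighbourhood of [x] that stays away from 1. *)
Lemma continuous_euler x : 0 < x < 1 -> {for x, continuous euler}.
Proof.
move=> /andP[x0 x1]; pose c := (1 + x) / 2.
have xc : x < c by rewrite /c; lra.
have c1 : c < 1 by rewrite /c; lra.
have c0 : 0 < c by exact: lt_trans xc.
apply/cvgrPdist_le => e e0.
have [K Ke] : exists K, c ^+ K.+1 / (1 - c) <= e / 3.
  have ec : 0 < (e / 3) * (1 - c) by rewrite mulr_gt0 ?subr_gt0// divr_gt0.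
  have [K HK] := exists_exp_lt (introT andP (conj (ltW c0) c1)) ec.
  by exists K; rewrite ler_pdivrMr ?subr_gt0.
have tail y : 0 <= y <= c -> 0 <= euler_prod K y - euler y <= e / 3.
  move=> /andP[y0 yc]; have y1 : y < 1 by exact: le_lt_trans c1.
  rewrite subr_ge0 euler_le_prod ?y0 ?(ltW y1)//=.
  apply: le_trans (euler_tail K _) _; first by rewrite y0.
  apply: le_trans Ke; apply: ler_pM; rewrite ?exprn_ge0 ?invr_ge0 ?subr_ge0 ?(ltW y1)//.
    by rewrite lerXn2r ?nnegrE// ltW.
  by rewrite lef_pV2 ?posrE ?subr_gt0// lerD2l lerN2.
have /cvgrPdist_le/(_ (e / 3)) := @continuous_euler_prod K x.
move=> /(_ ltac:(by rewrite divr_gt0)) cK.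
near=> y.
have y0 : 0 < y by near: y; exact: lt_nbhsr.
have yc : y < c by near: y; exact: lt_nbhsl.
have /andP[tx0 tx1] := tail x ltac:(by rewrite (ltW x0) (ltW xc)).
have /andP[ty0 ty1] := tail y ltac:(by rewrite (ltW y0) (ltW yc)).
have : `|euler_prod K x - euler_prod K y| <= e / 3 by near: y; exact: cK.
rewrite !ler_norml => /andP[h1 h2]; apply/andP; split; lra.
Unshelve. all: by end_near. Qed.

Definition euler_cdf (t : R) : R := if t <= 1 then 0 else euler (t ^- 2).

Let inv_sqr_itv (t : R) : 1 < t -> 0 < t ^- 2 < 1.
Proof.
move=> t1; have t0 : 0 < t by exact: lt_trans t1.
by rewrite invr_gt0 exprn_gt0//= invf_lt1 ?exprn_gt0// exprn_egt1.
Qed.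

Lemma euler_cdf_nondecreasing : nondecreasing euler_cdf.
Proof.
move=> s t st; rewrite /euler_cdf; case: (leP t 1) => [t1|t1].
  by rewrite (le_trans st t1).
have /andP[i0 i1] := inv_sqr_itv t1.
case: (leP s 1) => [s1|s1]; first by rewrite euler_ge0// !ltW.
have /andP[j0 j1] := inv_sqr_itv s1; have s0 : 0 < s by exact: lt_trans s1.
apply: euler_antitone; rewrite ?(ltW i0) ?(ltW j1)//.
by rewrite lef_pV2 ?posrE ?exprn_gt0 ?(lt_le_trans s0)// lerXn2r ?nnegrE ?(ltW s0)// (le_trans (ltW s0)).
Qed.

Lemma euler_cdfE t : 1 <= t -> euler_cdf t = euler (t ^- 2).
Proof.
rewrite le_eqVlt /euler_cdf => /predU1P[<-|]; last by rewrite ltNge => /negbTE ->.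
by rewrite lexx expr1n invr1 euler1.
Qed.

Lemma euler_cdf_le (t : R) : 1 <= t -> euler_cdf t <= 1 - t ^- 2.
Proof.
rewrite le_eqVlt => /predU1P[<-|t1].
  by rewrite /euler_cdf lexx expr1n invr1 subrr.
have /andP[i0 i1] := inv_sqr_itv t1.
rewrite (euler_cdfE (ltW t1)); apply: le_trans (euler_le_prod 1 _) _.
  by rewrite !ltW.
by rewrite /euler_prod big_nat1 expr1.
Qed.

Let continuous_inv_sqr (t : R) : 0 < t -> (fun s : R => s ^- 2) @ t --> t ^- 2.
Proof.
move=> t0; apply: cvgV; first by rewrite expf_neq0// gt_eqF.
exact: exprn_continuous.
Qed.

Lemma euler_cdf_ge0 t : 0 <= euler_cdf t.
Proof.
rewrite /euler_cdf; case: (leP t 1) => // t1; have /andP[i0 i1] := inv_sqr_itv t1.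
by rewrite euler_ge0// !ltW.
Qed.

Lemma euler_cdf_le1 t : euler_cdf t <= 1.
Proof.
rewrite /euler_cdf; case: (leP t 1) => // t1; have /andP[i0 i1] := inv_sqr_itv t1.
by rewrite euler_le1// !ltW.
Qed.

Lemma continuous_euler_cdf : continuous euler_cdf.
Proof.
move=> t; have [t1|t1|->] := ltgtP t 1.
- rewrite /continuous_at (_ : euler_cdf t = 0); last by rewrite /euler_cdf ltW.
  apply: cvg_near_cst; near=> s.
  have s1 : s < 1 by near: s; exact: lt_nbhsl.
  by rewrite /euler_cdf ltW.
- rewrite /continuous_at (euler_cdfE (ltW t1)).
  have t0 : 0 < t by exact: lt_trans t1.
  have H : (euler \o (fun s : R => s ^- 2)) @ t --> euler (t ^- 2).
    apply: continuous_cvg; last exact: continuous_inv_sqr.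
    by apply: continuous_euler; exact: inv_sqr_itv.
  apply: cvg_trans H; apply: near_eq_cvg; near=> s.
  have s1 : 1 < s by near: s; exact: lt_nbhsr.
  by rewrite /= euler_cdfE// ltW.
- rewrite /continuous_at (_ : euler_cdf 1 = 0); last by rewrite /euler_cdf lexx.
  apply/cvgrPdist_le => e e0.
  have := continuous_inv_sqr (@ltr01 R); rewrite expr1n invr1.
  move=> /cvgrPdist_le/(_ _ e0) H.
  near=> s; rewrite sub0r normrN ger0_norm ?euler_cdf_ge0//.
  have : `|1 - s ^- 2| <= e by near: s; exact: H.
  have [s1|s1] := leP s 1; first by move=> _; rewrite /euler_cdf s1 ltW.
  move=> /(le_trans (ler_norm _)); apply: le_trans.
  by apply: euler_cdf_le; exact: ltW.
Unshelve. all: by end_near. Qed.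

Lemma cvg_euler_cdf_y : euler_cdf t @[t --> +oo] --> (1 : R).
Proof.
apply/cvgrPdist_le => e e0.
near=> t.
have t1 : 1 < t by near: t; apply: nbhs_pinfty_gt; exact: num_real.
have /andP[i0 i1] := inv_sqr_itv t1.
rewrite ger0_norm ?subr_ge0 ?euler_cdf_le1// euler_cdfE; last exact: ltW.
have := @euler_tail 0 (t ^- 2); rewrite /euler_prod big_geq// (ltW i0) i1.
move=> /(_ isT)/le_trans; apply.
have te : 1 + e^-1 <= t by near: t; apply: nbhs_pinfty_ge; exact: num_real.
have t0 : 0 < t by exact: lt_trans t1.
have t2 : 0 < t ^+ 2 - 1 by rewrite subr_gt0 exprn_egt1.
rewrite expr1 (_ : _ / _ = (t ^+ 2 - 1)^-1); last first.
  by field; rewrite !gt_eqF.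
rewrite -[leRHS]invrK lef_pV2 ?posrE ?invr_gt0//.
have : t <= t ^+ 2 by rewrite expr2 ler_peMl ?(ltW t0)// ltW.
by move: te; lra.
Unshelve. all: by end_near. Qed.

Lemma cvg_euler_cdf_Ny : euler_cdf t @[t --> -oo] --> (0 : R).
Proof.
apply: cvg_near_cst; near=> s.
have s1 : s < 1 by near: s; apply: nbhs_ninfty_lt; exact: num_real.
by rewrite /euler_cdf ltW.
Unshelve. all: by end_near. Qed.

Lemma euler_cdf_right_continuous : right_continuous euler_cdf.
Proof. by move=> t; apply: cvg_at_right_filter; exact: continuous_euler_cdf. Qed.

HB.instance Definition _ := isCumulative.Build R _ R euler_cdf
  euler_cdf_nondecreasing euler_cdf_right_continuous.

HB.instance Definition _ := isCumulativeBounded.Build R 0 1 euler_cdf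
  cvg_euler_cdf_Ny cvg_euler_cdf_y.

(** The Stieltjes measure of [euler_cdf] has this law; taking the maximum with 1
    changes the identity on a null set and bounds it below everywhere. *)
Lemma exists_euler_variable : exists (d : measure_display) (T : measurableType d)
  (P : probability T R) (x : {RV P >-> R}), (forall w, 1 <= x w) /\
  forall t, 1 <= t -> P [set w | x w < t] = (euler (t ^- 2))%:E.
Proof.
pose P : probability _ R := lebesgue_stieltjes_measure euler_cdf.
pose f (w : measurableTypeR R) : R := Num.max 1 w.
have mf : measurable_fun setT f by apply: measurable_maxr => //; exact: measurable_id.
pose x : {RV P >-> R} := HB.pack f (isMeasurableFun.Build _ _ _ _ f mf).
exists _, _, P, x; split; first by move=> w; rewrite /= /f le_max lexx.
have cdfE t : P `]-oo, t]%classic = (euler_cdf t)%:E.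
  have := cdf_lebesgue_stieltjes_id euler_cdf t; rewrite /cdf /distribution /pushforward.
  by rewrite preimage_id.
move=> t t1; rewrite -euler_cdfE//.
have mo : measurable (`]-oo, t[%classic : set (measurableTypeR R)) by exact: measurable_itv.
have mc s : measurable (`]-oo, s]%classic : set (measurableTypeR R)) by exact: measurable_itv.
have [t1'|t1'] := leP t 1.
  rewrite (_ : [set w | _] = set0) ?measure0; first by rewrite /euler_cdf t1'.
  by apply/seteqP; split => w //=; rewrite /f gt_max ltNge t1'.
rewrite (_ : [set w | _] = `]-oo, t[%classic); last first.
  by apply/seteqP; split => w /=; rewrite /f gt_max in_itv /= t1'.
apply/eqP; rewrite eq_le; apply/andP; split.
  rewrite -cdfE le_measure ?inE//.
  by apply: subset_itvl; rewrite bnd_simp.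
apply/lee_addgt0Pr => e e0.
have /cvgrPdist_le/(_ _ e0)[dl /= dl0 H] := @continuous_euler_cdf t.
pose s := t - dl / 2.
have := H s; rewrite /ball_ /= /s opprB addrC subrK gtr0_norm ?divr_gt0//.
rewrite ltr_pdivrMr// ltr_pMr// ltr1n => /(_ isT).
rewrite ler_norml => /andP[_]; rewrite lerBlDr => h.
apply: (@le_trans _ _ (e + euler_cdf s)%:E); first by rewrite lee_fin.
rewrite EFinD addeC leeD2r// -cdfE le_measure ?inE//.
by apply: subset_itvl; rewrite bnd_simp /s gtrBl divr_gt0.
Qed.

End euler.

(** * Weak convergence from the convergence of distribution functions *)

Section weak_convergence.
Variable R : realType.

Lemma measurable_lt_preimage d (T : measurableType d) (X : T -> R) (t : R) :
  measurable_fun setT X -> measurable [set w | X w < t].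
Proof.
move=> mX; rewrite (_ : [set w | _] = setT `&` X @^-1` `]-oo, t[%classic).
  by apply: mX => //; exact: measurable_itv.
by apply/seteqP; split => w; rewrite /= in_itv /=; [split|case].
Qed.

(** A derivation records the partition, so that facts on step functions follow
    by adding one cell at a time. *)
Inductive step_on (a : R) : R -> (R -> R) -> Prop :=
| step_nil : step_on a a (fun=> 0)
| step_cons b c (v : R) phi : b <= c -> step_on a b phi ->
    step_on a c (fun x => phi x + v * (b <= x < c)%R%:R).

Lemma step_on_le a b phi : step_on a b phi -> a <= b.
Proof. by elim=> // b' c v psi bc _ /le_trans; apply. Qed.

Lemma step_on_outside a b phi x : step_on a b phi -> ~~ (a <= x < b) -> phi x = 0.
Proof.
elim=> // {}b c v psi bc st IH; have ab := step_on_le st.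
rewrite negb_and -ltNge -leNgt => xab; rewrite IH; last first.
  rewrite negb_and -ltNge -leNgt; case/orP: xab => [->//|cx].
  by rewrite (le_trans bc cx) orbT.
rewrite add0r (_ : (b <= x < c) = false) ?mulr0//; apply/negbTE.
by rewrite negb_and -ltNge -leNgt; case/orP: xab => [xa|->]; rewrite ?orbT// (lt_le_trans xa).
Qed.

Lemma measurable_step a b phi : step_on a b phi -> measurable_fun setT phi.
Proof.
elim=> [|{}b c v psi bc _ mpsi]; first exact: measurable_cst.
apply: measurable_funD => //; apply: measurable_funM => //.
rewrite (_ : (fun x => _) = \1_(`[b, c[%classic)); last first.
  by apply/funext => x; rewrite indicE mem_setE in_itv.
by apply: measurable_indic; exact: measurable_itv.
Qed.

Lemma bounded_step a b phi : step_on a b phi -> exists M, forall x, `|phi x| <= M.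
Proof.
elim=> [|{}b c v psi bc _ [M HM]]; first by exists 0 => x; rewrite normr0.
exists (M + `|v|) => x; apply: le_trans (ler_normD _ _) _; apply: lerD => //.
by rewrite normrM ler_piMr//; case: (_ <= _ < _); rewrite ?normr1 ?normr0.
Qed.

(** The supremum of the endpoints up to which such a step function exists cannot
    be smaller than [b]: by continuity there, one more cell passes beyond it. *)
Lemma exists_step (f : R -> R) a b e : continuous f -> a <= b -> 0 < e ->
  exists2 phi, step_on a b phi & forall x, a <= x < b -> `|f x - phi x| <= e.
Proof.
move=> cf ab e0.
pose S := [set s | a <= s <= b /\ exists2 phi, step_on a s phi &
  forall x, a <= x < s -> `|f x - phi x| <= e].
have Sa : S a.
  split; first by rewrite lexx.
  exists (fun=> 0); first exact: step_nil.
  by move=> x /andP[ax xa]; have := le_lt_trans ax xa; rewrite ltxx.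
have Sub : has_sup S.
  by split; [exists a|exists b => s [/andP[]]].
pose sg := sup S.
have sga : a <= sg by exact: sup_upper_bound.
have sgb : sg <= b by apply: ge_sup; [exists a|move=> s [/andP[]]].
have /cvgrPdist_le/(_ _ e0)[dl /= dl0 Hdl] := cf sg.
have [s [/andP[as_ sb] [phi sphi Hphi]] ssg] := sup_adherent dl0 Sub.
have slesg : s <= sg.
  by apply: sup_upper_bound => //; split; [rewrite as_|exists phi].
have ext c : s <= c -> c <= b -> c < sg + dl -> S c.
  move=> sc cb csg; split; first by rewrite (le_trans as_ sc).
  exists (fun x => phi x + f sg * (s <= x < c)%R%:R); first exact: step_cons.
  move=> x /andP[ax xc]; have [xs|sx] := ltP x s.
    by rewrite /= mulr0 addr0 Hphi// ax.
  rewrite xc /= mulr1 (step_on_outside sphi) ?add0r; last by rewrite negb_and -ltNge -leNgt sx orbT.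
  rewrite distrC; apply: Hdl; rewrite /= ltr_distlC ltrBlDr; apply/andP; split.
    by rewrite -ltrBlDr (lt_le_trans ssg).
  by rewrite (lt_trans xc).
have sgbE : sg = b.
  apply/eqP; rewrite eq_le sgb leNgt; apply/negP => sgltb.
  pose c := Num.min b (sg + dl / 2).
  have sgc : sg < c by rewrite lt_min sgltb ltrDl divr_gt0.
  have : S c.
    apply: ext; [exact: ltW (le_lt_trans slesg sgc)|by rewrite ge_min lexx|].
    rewrite gt_min; apply/orP; right; rewrite ltrD2l.
    by rewrite ltr_pdivrMr// ltr_pMr// ltr1n.
  by move=> /(sup_upper_bound Sub); rewrite leNgt sgc.
by have [] : S b by apply: ext => //; rewrite sgbE ltrDl.
Qed.

Section convergence.
Variables (d : nat -> measure_display) (T : forall n, measurableType (d n)).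
Variables (P : forall n, probability (T n) R) (X : forall n, T n -> R).
Arguments X : clear implicits.
Variables (d' : measure_display) (T' : measurableType d').
Variables (P' : probability T' R) (Y : T' -> R).
Hypothesis mX : forall n, measurable_fun setT (X n).
Hypothesis mY : measurable_fun setT Y.
Hypothesis cvg_cdf : forall t,
  fine (P n [set w | X n w < t]) @[n --> \oo] --> fine (P' [set w | Y w < t]).

Lemma integrable_bounded_comp dd (S : measurableType dd) (Q : probability S R)
    (Z : S -> R) (phi : R -> R) (M : R) :
  measurable_fun setT Z -> measurable_fun setT phi -> (forall x, `|phi x| <= M) ->
  Q.-integrable setT (EFin \o (fun w => phi (Z w))).
Proof.
move=> mZ mphi bphi; apply: measurable_bounded_integrable => //.
- by rewrite (le_lt_trans (probability_le1 Q measurableT)) ?ltry.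
- exact: (measurableT_comp mphi).
- exists M; split; first exact: num_real.
  by move=> y My w _ /=; rewrite (le_trans (bphi _))// ltW.
Qed.

Lemma fine_probability_cell dd (S : measurableType dd) (Q : probability S R)
    (Z : S -> R) (b c : R) : measurable_fun setT Z -> b <= c ->
  \int[Q]_w ((b <= Z w < c)%R%:R) =
    fine (Q [set w | Z w < c]) - fine (Q [set w | Z w < b]).
Proof.
move=> mZ bc.
have mb := measurable_lt_preimage b mZ; have mc := measurable_lt_preimage c mZ.
have E : [set w | b <= Z w < c] = [set w | Z w < c] `\` [set w | Z w < b].
  apply/seteqP; split => w /=.
    by move=> /andP[bw ->]; split => //; apply/negP; rewrite -leNgt.
  by move=> [-> /negP]; rewrite -leNgt => ->.
rewrite /Rintegral (eq_integral (fun w => (\1_[set w | b <= Z w < c] w)%:E)); last first.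
  move=> w _; rewrite indicE; congr (_%:R%:E).
  by congr nat_of_bool; apply/idP/idP; rewrite inE.
rewrite integral_indic//; last by rewrite E; exact: measurableD.
rewrite setIT E measureD//; last by rewrite -ge0_fin_numE// fin_num_measure.
rewrite setIidr; last by move=> w /= /lt_le_trans; apply.
by rewrite fineB// fin_num_measure.
Qed.

Let cvg_step a b phi : step_on a b phi ->
  (\int[P n]_w phi (X n w)) @[n --> \oo] --> \int[P']_w phi (Y w).
Proof.
elim=> [|{}b c v psi bc st IH].
  rewrite (_ : \int[P']_w _ = 0); last by rewrite /Rintegral integral0.
  rewrite (_ : (fun n => _) = (fun=> 0)); first exact: cvg_cst.
  by apply/funext => n; rewrite /Rintegral integral0.
have [M HM] := bounded_step st; have mpsi := measurable_step st.
have mcell : measurable_fun setT (fun x : R => (b <= x < c)%R%:R : R).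
  rewrite (_ : (fun x => _) = \1_(`[b, c[%classic)); last first.
    by apply/funext => x; rewrite indicE mem_setE in_itv.
  by apply: measurable_indic; exact: measurable_itv.
have bcell x : `|(b <= x < c)%R%:R : R| <= 1.
  by case: (_ <= _ < _); rewrite ?normr1 ?normr0.
have E dd (S : measurableType dd) (Q : probability S R) (Z : S -> R) :
    measurable_fun setT Z ->
    \int[Q]_w (psi (Z w) + v * (b <= Z w < c)%R%:R) = \int[Q]_w psi (Z w) +
      v * (fine (Q [set w | Z w < c]) - fine (Q [set w | Z w < b])).
  move=> mZ; have i1 := integrable_bounded_comp Q mZ mpsi HM.
  have i2 := integrable_bounded_comp Q mZ mcell bcell.
  rewrite RintegralD//; last first.
    apply: (integrable_bounded_comp (M := `|v|) Q mZ (phi := fun x => v * (b <= x < c)%R%:R)).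
      exact: measurable_funM.
    by move=> x; rewrite normrM ler_piMr.
  by rewrite RintegralZl// fine_probability_cell.
rewrite E//; under eq_fun do rewrite E//.
apply: cvgD => //; apply: cvgMl_tmp; apply: cvgB; exact: cvg_cdf.
Qed.

Hypothesis tight_left : forall e, 0 < e -> exists a, fine (P' [set w | Y w < a]) <= e.
Hypothesis tight_right : forall e, 0 < e ->
  exists b, 1 - e <= fine (P' [set w | Y w < b]).

(** By tightness a test function may be replaced by a step function on a bounded
    interval, whose expectation is a combination of values of the distribution
    function. *)
Lemma cvg_in_law_cdf : cvg_in_law P X P' Y.
Proof.
move=> f cf [M0 [_ HM]].
pose M := M0 + 1 + `|M0 + 1|.
have fM x : `|f x| <= M.
  have : `|f x| <= M0 + 1 by apply: HM; rewrite ?ltrDl.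
  by rewrite /M; have := normr_ge0 (M0 + 1); lra.
have M_ge0 : 0 <= M by exact: le_trans (fM 0).
have mf : measurable_fun setT f by exact: continuous_measurable_fun.
have intf dd (S : measurableType dd) (Q : probability S R) (Z : S -> R) :
    measurable_fun setT Z -> 'E_Q[f \o Z]%E = (\int[Q]_w f (Z w))%:E.
  move=> mZ; rewrite unlock /Rintegral fineK//.
  exact: (integrable_fin_num measurableT (integrable_bounded_comp Q mZ mf fM)).
rewrite intf//; under eq_fun do rewrite intf//.
apply: cvg_EFin; first by near=> n.
apply/cvgrPdist_le => e e0.
(* the errors at the end of the proof add up to (6 M + 3) eta *)
pose eta := e / (6 * M + 3).
have c0 : 0 < 6 * M + 3 by lra.
have eta0 : 0 < eta by rewrite divr_gt0.
have [a Ha] := tight_left eta0; have [b' Hb'] := tight_right eta0.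
pose b := Num.max a b'.
have ab : a <= b by rewrite le_max lexx.
have Hb : 1 - eta <= fine (P' [set w | Y w < b]).
  apply: (le_trans Hb'); apply: fine_le; rewrite ?fin_num_measure//.
  - exact: measurable_lt_preimage.
  - exact: measurable_lt_preimage.
  apply: le_measure; rewrite ?inE; [exact: measurable_lt_preimage..|].
  by move=> w /=; rewrite /b lt_max => ->; rewrite orbT.
have [phi st Hphi] := exists_step cf ab eta0.
have [Mp HMp] := bounded_step st; have mphi := measurable_step st.
have mcell : measurable_fun setT (fun x : R => (a <= x < b)%R%:R : R).
  rewrite (_ : (fun x => _) = \1_(`[a, b[%classic)); last first.
    by apply/funext => x; rewrite indicE mem_setE in_itv.
  by apply: measurable_indic; exact: measurable_itv.
have bcell x : `|(a <= x < b)%R%:R : R| <= 1.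
  by case: (_ <= _ < _); rewrite ?normr1 ?normr0.
have close x : `|f x - phi x| <= eta + M * (1 - (a <= x < b)%R%:R).
  case: (boolP (a <= x < b)) => h; first by rewrite subrr mulr0 addr0 Hphi.
  by rewrite (step_on_outside st h) !subr0 mulr1 (le_trans (fM x))// lerDr ltW.
have bound dd (S : measurableType dd) (Q : probability S R) (Z : S -> R) :
    measurable_fun setT Z ->
    `|\int[Q]_w f (Z w) - \int[Q]_w phi (Z w)| <= eta + M * (1 -
       (fine (Q [set w | Z w < b]) - fine (Q [set w | Z w < a]))).
  move=> mZ; have i1 := integrable_bounded_comp Q mZ mf fM.
  have i2 := integrable_bounded_comp Q mZ mphi HMp.
  have i3 := integrable_bounded_comp Q mZ mcell bcell.
  have bcell1 x : `|1 - (a <= x < b)%R%:R : R| <= 1.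
    by case: (_ <= _ < _); rewrite ?subrr ?subr0 ?normr1 ?normr0.
  have mcell1 : measurable_fun setT (fun x : R => 1 - (a <= x < b)%R%:R : R).
    exact: measurable_funB.
  have i4 := integrable_bounded_comp Q mZ mcell1 bcell1.
  have i5 : Q.-integrable setT (EFin \o (fun w => M * (1 - (a <= Z w < b)%R%:R))).
    apply: (integrable_bounded_comp (M := M) Q mZ
      (phi := fun x => M * (1 - (a <= x < b)%R%:R))).
      exact: measurable_funM.
    by move=> x; rewrite normrM (ger0_norm M_ge0) ler_piMr.
  have i6 : Q.-integrable setT (EFin \o (fun w => eta + M * (1 - (a <= Z w < b)%R%:R))).
    apply: (integrable_bounded_comp (M := eta + M) Q mZ
      (phi := fun x => eta + M * (1 - (a <= x < b)%R%:R))).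
      by apply: measurable_funD => //; exact: measurable_funM.
    move=> x; apply: le_trans (ler_normD _ _) _.
    by rewrite (ger0_norm (ltW eta0)) lerD2l normrM (ger0_norm M_ge0) ler_piMr.
  have i0 (k : R) : Q.-integrable setT (EFin \o (fun=> k)).
    exact: finite_measure_integrable_cst.
  have pQ : fine (Q setT) = 1 by have := probability_setT Q => ->.
  have -> : eta + M * (1 - (fine (Q [set w | Z w < b]) - fine (Q [set w | Z w < a]))) =
      \int[Q]_w (eta + M * (1 - (a <= Z w < b)%R%:R)).
    rewrite (RintegralD measurableT (i0 _) i5) (RintegralZl _ measurableT i4).
    rewrite (RintegralB measurableT (i0 _) i3) !Rintegral_cst// pQ !mulr1.
    by rewrite fine_probability_cell.
  rewrite -(RintegralB measurableT i1 i2).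
  have i12 : Q.-integrable setT (EFin \o (fun w => f (Z w) - phi (Z w))).
    by have := integrableB measurableT i1 i2.
  apply: le_trans (le_normr_Rintegral measurableT i12) _.
  have i12' : Q.-integrable setT (EFin \o (fun w => `|f (Z w) - phi (Z w)|)).
    by have := integrable_abse i12.
  by apply: (le_Rintegral measurableT i12' i6) => w _; exact: close.
have cphi := cvg_step st.
have /cvgrPdist_le/(_ _ eta0) cphi' := cphi.
have /cvgrPdist_le/(_ _ eta0) ca := @cvg_cdf a.
have /cvgrPdist_le/(_ _ eta0) cb := @cvg_cdf b.
have bY := bound _ _ P' _ mY.
near=> n.
have bX := bound _ _ (P n) _ (@mX n).
have hphi : `|\int[P']_w phi (Y w) - \int[P n]_w phi (X n w)| <= eta.
  by near: n; exact: cphi'.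
have ha : `|fine (P' [set w | Y w < a]) - fine (P n [set w | X n w < a])| <= eta.
  by near: n; exact: ca.
have hb : `|fine (P' [set w | Y w < b]) - fine (P n [set w | X n w < b])| <= eta.
  by near: n; exact: cb.
have etaE : (6 * M + 3) * eta = e by rewrite /eta mulrC divfK// gt_eqF.
move: bX bY hphi ha hb Ha Hb => /=.
set IfX := \int[P n]_w f _; set IpX := \int[P n]_w phi _.
set IfY := \int[P']_w f _; set IpY := \int[P']_w phi _.
set Fa := fine (P' [set w | Y w < a]); set Fb := fine (P' [set w | Y w < b]).
set Ga := fine (P n [set w | X n w < a]); set Gb := fine (P n [set w | X n w < b]).
move=> bX bY hphi ha hb Ha Hb.
have h1 : M * (1 - (Fb - Fa)) <= M * (2 * eta) by apply: ler_wpM2l => //; lra.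
have h2 : M * (1 - (Gb - Ga)) <= M * (4 * eta).
  apply: ler_wpM2l => //; move: ha hb; rewrite !ler_norml => /andP[? ?] /andP[? ?]; lra.
rewrite -etaE; move: bX bY hphi; rewrite !ler_norml.
move=> /andP[? ?] /andP[? ?] /andP[? ?]; apply/andP; split; lra.
Unshelve. all: by end_near. Qed.

End convergence.
End weak_convergence.

(** * The law of the maximum modulus of a jellium *)

Section jellium.
Variables (R : realType) (nu : probability R[i] R) (r : R).
Hypothesis nu_rotation : rotation_invariant nu.
Hypothesis nu_log : (\int[nu]_z `| log_modulus z | < +oo)%E.
Hypothesis r_outer : is_max [set normc z | z in measure_support nu] r.
Notation cleb := (complex_lebesgue R).
Notation leb n := (lebesgue_Cn R n).

Let r_gt0 : 0 < r.
Proof. exact: (outer_radius_gt0 nu_log r_outer). Qed.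

Let V (z : R[i]) : R := fine (potential nu z).

Let VE z : potential nu z = (V z)%:E.
Proof. by rewrite fineK//; apply: (potential_fin nu_rotation nu_log r_outer). Qed.

Let V_outer z : r < normc z -> V z = ln (normc z).
Proof. by move=> rz; rewrite /V (potential_outer nu_rotation nu_log r_outer rz). Qed.

Let V_rotation u z : normc u = 1 -> V (u * z) = V z.
Proof. by move=> u1; rewrite /V (potential_rotation nu_rotation nu_log r_outer). Qed.

Let measurable_V : measurable_fun setT V.
Proof.
apply: measurableT_comp; first exact: fine_measurable.
exact: (measurable_potential nu_rotation nu_log r_outer).
Qed.

(** The pair interaction exponentiates to the squared modulus of a Vandermonde
    determinant; when two particles coincide the energy is infinite and both
    sides vanish. *)
Lemma jellium_weightE n (x : n.-tuple R[i]) : jellium_weight nu x =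
  ((normc (\det (\matrix_(i < n, j < n) tnth x i ^+ j)) ^+ 2)%:E *
   \prod_(i < n) (expR (- (2 * n.+1%:R * V (tnth x i))))%:E)%E.
Proof.
have vdm : normc (\det (\matrix_(i < n, j < n) tnth x i ^+ j)) =
    \prod_(i < n) \prod_(j < n | (i < j)%N) normc (tnth x i - tnth x j).
  rewrite -det_tr.
  rewrite (_ : (\matrix_(i < n, j < n) tnth x i ^+ j)^T =
      Vandermonde n (\row_j tnth x j)); last first.
    by apply/matrixP => i j; rewrite !mxE.
  rewrite det_Vandermonde (big_morph _ (@normcM R) (@normc1 R)).
  apply: eq_bigr => i _; rewrite (big_morph _ (@normcM R) (@normc1 R)).
  by apply: eq_bigr => j _; rewrite !mxE -normcN opprB.
have sumV : (\sum_(i < n) potential nu (tnth x i))%E = (\sum_(i < n) V (tnth x i))%:E.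
  by rewrite -sumEFin; apply: eq_bigr => i _; exact: VE.
rewrite prodEFin vdm -EFinM /jellium_weight sumV -EFinM.
case: (boolP [forall i : 'I_n, forall j : 'I_n, (i < j)%N ==> (tnth x i != tnth x j)]).
  move=> /'forall_forallP/= neq.
  have d0 (i j : 'I_n) : (i < j)%N -> 0 < normc (tnth x i - tnth x j).
    by move=> ij; rewrite normc_gt0 subr_eq0; exact: (implyP (neq i j)).
  have -> : (\sum_(i < n) \sum_(j < n | (i < j)%N)
      log_modulus (tnth x i - tnth x j)%R = (\sum_(i < n) \sum_(j < n | (i < j)%N)
      ln (normc (tnth x i - tnth x j)))%R%:E)%E.
    rewrite -sumEFin; apply: eq_bigr => i _; rewrite -sumEFin; apply: eq_bigr => j ij.
    by rewrite log_modulusE// -normc_gt0 d0.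
  rewrite -EFinN -EFinD -EFinM /=; congr (_%:E).
  rewrite mulNr mulrDr opprD mulrN opprK expRD; congr (_ * _).
    rewrite expRM_natl; congr (_ ^+ _).
    rewrite expR_sum; apply: eq_bigr => i _; rewrite expR_sum; apply: eq_bigr => j ij.
    by rewrite lnK// posrE d0.
  by rewrite -expR_sum mulrA mulr_sumr sumrN.
move=> /forallPn[i /forallPn[j]].
rewrite negb_imply negbK => /andP[ij /eqP xij].
have -> : (\sum_(i < n) \sum_(j < n | (i < j)%N)
      log_modulus (tnth x i - tnth x j)%R = -oo)%E.
  apply/esum_eqNyP; exists i; split => //.
  apply/esum_eqNyP; exists j; split => //.
  by rewrite xij subrr /log_modulus normc0 /= lexx.
have -> : \prod_(i < n) \prod_(j < n | (i < j)%N) normc (tnth x i - tnth x j) = 0.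
  by rewrite (bigD1 i)//= (bigD1 j)//= xij subrr normc0 !mul0r.
rewrite expr0n mul0r.
by rewrite /= lt0_muley// lte_fin oppr_lt0.
Qed.

(** [jellium_mass n k D] is the squared norm of the monomial of degree [k] over
    [D] for the weight of the jellium of [n] particles. *)
Definition jellium_mass n k (D : set R[i]) : \bar R :=
  (\int[cleb]_(z in D) (normc z ^+ (2 * k) * expR (- (2 * n.+1%:R * V z)))%:E)%E.

Let weight n (z : R[i]) : R := expR (- (2 * n.+1%:R * V z)).

Let measurable_weight n : measurable_fun setT (weight n).
Proof.
apply: (measurableT_comp (continuous_measurable_fun (@continuous_expR R))).
by apply: measurable_funN; apply: measurable_funM; [exact: measurable_cst|exact: measurable_V].
Qed.

Let measurable_mass_fun n k (D : set R[i]) :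
  measurable_fun D (fun z => (normc z ^+ (2 * k) * weight n z)%:E).
Proof.
apply: (measurable_funS measurableT) => //; apply/measurable_EFinP.
by apply: measurable_funM; [apply: measurable_funX; exact: measurable_normc|exact: measurable_weight].
Qed.

(** The indicator of the box is absorbed in the radial weight of
    [integral_sqr_det]. *)
Lemma integral_jellium_weight n (D : set R[i]) : measurable D ->
  (forall u z, normc u = 1 -> D z -> D (u * z)) ->
  (\int[leb n]_(x in [set x | forall i, D (tnth x i)]) jellium_weight nu x =
   n`!%:R%:E * \prod_(k < n) jellium_mass n k D)%E.
Proof.
move=> mD rotD.
pose g z := ((weight n z)%:E * (\1_D z)%:E)%E.
have mg : measurable_fun setT g.
  apply: emeasurable_funM; apply/measurable_EFinP; first exact: measurable_weight.
  exact: measurable_indic.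
have g0 z : (0 <= g z)%E by rewrite mule_ge0// lee_fin ?expR_ge0// indicE.
have rotDE u z : normc u = 1 -> (u * z \in D) = (z \in D).
  move=> u1; apply/idP/idP; rewrite !inE; last exact: rotD.
  have u0 : u != 0 by rewrite -normc_gt0 u1.
  move=> /(rotD u^-1); rewrite mulKf//; apply.
  by apply: (mulfI (x := normc u)); rewrite ?u1 ?oner_eq0// -{1}u1 -normcM divff// normc1 mulr1.
have grot u z : normc u = 1 -> g (u * z) = g z.
  by move=> u1; rewrite /g /weight V_rotation// !indicE rotDE.
have := integral_sqr_det (psi := id) (e := fun j : 'I_n => j : nat)
   (@measurable_id _ _ setT) (fun _ _ _ => erefl) mg g0 grot (@ord_inj n).
move=> ih.
transitivity (n`!%:R%:E * \prod_(j < n) \int[cleb]_z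
   ((normc z ^+ (2 * j))%:E * g z))%E; last first.
  congr (_ * _)%E; apply: eq_bigr => k _; rewrite /jellium_mass [RHS]integral_mkcond.
  apply: eq_integral => z _; rewrite patchE /g indicE.
  by case: (z \in D) => /=; rewrite ?mule1 ?mule0.
rewrite -ih [LHS]integral_mkcond; apply: eq_integral => x _; rewrite patchE.
have -> : (\prod_(i < n) g (tnth x i))%E =
    (\prod_(i < n) (weight n (tnth x i))%:E * \prod_(i < n) (\1_D (tnth x i))%:E)%E.
  by rewrite -big_split.
case: (boolP (x \in _)); rewrite ?inE => xD.
  have -> : (\prod_(i < n) (\1_D (tnth x i))%:E = 1 :> \bar R)%E.
    by rewrite big1// => i _; rewrite indicE mem_set.
  by rewrite mule1 jellium_weightE.
have [i xi] : exists i, ~ D (tnth x i) by apply/existsNP; move/negP: xD; rewrite inE.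
have -> : (\prod_(i < n) (\1_D (tnth x i))%:E = 0 :> \bar R)%E.
  by rewrite (bigD1 i)//= indicE memNset// mul0e.
by rewrite !mule0.
Qed.

Lemma complex_lebesgue_circle (s : R) : cleb [set z | normc z = s] = 0%E.
Proof.
have mC : measurable [set z : R[i] | normc z = s].
  rewrite (_ : [set _ | _] = setT `&` (@normc R : _ -> measurableTypeR R) @^-1` [set s]).
    by apply: measurable_normc => //; exact: measurable_set1.
  by apply/seteqP; split => z /=; [split|case].
pose h (q : R) : \bar R := (\1_[set (s ^+ 2)%R : measurableTypeR R] q)%:E.
have mh : measurable_fun setT h.
  apply/measurable_EFinP; apply: measurable_indic; exact: measurable_set1.
have h0 q : (0 <= h q)%E by rewrite lee_fin indicE.
have := ge0_integral_sqr_normc mh h0.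
rewrite (_ : \int[lebesgue_measure]_(q in _) h q = 0)%E ?mule0; last first.
  rewrite /h integral_indic; [|exact: measurable_itv|exact: measurable_set1].
  apply/eqP; rewrite eq_le measure_ge0 andbT -(lebesgue_measure_set1 (s ^+ 2)).
  apply: le_measure; rewrite ?inE; [|exact: measurable_set1|exact: subIsetl].
  by apply: measurableI; [exact: measurable_set1|exact: measurable_itv].
move=> E; apply/eqP; rewrite eq_le measure_ge0 andbT -E.
rewrite -integral_indic_complex_lebesgue//.
apply: ge0_le_integral => //.
- by apply/measurable_EFinP; exact: measurable_indic.
- by apply: (measurableT_comp mh); exact: measurable_sqr_normc.
move=> z _; rewrite /h lee_fin !indicE; case: (boolP (z \in _)) => //.
by rewrite inE /= => ->; rewrite mem_set.
Qed.

(** Outside the support the potential is the logarithm, which turns the weight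
    into a negative power; the circle of radius [r], where this may fail, has
    area zero. *)
Lemma jellium_mass_outer n k (t : R) : (k < n)%N -> r <= t ->
  jellium_mass n k [set z | t <= normc z] =
  (pi / (n - k)%:R * t ^- (2 * (n - k)))%:E.
Proof.
move=> kn rt; have t0 : 0 < t by exact: lt_le_trans rt.
have nk0 : (0 < n - k)%N by rewrite subn_gt0.
have mD : measurable [set z : R[i] | t <= normc z] by exact: measurable_normc_ge.
rewrite -(integral_outer_power t0 nk0).
apply: ae_eq_integral => //.
- exact: measurable_mass_fun.
- apply: (measurable_funS measurableT) => //; apply/measurable_EFinP.
  apply: measurable_inv_ge0 => [z|]; first by rewrite exprn_ge0// normc_ge0.
  by apply: measurable_funX; exact: measurable_normc.
exists [set z | normc z = r]; split; [|exact: complex_lebesgue_circle|].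
  rewrite (_ : [set _ | _] = setT `&` (@normc R : _ -> measurableTypeR R) @^-1` [set r]).
    by apply: measurable_normc => //; exact: measurable_set1.
  by apply/seteqP; split => z /=; [split|case].
move=> z /=; apply: contra_notP => /eqP zr tz.
have rz : r < normc z by rewrite lt_neqAle eq_sym zr (le_trans rt).
have z0 : 0 < normc z by exact: lt_trans rz.
congr (_%:E); rewrite V_outer// expRN mulrC.
have -> : expR (2 * n.+1%:R * ln (normc z)) = normc z ^+ (2 * n.+1).
  by rewrite -natrM expRM_natl lnK// posrE.
rewrite -subSn; last exact: ltnW.
have -> : normc z ^+ (2 * n.+1) = normc z ^+ (2 * k) * normc z ^+ (2 * (n.+1 - k)).
  by rewrite -exprD -mulnDr subnKC// ltnW// ltnS ltnW.
by rewrite invfM mulrAC mulVf ?mul1r// expf_neq0// gt_eqF.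
Qed.

Lemma exists_lower_bound : exists c : R, forall z, c <= V z.
Proof.
exists (fine (\int[nu]_w (ln (normc w))%:E)) => z.
have := potential_ge_cst nu_rotation nu_log r_outer z; rewrite VE.
have : (\int[nu]_w (ln (normc w))%:E)%E \is a fin_num.
  by have := integrable_fin_num measurableT (integrable_ln nu_log).
by move=> /fineK {1}<-; rewrite lee_fin.
Qed.

(** The density of the monomial of degree [m] in the jellium of [m + i.+1]
    particles, arranged as a power of a quantity that is smaller than one in the
    disc, where the potential exceeds the logarithm. *)
Let inner i m z : R := (normc z * expR (- V z)) ^+ (2 * m) *
  expR (- (2 * i.+2%:R * V z)).

Let disc : set R[i] := [set z | normc z < r].

Let measurable_disc : measurable disc.
Proof. exact: measurable_normc_lt. Qed.

Let innerE i m z : inner i m z = normc z ^+ (2 * m) * weight (m + i.+1) z.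
Proof.
rewrite /inner exprMn -[LHS]mulrA; congr (_ * _).
rewrite -expRM_natr -expRD /weight; congr expR.
by rewrite -addnS natrD natrM; ring.
Qed.

Let inner_ge0 i m z : 0 <= inner i m z.
Proof. by rewrite mulr_ge0 ?expR_ge0// exprn_ge0// mulr_ge0 ?normc_ge0 ?expR_ge0. Qed.

Let factor_itv z : disc z -> 0 <= normc z * expR (- V z) < 1.
Proof.
move=> zr; rewrite mulr_ge0 ?normc_ge0 ?expR_ge0//=.
have [->|z0] := eqVneq z 0; first by rewrite normc0 mul0r.
have := potential_gt_log nu_rotation nu_log r_outer z0 zr; rewrite VE lte_fin => h.
rewrite expRN ltr_pdivrMr ?expR_gt0// mul1r.
by rewrite -ltr_ln ?posrE ?expR_gt0 ?normc_gt0// expRK.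
Qed.

Let inner_bound i : exists C : R, forall m z, disc z -> inner i m z <= C.
Proof.
have [c Hc] := exists_lower_bound.
exists (expR (- (2 * i.+2%:R * c))) => m z dz.
have /andP[f0 f1] := factor_itv dz.
rewrite -[leRHS]mul1r; apply: ler_pM; rewrite ?expR_ge0 ?exprn_ge0 ?exprn_ile1 ?(ltW f1)//.
by rewrite ler_expR lerN2 ler_pM2l// mulr_gt0.
Qed.

Let measurable_inner i m : measurable_fun disc (fun z => (inner i m z)%:E).
Proof.
under eq_fun do rewrite innerE.
exact: measurable_mass_fun.
Qed.

Let finite_disc : (cleb disc < +oo)%E.
Proof.
apply: (@le_lt_trans _ _ (cleb (@sqr_disc R (r ^+ 2)))).
  apply: le_measure; rewrite ?inE//; first exact: measurable_sqr_disc.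
  by move=> z /ltW zr; rewrite /sqr_disc /= ler_pXn2r// ?nnegrE ?normc_ge0// ltW.
by rewrite complex_lebesgue_sqr_disc ltry.
Qed.

Let integrable_cst_disc (C : R) : cleb.-integrable disc (fun=> C%:E).
Proof.
apply/integrableP; split; first exact: measurable_cst.
by rewrite integral_cst//= lte_mul_pinfty// ge0_fin_numE.
Qed.

Definition inner_mass i m : R := fine (jellium_mass (m + i.+1) m disc).

Let inner_massE i m : jellium_mass (m + i.+1) m disc = (\int[cleb]_(z in disc) (inner i m z)%:E)%E.
Proof. by apply: eq_integral => z _; rewrite innerE. Qed.

Lemma jellium_mass_disc i m : jellium_mass (m + i.+1) m disc = (inner_mass i m)%:E.
Proof.
rewrite /inner_mass fineK// inner_massE.
have [C HC] := inner_bound i.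
apply: (integrable_fin_num measurable_disc).
apply: (le_integrable measurable_disc _ _ (integrable_cst_disc C)).
  exact: measurable_inner.
move=> z dz /=; rewrite lee_fin (ger0_norm (inner_ge0 _ _ _)).
by rewrite (le_trans (HC m z dz))// ler_norm.
Qed.

Lemma inner_mass_ge0 i m : 0 <= inner_mass i m.
Proof.
apply: fine_ge0; rewrite inner_massE; apply: integral_ge0 => z _.
by rewrite lee_fin.
Qed.

Lemma cvg_inner_mass i : inner_mass i m @[m --> \oo] --> 0.
Proof.
have [C HC] := inner_bound i.
have : (\int[cleb]_(z in disc) (inner i m z)%:E)%E @[m --> \oo] -->
    (\int[cleb]_(z in disc) (cst 0 z))%E.
  apply: (@dominated_cvg _ _ _ cleb disc measurable_disc
     (fun m z => (inner i m z)%:E) (cst 0%E) (fun=> C%:E)) => //.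
  - move=> z dz; have /andP[f0 f1] := factor_itv dz.
    apply: cvg_EFin; first by near=> m.
    have h : ((normc z * expR (- V z)) ^+ 2) ^+ m @[m --> \oo] --> 0.
      by apply: cvg_expr; rewrite ger0_norm ?exprn_ge0// exprn_ilt1.
    have : ((normc z * expR (- V z)) ^+ 2) ^+ m * expR (- (2 * i.+2%:R * V z))
        @[m --> \oo] --> 0 * expR (- (2 * i.+2%:R * V z)).
      by apply: cvgM => //; exact: cvg_cst.
    rewrite mul0r => h2; apply: (cvg_trans _ h2); apply: near_eq_cvg; near=> m.
    by rewrite /inner /= exprM.
  - by move=> m z dz; rewrite lee_fin (ger0_norm (inner_ge0 _ _ _)) HC.
rewrite integral0 => /fine_cvgP[_].
apply: cvg_trans; apply: near_eq_cvg; near=> m.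
by rewrite /inner_mass inner_massE.
Unshelve. all: by end_near. Qed.

(** The maximum modulus is distributed as a maximum of independent radii, one
    for each monomial; this is the probability that the radius of the monomial
    of degree [m], among those of degree at most [m + i], is at least [t]. *)
Definition outer_ratio (t : R) i m : R :=
  (pi / i.+1%:R * t ^- (2 * i.+1)) /
  (inner_mass i m + pi / i.+1%:R * r ^- (2 * i.+1)).

Let outer_gt0 i (t : R) : 0 < t -> 0 < pi / i.+1%:R * t ^- (2 * i.+1).
Proof. by move=> t0; rewrite mulr_gt0 ?divr_gt0 ?pi_gt0// invr_gt0 exprn_gt0. Qed.

Lemma jellium_mass_split i m (t : R) : r <= t ->
  jellium_mass (m + i.+1) m setT =
  (jellium_mass (m + i.+1) m [set z | (normc z < t)%R] +
   (pi / i.+1%:R * t ^- (2 * i.+1))%:E)%E.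
Proof.
move=> rt.
have := @jellium_mass_outer (m + i.+1) m t; rewrite addnS ltnS leq_addr -addnS.
rewrite addKn => <-//.
rewrite /jellium_mass -ge0_integral_setU//.
- by congr integral; apply/seteqP; split => z //= _; case: (ltP (normc z) t); [left|right].
- exact: measurable_normc_lt.
- exact: measurable_normc_ge.
- exact: measurable_mass_fun.
- by move=> z _; rewrite lee_fin mulr_ge0 ?expR_ge0// exprn_ge0// normc_ge0.
- by apply/disj_setPS => z /= [zt tz]; move: (lt_le_trans zt tz); rewrite ltxx.
Qed.

Lemma jellium_massT i m : jellium_mass (m + i.+1) m setT =
  (inner_mass i m + pi / i.+1%:R * r ^- (2 * i.+1))%:E.
Proof. by rewrite (jellium_mass_split i m (lexx r)) jellium_mass_disc EFinD. Qed.

Lemma jellium_mass_inside i m (t : R) : r <= t ->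
  jellium_mass (m + i.+1) m [set z | normc z < t] =
  ((inner_mass i m + pi / i.+1%:R * r ^- (2 * i.+1)) * (1 - outer_ratio t i m))%:E.
Proof.
move=> rt; have h := jellium_mass_split i m rt; rewrite jellium_massT in h.
have E : (jellium_mass (m + i.+1) m [set z | (normc z < t)%R] =
   (inner_mass i m + pi / i.+1%:R * r ^- (2 * i.+1))%:E -
   (pi / i.+1%:R * t ^- (2 * i.+1))%:E)%E by rewrite h addeK.
rewrite E -EFinB; congr (_%:E).
rewrite mulrBr mulr1 /outer_ratio mulrCA divff ?mulr1// gt_eqF//.
by rewrite ltr_wpDl ?inner_mass_ge0// outer_gt0.
Qed.

Lemma outer_ratio_itv t i m : r <= t -> 0 <= outer_ratio t i m <= ((r / t) ^+ 2) ^+ i.+1.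
Proof.
move=> rt; have t0 : 0 < t by exact: lt_le_trans rt.
have pr := outer_gt0 i r_gt0; have pt := outer_gt0 i t0.
have I0 := inner_mass_ge0 i m; have s0 := ltr_wpDl I0 pr.
rewrite divr_ge0 ?(ltW pt) ?(ltW s0)//= ler_pdivrMr//.
have -> : pi / i.+1%:R * t ^- (2 * i.+1) =
    ((r / t) ^+ 2) ^+ i.+1 * (pi / i.+1%:R * r ^- (2 * i.+1)).
  rewrite -exprM exprMn exprVn [RHS]mulrCA mulrAC mulfV ?mul1r//.
  by rewrite expf_neq0// gt_eqF.
apply: ler_wpM2l; last by rewrite lerDr.
by rewrite !exprn_ge0// divr_ge0// ltW.
Qed.

Lemma cvg_outer_ratio t i : r <= t ->
  outer_ratio t i m @[m --> \oo] --> ((r / t) ^+ 2) ^+ i.+1.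
Proof.
move=> rt; have t0 : 0 < t by exact: lt_le_trans rt.
have pr := outer_gt0 i r_gt0.
have -> : ((r / t) ^+ 2) ^+ i.+1 = (pi / i.+1%:R * t ^- (2 * i.+1)) /
    (0 + pi / i.+1%:R * r ^- (2 * i.+1)).
  have p0 : pi / i.+1%:R != 0 :> R by rewrite gt_eqF// divr_gt0// pi_gt0.
  rewrite add0r -exprM exprMn exprVn invfM invrK.
  by rewrite mulrACA mulfV// mul1r mulrC.
apply: cvgM; first exact: cvg_cst.
apply: cvgV; first by rewrite add0r gt_eqF.
by apply: cvgD; [exact: cvg_inner_mass|exact: cvg_cst].
Qed.

Lemma max_modulus_ltP n (x : n.-tuple R[i]) (t : R) : 0 < t ->
  (max_modulus x < t) <-> forall i, normc (tnth x i) < t.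
Proof.
move=> t0; split; first by move=> /bigmax_ltP[_ h] i; exact: h.
by move=> h; apply/bigmax_ltP; split => // i _; exact: h.
Qed.

Lemma measurable_max_modulus n : measurable_fun setT (@max_modulus R n).
Proof.
rewrite /max_modulus; elim: (index_enum _) => [|i s IH].
  by under eq_fun do rewrite big_nil; exact: measurable_cst.
under eq_fun do rewrite big_cons.
apply: measurable_maxr => //; apply: measurable_normc_comp; exact: measurable_tnth.
Qed.

(** Both the integral over the box and the normalizing constant are products
    over the degrees; the factor [i] comes from the degree [n - i.+1]. *)
Lemma jellium_max_modulus n d (T : measurableType d) (P : probability T R)
    (X : {RV P >-> n.-tuple R[i]}) (t : R) : is_jellium nu X -> r <= t ->
  P [set w | max_modulus (X w) < t] =
    (\prod_(0 <= i < n) (1 - outer_ratio t i (n - i.+1)))%:E.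
Proof.
move=> jX rt; have t0 : 0 < t by exact: lt_le_trans rt.
pose A : set (n.-tuple R[i]) := [set x | max_modulus x < t].
have mA : measurable A.
  rewrite (_ : A = setT `&` (@max_modulus R n : _ -> measurableTypeR R) @^-1` `]-oo, t[).
    by apply: measurable_max_modulus => //; exact: measurable_itv.
  by apply/seteqP; split => z /=; rewrite in_itv /=; [split|case].
have := jX A mA; rewrite /distribution /pushforward => ->.
have AE : A = [set x | forall i, [set z | normc z < t] (tnth x i)].
  by apply/seteqP; split => x /=; rewrite /A /= max_modulus_ltP.
rewrite AE integral_jellium_weight; last 2 first.
- exact: measurable_normc_lt.
- by move=> u z u1 /=; rewrite normcM u1 mul1r.
have -> : jellium_constant nu n = (n`!%:R%:E * \prod_(k < n) jellium_mass n k setT)%E.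
  rewrite -integral_jellium_weight//; congr integral.
  by apply/seteqP; split.
pose h i := inner_mass i (n - i.+1) + pi / i.+1%:R * r ^- (2 * i.+1).
have h0 i : 0 < h i by rewrite ltr_wpDl ?inner_mass_ge0// outer_gt0.
have rev (D : set R[i]) (q : nat -> R) :
    (forall i, (i < n)%N -> jellium_mass n (n - i.+1) D = (q i)%:E) ->
    (\prod_(k < n) jellium_mass n k D)%E = (\prod_(0 <= i < n) q i)%:E.
  move=> Hq; rewrite (reindex_inj rev_ord_inj) /= -prodEFin big_mkord.
  by apply: eq_bigr => i _; exact: Hq.
rewrite (rev _ h); last by move=> i ni; have := jellium_massT i (n - i.+1); rewrite (subnK ni).
rewrite (rev _ (fun i => h i * (1 - outer_ratio t i (n - i.+1)))); last first.
  by move=> i ni; have := jellium_mass_inside i (n - i.+1) rt; rewrite (subnK ni).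
have H0 : \prod_(0 <= i < n) h i != 0 by rewrite prodf_seq_neq0; apply/allP => i _; rewrite gt_eqF.
have F0 : n`!%:R != 0 :> R by rewrite pnatr_eq0 -lt0n fact_gt0.
rewrite -!EFinM inver mulf_eq0 (negbTE F0) (negbTE H0) /= -EFinM; congr (_%:E).
by rewrite big_split /= [n`!%:R * (_ * _)]mulrA mulKf// mulf_neq0.
Qed.

End jellium.

(** Tannery's argument: domination by a geometric sequence makes the tails of
    the products uniformly small in [n]. *)
Lemma cvg_prod_onem (R : realType) (q : nat -> nat -> R) (x : R) : 0 <= x < 1 ->
  (forall n i, (i < n)%N -> 0 <= q n i <= x ^+ i.+1) ->
  (forall i, q n i @[n --> \oo] --> x ^+ i.+1) ->
  \prod_(0 <= i < n) (1 - q n i) @[n --> \oo] --> euler x.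
Proof.
move=> x01 q0 cq; have /andP[x0 x1] := x01.
have x01' : 0 <= x <= 1 by rewrite x0 ltW.
apply/cvgrPdist_le => e e0.
have e1 : 0 < e / 3 * (1 - x) by rewrite mulr_gt0 ?subr_gt0// divr_gt0.
have [K HK] := exists_exp_lt x01 e1.
have tail : x ^+ K.+1 / (1 - x) <= e / 3 by rewrite ler_pdivrMr// subr_gt0.
have cK : \prod_(0 <= i < K) (1 - q n i) @[n --> \oo] --> euler_prod K x.
  rewrite /euler_prod; elim: (K) => [|k IH].
    by under eq_fun do rewrite big_geq//; rewrite big_geq//; exact: cvg_cst.
  under eq_fun do rewrite big_nat_recr//=.
  rewrite big_nat_recr//=; apply: cvgM; first exact: IH.
  by apply: cvgB; [exact: cvg_cst|exact: cq].
have e3 : 0 < e / 3 by rewrite divr_gt0.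
have /cvgrPdist_le/(_ _ e3) cK' := cK.
near=> n.
have Kn : (K <= n)%N by near: n; exact: nbhs_infty_ge.
have h1 : `|euler_prod K x - \prod_(0 <= i < K) (1 - q n i)| <= e / 3.
  by near: n; exact: cK'.
pose q' i := if (i < n)%N then q n i else 0.
have q'01 i : 0 <= q' i <= 1.
  rewrite /q'; case: ifP => [ni|_]; last by rewrite lexx ler01.
  have /andP[-> h] := q0 n i ni.
  by rewrite (le_trans h)// exprn_ile1// ltW.
have E k : (k <= n)%N ->
    \prod_(0 <= i < k) (1 - q n i) = \prod_(0 <= i < k) (1 - q' i).
  move=> kn; apply: eq_big_nat => i /andP[_ ik].
  by rewrite /q' (leq_trans ik kn).
have := prod_onem_cut q'01 Kn; rewrite -!E// => /andP[h2 h3].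
have h4 : \sum_(K <= i < n) q' i <= e / 3.
  apply: le_trans tail; apply: le_trans (geometric_tail K n x01).
  apply: ler_sum_nat => i /andP[_ ni]; rewrite /q' ni.
  by have /andP[] := q0 n i ni.
have h5 := euler_tail K x01; have h6 := euler_le_prod K x01'.
move: h1; rewrite !ler_norml => /andP[h1 h1']; apply/andP; split; lra.
Unshelve. all: by end_near. Qed.

Section scaled_variable.
Variables (R : realType) (r : R).
Hypothesis r_gt0 : 0 < r.

Lemma exists_small_euler e : 0 < e -> exists2 s, r < s & euler ((r / s) ^+ 2) <= e.
Proof.
move=> e0.
have : {for r, continuous (fun s : R => euler_cdf (s / r))}.
  apply: continuous_comp; last exact: continuous_euler_cdf.
  by apply: cvgMr_tmp; exact: cvg_id.
move=> /cvgrPdist_le/(_ e e0) h.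
have : \forall s \near r^'+, r < s /\ euler_cdf (s / r) <= e.
  near=> s; split; first by near: s; exact: nbhs_right_gt.
  have : `|euler_cdf (r / r) - euler_cdf (s / r)| <= e.
    by near: s; apply: cvg_within; exact: h.
  rewrite divff ?gt_eqF// {1}/euler_cdf lexx sub0r normrN; apply: le_trans.
  exact: ler_norm.
move=> /filter_ex[s [rs hs]]; exists s => //.
have s0 : 0 < s by exact: lt_trans rs.
move: hs; rewrite euler_cdfE; last by rewrite ler_pdivlMr// mul1r ltW.
by rewrite -exprVn invf_div.
Unshelve. all: by end_near. Qed.

Variables (d : measure_display) (T : measurableType d) (P : probability T R).
Variable x : T -> R.
Hypothesis x_ge1 : forall w, 1 <= x w.
Hypothesis x_law : forall t, 1 <= t -> P [set w | x w < t] = (euler (t ^- 2))%:E.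

Lemma scaled_law t : r <= t -> P [set w | r * x w < t] = (euler ((r / t) ^+ 2))%:E.
Proof.
move=> rt; have t0 : 0 < t by exact: lt_le_trans rt.
rewrite -invf_div exprVn -x_law ?ler_pdivlMr ?mul1r//; congr (P _).
by apply/seteqP; split => w /=; rewrite ltr_pdivlMr// mulrC.
Qed.

Lemma scaled_law0 t : t <= r -> P [set w | r * x w < t] = 0%E.
Proof.
move=> tr; rewrite (_ : [set w | _] = set0) ?measure0//.
apply/seteqP; split => w //=; rewrite ltNge (le_trans tr)// ler_peMr//.
exact: ltW.
Qed.

End scaled_variable.

Section jellium_convergence.
Variables (R : realType) (nu : probability R[i] R) (r : R).
Hypothesis nu_rotation : rotation_invariant nu.
Hypothesis nu_log : (\int[nu]_z `| log_modulus z | < +oo)%E.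
Hypothesis r_outer : is_max [set normc z | z in measure_support nu] r.

Lemma cvg_jellium_max_modulus (d : nat -> measure_display)
    (T : forall n, measurableType (d n)) (P : forall n, probability (T n) R)
    (X : forall n, {RV (P n) >-> n.-tuple R[i]}) (t : R) :
  (forall n, (0 < n)%N -> is_jellium nu (X n)) -> r < t ->
  fine (P n [set w | max_modulus (X n w) < t]) @[n --> \oo] --> euler ((r / t) ^+ 2).
Proof.
move=> jX rt; have r0 := outer_radius_gt0 nu_log r_outer.
have t0 : 0 < t by exact: lt_trans rt.
have x01 : 0 <= (r / t) ^+ 2 < 1.
  rewrite sqr_ge0 /= expr_lt1// ?divr_ge0 ?ltW// ltr_pdivrMr// mul1r//.
have : \prod_(0 <= i < n) (1 - outer_ratio nu r t i (n - i.+1)) @[n --> \oo] -->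
    euler ((r / t) ^+ 2).
  apply: (cvg_prod_onem (q := fun n i => outer_ratio nu r t i (n - i.+1)) x01).
  - by move=> n i _; apply: outer_ratio_itv => //; exact: ltW.
  - move=> i; rewrite -(@cvg_shiftn i.+1).
    under eq_fun do rewrite addnK.
    by apply: cvg_outer_ratio => //; exact: ltW.
apply: cvg_trans; apply: near_eq_cvg; near=> n.
rewrite (jellium_max_modulus nu_rotation nu_log r_outer (t := t))//.
- by apply: jX; near: n; exact: nbhs_infty_gt.
- exact: ltW.
Unshelve. all: by end_near. Qed.

Lemma cvg_in_law_jellium (d : nat -> measure_display)
    (T : forall n, measurableType (d n)) (P : forall n, probability (T n) R)
    (X : forall n, {RV (P n) >-> n.-tuple R[i]})
    (d' : measure_display) (T' : measurableType d') (P' : probability T' R)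
    (x : {RV P' >-> R}) : (forall w, 1 <= x w) ->
  (forall t, 1 <= t -> P' [set w | x w < t] = (euler (t ^- 2))%:E) ->
  (forall n, (0 < n)%N -> is_jellium nu (X n)) ->
  cvg_in_law P (fun n w => max_modulus (X n w)) P' (fun w => r * x w).
Proof.
move=> x1 Px jX; have r0 := outer_radius_gt0 nu_log r_outer.
have lawE := scaled_law r0 Px; have law0 := scaled_law0 r0 P' x1.
have cvg_cdf t : fine (P n [set w | max_modulus (X n w) < t]) @[n --> \oo] -->
    fine (P' [set w | r * x w < t]).
  have [rt|tr] := ltP r t.
    by rewrite (lawE _ (ltW rt)); exact: cvg_jellium_max_modulus.
  rewrite (law0 _ tr) /=; apply/cvgrPdist_le => e e0.
  have e2 : 0 < e / 2 by rewrite divr_gt0.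
  have [s rs se] := exists_small_euler r0 e2.
  have /cvgrPdist_le/(_ _ e2) cs := cvg_jellium_max_modulus jX rs.
  near=> n.
  have hs : `|euler ((r / s) ^+ 2) - fine (P n [set w | max_modulus (X n w) < s])| <= e / 2.
    by near: n; exact: cs.
  have mX u : measurable [set w | max_modulus (X n w) < u].
    apply: measurable_lt_preimage; apply: measurableT_comp => //.
    exact: measurable_max_modulus.
  have le_ts : fine (P n [set w | max_modulus (X n w) < t]) <=
      fine (P n [set w | max_modulus (X n w) < s]).
    apply: fine_le; rewrite ?fin_num_measure//.
    apply: le_measure; rewrite ?inE// => w /= /lt_trans; apply.
    exact: le_lt_trans rs.
  have ge0 : 0 <= fine (P n [set w | max_modulus (X n w) < t]) by exact: fine_ge0.
  rewrite sub0r normrN ger0_norm//; move: hs; rewrite ler_norml => /andP[? ?]; lra.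
apply: cvg_in_law_cdf.
- move=> n; apply: measurableT_comp; first exact: measurable_max_modulus.
  exact: measurable_funPT.
- exact: measurable_funM.
- exact: cvg_cdf.
- by move=> e e0; exists r; rewrite law0// ltW.
move=> e e0.
have : \forall u \near +oo, 1 < u /\ `|1 - euler_cdf u| <= e.
  near=> u; split; first by near: u; apply: nbhs_pinfty_gt; exact: num_real.
  by near: u; move/cvgrPdist_le: (@cvg_euler_cdf_y R); apply.
move=> /filter_ex[u [u1]]; rewrite euler_cdfE; last exact: ltW.
rewrite ler_norml => /andP[_ hu]; exists (r * u).
have u0 : 0 < u by exact: lt_trans u1.
rewrite lawE; last by rewrite ler_peMr// ltW.
rewrite /= invfM mulrA divff ?gt_eqF// mul1r exprVn; lra.
Unshelve. all: by end_near. Qed.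

End jellium_convergence.

(** * Determinants of kernels of finite rank *)

Lemma sumr_inj_le (R : numDomainType) (I J : finType) (h : I -> J) (F : J -> R) :
  injective h -> (forall j, 0 <= F j) -> \sum_i F (h i) <= \sum_j F j.
Proof.
move=> hI F0.
have -> : \sum_i F (h i) = \sum_(j in h @: [set: I]%SET) F j.
  rewrite big_imset /=; last by move=> ? ? _ _; exact: hI.
  by apply: eq_bigl => i; rewrite finset.in_setT.
by rewrite [leRHS](bigID (mem (h @: [set: I]%SET))) /= lerDl; exact: sumr_ge0.
Qed.

Section det_finite_rank.
Variable R : comNzRingType.

Lemma det_scale_col m (a : 'I_m -> R) (M : 'I_m -> 'I_m -> R) :
  \det (\matrix_(i, j) (a j * M i j)) = (\prod_j a j) * \det (\matrix_(i, j) M i j).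
Proof.
rewrite /determinant mulr_sumr; apply: eq_bigr => s _.
rewrite mulrCA; congr (_ * _).
under eq_bigr do rewrite mxE; rewrite big_split /=; congr (_ * _).
  by rewrite [RHS](reindex_inj (@perm_inj _ s)).
by apply: eq_bigr => i _; rewrite mxE.
Qed.

(** Expanding each entry writes the determinant as a sum over all maps from
    columns to ranks; averaging over reorderings of the columns makes the two
    factors of the kernel play symmetric roles. *)
Lemma det_finite_rank m n (b c : 'I_m -> 'I_n -> R) :
  \det (\matrix_(i, j) \sum_k b i k * c j k) *+ m`! =
  \sum_(f : {ffun 'I_m -> 'I_n})
    \det (\matrix_(i, j) b i (f j)) * \det (\matrix_(i, j) c i (f j)).
Proof.
pose C (f : {ffun 'I_m -> 'I_n}) := \det (\matrix_(i, j) c i (f j)).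
have E1 : \det (\matrix_(i, j) \sum_k b i k * c j k) =
    \sum_(f : {ffun 'I_m -> 'I_n}) (\prod_i b i (f i)) * C f.
  rewrite {1}/determinant.
  under eq_bigr => s _.
    under eq_bigr do rewrite mxE.
    rewrite bigA_distr_bigA mulr_sumr; over.
  rewrite exchange_big; apply: eq_bigr => f _ /=.
  rewrite /C -det_tr /determinant mulr_sumr; apply: eq_bigr => s _.
  rewrite big_split mulrCA; congr (_ * (_ * _)).
  by apply: eq_bigr => i _; rewrite !mxE.
have E2 (s : 'S_m) : \det (\matrix_(i, j) \sum_k b i k * c j k) =
    \sum_(f : {ffun 'I_m -> 'I_n}) ((-1) ^+ s * \prod_i b i (f (s i))) * C f.
  pose h (g : {ffun 'I_m -> 'I_n}) := [ffun i => g (s i)].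
  have hI : injective h.
    move=> f g /ffunP fg; apply/ffunP => i.
    by have := fg (s^-1%g i); rewrite !ffunE permKV.
  rewrite E1 (reindex_inj hI) /=; apply: eq_bigr => f _.
  rewrite [in RHS](mulrC _ (\prod_i _)) -mulrA; congr (_ * _).
    by apply: eq_bigr => i _; rewrite ffunE.
  rewrite /C (_ : (\matrix_(i, j) c i (h f j)) = col_perm s (\matrix_(i, j) c i (f j))).
    by rewrite col_permE det_mulmx det_perm odd_permV mulrC.
  by apply/matrixP => i j; rewrite !mxE ffunE.
have -> : \det (\matrix_(i, j) \sum_k b i k * c j k) *+ m`! =
    \sum_(s : 'S_m) \det (\matrix_(i, j) \sum_k b i k * c j k).
  by rewrite sumr_const card_Sn.
rewrite (eq_bigr _ (fun s _ => E2 s)).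
rewrite exchange_big; apply: eq_bigr => f _ /=.
rewrite -mulr_suml; congr (_ * _); rewrite /determinant; apply: eq_bigr => s _.
by congr (_ * _); apply: eq_bigr => i _; rewrite mxE.
Qed.

End det_finite_rank.

(** * Expansion of the Bergman kernel *)

(** With [s = r ^ 2] and [u = z * conjc w] the first factor is the Bergman
    kernel and the second one tends to 1. *)
Lemma sum_derivative_geometric (F : fieldType) (s p u : F) n :
  u != 0 -> u != s -> p != 0 ->
  \sum_(k < n) k.+1%:R * s ^+ k.+1 / p * u^-1 ^+ k.+2 =
  s / (p * (u - s) ^+ 2) * (1 - (n.+1%:R * (s / u) ^+ n - n%:R * (s / u) ^+ n.+1)).
Proof.
move=> u0 us p0; have us0 : u - s != 0 by rewrite subr_eq0.
elim: n => [|n IH].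
  by rewrite big_ord0 !expr0 mul1r mul0r subr0 subrr mulr0.
rewrite big_ord_recr IH /= !exprS !exprVn !exprMn -!natr1 !exprVn.
set v := u ^+ n; have v0 : v != 0 by rewrite expf_neq0.
by field; rewrite u0 us0 p0 v0.
Qed.

Section complex_sequences.
Variable R : realType.

(** Stated on coordinates, so that sums and products reduce to real limits. *)
Definition complex_cvg (u : nat -> R[i]) (l : R[i]) : Prop :=
  (complex.Re (u n) @[n --> \oo] --> complex.Re l) /\
  (complex.Im (u n) @[n --> \oo] --> complex.Im l).

Lemma complex_cvg_cst l : complex_cvg (fun=> l) l.
Proof. by split; exact: cvg_cst. Qed.

Lemma complex_cvgD u v a b : complex_cvg u a -> complex_cvg v b ->
  complex_cvg (fun n => u n + v n) (a + b).
Proof.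
have ReD (y z : R[i]) : complex.Re (y + z) = complex.Re y + complex.Re z by case: y z => ? ? [].
have ImD (y z : R[i]) : complex.Im (y + z) = complex.Im y + complex.Im z by case: y z => ? ? [].
move=> [u1 u2] [v1 v2]; split.
  by rewrite ReD; under eq_fun do rewrite ReD; exact: cvgD.
by rewrite ImD; under eq_fun do rewrite ImD; exact: cvgD.
Qed.

Lemma complex_cvgM u v a b : complex_cvg u a -> complex_cvg v b ->
  complex_cvg (fun n => u n * v n) (a * b).
Proof.
have ReM (y z : R[i]) : complex.Re (y * z) =
    complex.Re y * complex.Re z - complex.Im y * complex.Im z by case: y z => ? ? [].
have ImM (y z : R[i]) : complex.Im (y * z) =
    complex.Re y * complex.Im z + complex.Im y * complex.Re z by case: y z => ? ? [].
move=> [u1 u2] [v1 v2]; split.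
  by rewrite ReM; under eq_fun do rewrite ReM; apply: cvgB; exact: cvgM.
by rewrite ImM; under eq_fun do rewrite ImM; apply: cvgD; exact: cvgM.
Qed.

Lemma complex_cvg_sum (I : Type) (s : seq I) (P : pred I) (u : I -> nat -> R[i]) l :
  (forall i, complex_cvg (u i) (l i)) ->
  complex_cvg (fun n => \sum_(i <- s | P i) u i n) (\sum_(i <- s | P i) l i).
Proof.
move=> ul; elim: s => [|i s IH].
  by rewrite big_nil; under eq_fun do rewrite big_nil; exact: complex_cvg_cst.
rewrite big_cons; under eq_fun do rewrite big_cons.
by case: (P i) => //; exact: complex_cvgD.
Qed.

Lemma complex_cvg_prod (I : Type) (s : seq I) (P : pred I) (u : I -> nat -> R[i]) l :
  (forall i, complex_cvg (u i) (l i)) ->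
  complex_cvg (fun n => \prod_(i <- s | P i) u i n) (\prod_(i <- s | P i) l i).
Proof.
move=> ul; elim: s => [|i s IH].
  by rewrite big_nil; under eq_fun do rewrite big_nil; exact: complex_cvg_cst.
rewrite big_cons; under eq_fun do rewrite big_cons.
by case: (P i) => //; exact: complex_cvgM.
Qed.

Lemma complex_cvg_det m (u : 'I_m -> 'I_m -> nat -> R[i]) l :
  (forall i j, complex_cvg (u i j) (l i j)) ->
  complex_cvg (fun n => \det (\matrix_(i, j) u i j n)) (\det (\matrix_(i, j) l i j)).
Proof.
move=> ul; apply: complex_cvg_sum => s; apply: complex_cvgM.
  exact: complex_cvg_cst.
under eq_fun do under eq_bigr do rewrite mxE.
by under eq_bigr do rewrite mxE; exact: complex_cvg_prod.
Qed.

Lemma complex_cvg0 u : normc (u n) @[n --> \oo] --> (0 : R) -> complex_cvg u 0.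
Proof.
have Re_le (z : R[i]) : `|complex.Re z| <= normc z.
  by rewrite -sqrtr_sqr normc_Re_Im ler_wsqrtr// lerDl sqr_ge0.
have Im_le (z : R[i]) : `|complex.Im z| <= normc z.
  by rewrite -sqrtr_sqr normc_Re_Im ler_wsqrtr// lerDr sqr_ge0.
move=> u0; split; apply/cvgr0Pnorm_le => e e0; move/cvgr0Pnorm_le: u0 => /(_ _ e0);
  apply: filterS => n; rewrite (ger0_norm (normc_ge0 _)).
  exact: le_trans.
exact: le_trans.
Qed.

Lemma cvg_mulrn_expr (x : R) : 0 <= x < 1 -> n%:R * x ^+ n @[n --> \oo] --> 0.
Proof.
move=> /andP[x0 x1]; pose y := Num.sqrt x.
have y0 : 0 <= y by exact: sqrtr_ge0.
have yx : y ^+ 2 = x by exact: sqr_sqrtr.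
have y1 : y < 1 by rewrite -(@expr_lt1 _ 2)// yx.
have y1' : 0 < 1 - y by rewrite subr_gt0.
(* one factor y^n of x^n turns n into a geometric sum, the other tends to 0 *)
have h n : n%:R * x ^+ n <= y ^+ n / (1 - y).
  rewrite -yx -exprM mulnC exprM expr2 mulrA mulrC; apply: ler_wpM2l; first exact: exprn_ge0.
  have le1 : n%:R * y ^+ n <= \sum_(0 <= k < n) y ^+ k.
    rewrite mulr_natl -[X in _ *+ X]subn0 -sumr_const_nat; apply: ler_sum_nat => k /andP[_ kn].
    by apply: ler_wiXn2l; rewrite ?y0 ?(ltW y1) ?(ltnW kn).
  apply: le_trans le1 _; rewrite -[leRHS]mul1r ler_pdivlMr//.
  have yn : 0 <= y ^+ n by exact: exprn_ge0.
  by rewrite big_mkord; move: (subrX1 y n) yn; lra.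
apply: (@squeeze_cvgr _ _ _ _ (fun=> 0) (fun n => y ^+ n / (1 - y))).
- by near=> n; rewrite h andbT mulr_ge0// exprn_ge0.
- exact: cvg_cst.
- rewrite -[X in _ --> X](mul0r (1 - y)^-1); apply: cvgMr_tmp.
  by apply: cvg_expr; rewrite ger0_norm.
Unshelve. all: by end_near. Qed.

End complex_sequences.

Section bergman_expansion.
Variables (R : realType) (r : R).
Hypothesis r_gt0 : 0 < r.

(** The inverse of the squared norm of the monomial 1 / z^(k+2) outside the disc
    of radius [r]. *)
Definition bergman_coef k : R := k.+1%:R * (r ^+ 2) ^+ k.+1 / pi.

(** The first [n] terms of the expansion of the Bergman kernel at infinity. *)
Definition bergman_trunc n (z w : R[i]) : R[i] :=
  \sum_(k < n) (bergman_coef k)%:C%C * (z * conjc w)^-1 ^+ k.+2.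

Lemma complex_cvg_bergman z w : r < normc z -> r < normc w ->
  complex_cvg (fun n => bergman_trunc n z w) (bergman_kernel r z w).
Proof.
move=> rz rw; set u := z * conjc w; set s := ((r ^+ 2)%:C)%C; set p := (pi%:C)%C : R[i].
have nu : r ^+ 2 < normc u.
  by rewrite /u normcM normc_conj expr2 ltr_pM// ltW.
have u0 : u != 0 by rewrite -normc_gt0 (lt_trans _ nu)// exprn_gt0.
have ns : normc s = r ^+ 2 by rewrite /s normc_real ger0_norm// sqr_ge0.
have us : u != s.
  by apply/eqP => us; move: nu; rewrite us ns ltxx.
have p0 : p != 0 by rewrite -normc_gt0 /p normc_real gtr0_norm ?pi_gt0.
pose q := s / u; have nq : normc q = r ^+ 2 / normc u by rewrite /q normcM normcV ns.
have q01 : 0 <= normc q < 1.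
  by rewrite normc_ge0 nq ltr_pdivrMr ?mul1r// (lt_trans _ nu)// exprn_gt0.
have E n : bergman_trunc n z w = bergman_kernel r z w *
    (1 - (n.+1%:R * q ^+ n - n%:R * q ^+ n.+1)).
  rewrite /bergman_trunc /bergman_kernel -/u -/s -/p -(sum_derivative_geometric n u0 us p0).
  apply: eq_bigr => k _; congr (_ * _).
  rewrite /bergman_coef /p !rmorphM /= fmorphV rmorphXn /= rmorph_nat.
  by [].
under eq_fun do rewrite E.
rewrite -[X in complex_cvg _ X]mulr1; apply: complex_cvgM; first exact: complex_cvg_cst.
rewrite -[X in complex_cvg _ X]addr0; apply: complex_cvgD; first exact: complex_cvg_cst.
apply: complex_cvg0.
have bnd n : normc (- (n.+1%:R * q ^+ n - n%:R * q ^+ n.+1)) <=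
    2 * (n%:R * normc q ^+ n) + normc q ^+ n.
  have nat_normc k : normc (k%:R : R[i]) = k%:R.
    by rewrite -(rmorph_nat (real_complex R)) normc_real ger0_norm.
  rewrite normcN; apply: le_trans (le_normcD _ _) _.
  have N k l : normc (k%:R * q ^+ l) = k%:R * normc q ^+ l.
    by rewrite normcM nat_normc normcX.
  rewrite normcN !N -natr1.
  have qn0 : 0 <= normc q ^+ n by rewrite exprn_ge0// normc_ge0.
  have qSn : normc q ^+ n.+1 <= normc q ^+ n.
    by apply: ler_wiXn2l; rewrite ?normc_ge0// ltW//; case/andP: q01.
  have : n%:R * normc q ^+ n.+1 <= n%:R * normc q ^+ n by apply: ler_wpM2l.
  lra.
apply: (@squeeze_cvgr _ _ _ _ (fun=> 0) (fun n => 2 * (n%:R * normc q ^+ n) + normc q ^+ n)).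
- by near=> n; rewrite normc_ge0 bnd.
- exact: cvg_cst.
rewrite -[X in _ --> X]addr0 -{1}(mulr0 (2 : R)); apply: cvgD.
  by apply: cvgMl_tmp; exact: cvg_mulrn_expr.
by apply: cvg_expr; case/andP: q01 => q0 q1; rewrite ger0_norm.
Unshelve. all: by end_near. Qed.

(** The determinant of the truncated kernel, in a form that is visibly
    nonnegative and nondecreasing in [n]. *)
Definition trunc_det m n (x : m.-tuple R[i]) : R :=
  m`!%:R^-1 * \sum_(f : {ffun 'I_m -> 'I_n}) (\prod_j bergman_coef (f j)) *
    normc (\det (\matrix_(i, j) (conjc (tnth x i))^-1 ^+ (f j).+2)) ^+ 2.

Lemma det_bergman_trunc m n (x : m.-tuple R[i]) :
  kernel_det (bergman_trunc n) x = (trunc_det n x)%:C%C.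
Proof.
have F0 : (m`!%:R : R[i]) != 0 by rewrite pnatr_eq0 -lt0n fact_gt0.
apply: (mulfI F0); rewrite mulr_natl /kernel_det.
rewrite /trunc_det rmorphM fmorphV rmorph_nat mulrA divff// mul1r rmorph_sum.
pose c i (k : 'I_n) : R[i] := (conjc (tnth x i))^-1 ^+ k.+2.
pose b i (k : 'I_n) : R[i] := (bergman_coef k)%:C%C * conjc (c i k).
rewrite (_ : (\matrix_(i, j) bergman_trunc n (tnth x i) (tnth x j)) =
   (\matrix_(i, j) \sum_k b i k * c j k)); last first.
  apply/matrixP => i j; rewrite !mxE; apply: eq_bigr => k _.
  rewrite /b /c -mulrA; congr (_ * _).
  by rewrite rmorphXn /= fmorphV /= conjcK -exprMn -invfM.
rewrite det_finite_rank; apply: eq_bigr => f _.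
rewrite (det_scale_col (fun j => (bergman_coef (f j))%:C%C)) rmorphM rmorph_prod -mulrA; congr (_ * _).
rewrite mulrC; transitivity (\det (\matrix_(i, j) c i (f j)) *
    conjc (\det (\matrix_(i, j) c i (f j)))); last by apply/esym; exact: sqr_normcE.
congr (_ * _); rewrite -det_map_mx; congr (\det _); apply/matrixP => i j; rewrite !mxE//.
Qed.

Lemma bergman_coef_ge0 k : 0 <= bergman_coef k.
Proof. by rewrite divr_ge0 ?pi_ge0// mulr_ge0// exprn_ge0// sqr_ge0. Qed.

Lemma trunc_det_ge0 m n (x : m.-tuple R[i]) : 0 <= trunc_det n x.
Proof.
rewrite mulr_ge0// sumr_ge0// => f _; rewrite mulr_ge0 ?sqr_ge0//.
by rewrite prodr_ge0// => j _; exact: bergman_coef_ge0.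
Qed.

Lemma trunc_det_nondecreasing m (x : m.-tuple R[i]) :
  nondecreasing_seq (fun n => trunc_det n x).
Proof.
apply/nondecreasing_seqP => n; apply: ler_wpM2l => //.
pose h (f : {ffun 'I_m -> 'I_n}) : {ffun 'I_m -> 'I_n.+1} :=
  [ffun i => widen_ord (leqnSn n) (f i)].
have hI : injective h.
  move=> f g /ffunP fg; apply/ffunP => i; apply: val_inj.
  by have := congr1 val (fg i); rewrite !ffunE.
pose F (f : {ffun 'I_m -> 'I_n.+1}) : R := (\prod_j bergman_coef (f j)) *
    normc (\det (\matrix_(i, j) (conjc (tnth x i))^-1 ^+ (f j).+2)) ^+ 2.
rewrite (_ : \sum_(f : {ffun 'I_m -> 'I_n}) _ = \sum_f F (h f)).
  apply: (sumr_inj_le hI) => f; rewrite mulr_ge0 ?sqr_ge0//.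
  by rewrite prodr_ge0// => j _; exact: bergman_coef_ge0.
apply: eq_bigr => f _; rewrite /F; congr (_ * _).
  by apply: eq_bigr => j _; rewrite ffunE.
congr (_ ^+ 2); congr normc; congr (\det _).
by apply/matrixP => i j; rewrite !mxE ffunE.
Qed.

Lemma cvg_trunc_det m (x : m.-tuple R[i]) : (forall i, r < normc (tnth x i)) ->
  trunc_det n x @[n --> \oo] --> complex.Re (kernel_det (bergman_kernel r) x).
Proof.
move=> rx; have [+ _] : complex_cvg (fun n => kernel_det (bergman_trunc n) x)
    (kernel_det (bergman_kernel r) x).
  by apply: complex_cvg_det => i j; exact: complex_cvg_bergman.
by under eq_fun do rewrite det_bergman_trunc.
Qed.

Lemma kernel_det_ge0 m (x : m.-tuple R[i]) : (forall i, r < normc (tnth x i)) ->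
  0 <= complex.Re (kernel_det (bergman_kernel r) x).
Proof.
move=> rx; have h := cvg_trunc_det rx.
rewrite -(cvg_lim (@Rhausdorff R) h); apply: limr_ge; first by apply/cvg_ex; eexists; exact: h.
by near=> n; exact: trunc_det_ge0.
Unshelve. all: by end_near. Qed.

Lemma kernel_det_diag m (x : m.-tuple R[i]) i j : i != j -> tnth x i = tnth x j ->
  kernel_det (bergman_kernel r) x = 0.
Proof.
move=> ij xij; apply: (determinant_alternate ij) => k; rewrite !mxE xij//.
Qed.

(** * Correlation integrals of the Bergman kernel outside a disc *)

Notation cleb := (complex_lebesgue R).
Notation leb n := (lebesgue_Cn R n).

Lemma measurable_conjcV : measurable_fun setT (fun z : R[i] => (conjc z)^-1).
Proof.
have mn : measurable_fun setT (fun z : R[i] => (normc z ^+ 2)^-1).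
  apply: measurable_inv_ge0 => [z|]; first exact: sqr_ge0.
  by apply: measurable_funX; exact: measurable_normc.
have mc : measurable_fun setT (fun z : R[i] => ((normc z ^+ 2)^-1)%:C%C).
  by apply: measurable_Complex => //; exact: measurable_cst.
rewrite (_ : (fun z => _) = (fun z : R[i] => z * ((normc z ^+ 2)^-1)%:C%C)); last first.
  apply/funext => z; have [->|z0] := eqVneq z 0.
    by rewrite rmorph0 invr0 mul0r.
  rewrite fmorphV /= sqr_normcE invfM mulrA divff ?mul1r//.
by apply: measurable_complexM => //; exact: measurable_id.
Qed.

Lemma conjcV_rotation (u z : R[i]) : normc u = 1 -> (conjc (u * z))^-1 = u * (conjc z)^-1.
Proof.
move=> u1; have u0 : u != 0 by rewrite -normc_gt0 u1.
have uu : conjc u * u = 1 by rewrite mulrC -sqr_normcE u1 expr1n.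
have -> : conjc (u * z) = conjc u * conjc z by rewrite rmorphM.
by rewrite invfM (mulr1_eq uu).
Qed.

Definition outer_box m t : set (m.-tuple R[i]) :=
  [set x | forall i, t <= normc (tnth x i)].

Lemma measurable_outer_box m t : measurable (@outer_box m t).
Proof.
rewrite (_ : outer_box t = \bigcap_(i in [set: 'I_m])
    ((fun x : m.-tuple R[i] => tnth x i) @^-1` [set z | t <= normc z])); last first.
  by apply/seteqP; split => [x h i _|x h i]; apply: h.
apply: fin_bigcap_measurable; first exact: finite_finset.
move=> i _; rewrite -[X in measurable X]setTI.
by apply: measurable_tnth => //; exact: measurable_normc_ge.
Qed.

Lemma measurable_sqr_det_ffun m n (f : {ffun 'I_m -> 'I_n}) :
  measurable_fun setT (fun x : m.-tuple R[i] =>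
    normc (\det (\matrix_(i, j) (conjc (tnth x i))^-1 ^+ (f j).+2)) ^+ 2).
Proof.
apply: measurable_funX; apply: measurable_normc_comp.
apply: measurable_det => i j; apply: measurable_complexX.
by apply: (measurableT_comp measurable_conjcV); exact: measurable_tnth.
Qed.

Lemma measurable_trunc_det m n : measurable_fun setT (@trunc_det m n).
Proof.
apply: measurable_funM; first exact: measurable_cst.
apply: measurable_sum => f; apply: measurable_funM; first exact: measurable_cst.
exact: measurable_sqr_det_ffun.
Qed.

Lemma integral_sqr_det_outer m n (f : {ffun 'I_m -> 'I_n}) t : 0 < t ->
  (\int[leb m]_(x in outer_box t)
    (normc (\det (\matrix_(i, j) (conjc (tnth x i))^-1 ^+ (f j).+2)) ^+ 2)%:E =
   (if injectiveb f then m`!%:R * \prod_j (pi / (f j).+1%:R * t ^- (2 * (f j).+1))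
    else 0)%:E)%E.
Proof.
move=> t0; case: (boolP (injectiveb f)) => [/injectiveP fI|]; last first.
  move=> /injectivePn[j1 [j2 j12 fj]].
  rewrite (_ : (fun x => _) = fun=> 0%E) ?integral0//.
  apply/funext => x; rewrite -det_tr (determinant_alternate j12) ?normc0 ?expr0n//.
  by move=> k; rewrite !mxE fj.
pose B : set R[i] := [set z | t <= normc z].
have mB : measurable B by exact: measurable_normc_ge.
pose g z : \bar R := (\1_B z)%:E.
have mg : measurable_fun setT g by apply/measurable_EFinP; exact: measurable_indic.
have g0 z : (0 <= g z)%E by rewrite lee_fin indicE.
have grot u z : normc u = 1 -> g (u * z) = g z.
  by move=> u1; rewrite /g !indicE; congr (_%:R%:E); congr nat_of_bool;
    apply/idP/idP; rewrite !inE /B /= normcM u1 mul1r.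
have eI : injective (fun j : 'I_m => (f j).+2).
  by move=> j1 j2 [] /val_inj; exact: fI.
have := integral_sqr_det measurable_conjcV conjcV_rotation mg g0 grot eI.
rewrite [in X in _ -> X]integral_mkcond => ih.
transitivity (m`!%:R%:E * \prod_(j < m) \int[cleb]_z
   ((normc (conjc z)^-1 ^+ (2 * (f j).+2))%:E * g z))%E; last first.
  rewrite EFinM -prodEFin; congr (_ * _)%E; apply: eq_bigr => j _.
  rewrite -(integral_outer_power t0 (ltn0Sn (f j))) [RHS]integral_mkcond.
  apply: eq_integral => z _; rewrite patchE /g indicE -/B normcV normc_conj exprVn.
  by case: (z \in B) => /=; rewrite ?mule1 ?mule0.
rewrite -ih; apply: eq_integral => x _; rewrite patchE.
case: (boolP (x \in _)); rewrite ?inE => xB.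
  have -> : (\prod_(i < m) g (tnth x i) = 1)%E.
    by rewrite big1// => i _; rewrite /g indicE mem_set//; exact: xB.
  by rewrite mule1.
have [i xi] : exists i, ~ B (tnth x i) by apply/existsNP; move/negP: xB; rewrite inE.
have -> : (\prod_(i < m) g (tnth x i) = 0)%E.
  by rewrite (bigD1 i)//= /g indicE memNset// mul0e.
by rewrite mule0.
Qed.

(** The elementary symmetric function of degree [m] in y, ..., y^n, multiplied
    by [m`!]: in this form it is what the integral of a determinant produces. *)
Definition injective_sum m n (y : R) : R :=
  \sum_(f : {ffun 'I_m -> 'I_n} | injectiveb f) \prod_j y ^+ (f j).+1.

Lemma integral_trunc_det m n t : 0 < t ->
  (\int[leb m]_(x in outer_box t) (trunc_det n x)%:E =
   (injective_sum m n ((r / t) ^+ 2))%:E)%E.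
Proof.
move=> t0; have mbox := @measurable_outer_box m t.
pose F (f : {ffun 'I_m -> 'I_n}) (x : m.-tuple R[i]) : R :=
  normc (\det (\matrix_(i, j) (conjc (tnth x i))^-1 ^+ (f j).+2)) ^+ 2.
pose c (f : {ffun 'I_m -> 'I_n}) : R := m`!%:R^-1 * \prod_j bergman_coef (f j).
have c0 f : 0 <= c f.
  by rewrite mulr_ge0// prodr_ge0// => j _; exact: bergman_coef_ge0.
have mF f : measurable_fun (outer_box t) (EFin \o F f).
  apply: (measurable_funS measurableT) => //; apply/measurable_EFinP.
  exact: measurable_sqr_det_ffun.
transitivity (\int[leb m]_(x in outer_box t) (\sum_f (c f)%:E * (F f x)%:E))%E.
  apply: eq_integral => x _; rewrite /trunc_det mulr_sumr -sumEFin.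
  by apply: eq_bigr => f _; rewrite mulrA EFinM.
rewrite (ge0_integral_sum _ mbox); last 2 first.
- by move=> f; apply: measurable_funeM; exact: mF.
- by move=> f x _; rewrite mule_ge0// lee_fin ?sqr_ge0.
transitivity (\sum_(f : {ffun 'I_m -> 'I_n}) (if injectiveb f then
   \prod_j ((r / t) ^+ 2) ^+ (f j).+1 else 0)%:E)%E; last first.
  by rewrite sumEFin -big_mkcond.
apply: eq_bigr => f _; rewrite (ge0_integralZl _ mbox (mF f)); last 2 first.
- by move=> x _; rewrite lee_fin sqr_ge0.
- by rewrite lee_fin.
rewrite integral_sqr_det_outer// -EFinM; congr (_%:E).
case: (injectiveb f); last by rewrite mulr0.
have F0 : m`!%:R != 0 :> R by rewrite pnatr_eq0 -lt0n fact_gt0.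
rewrite /c mulrAC mulrA mulVf// mul1r -big_split /=; apply: eq_bigr => j _.
rewrite /bergman_coef -!exprM exprMn exprVn.
have p0 : pi != 0 :> R by rewrite gt_eqF// pi_gt0.
have k0 : (f j).+1%:R != 0 :> R by [].
have cancel (p k a b : R) : p != 0 -> k != 0 -> b != 0 -> p / k / b * (k * a / p) = a / b.
  by move=> ? ? ?; field; apply/and3P.
by apply: cancel; rewrite // expf_neq0// gt_eqF.
Qed.

End bergman_expansion.

(** * Inclusion and exclusion *)

Section inclusion_exclusion.
Variable R : realType.

(** A set with [m] elements is the image of [m`!] injections. *)
Lemma injective_sum_subsets m n (y : R) : injective_sum m n y = m`!%:R *
  \sum_(A : {set 'I_n} | #|A| == m) \prod_(k in A) y ^+ k.+1.
Proof.
rewrite /injective_sum.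
rewrite (partition_big (fun f : {ffun 'I_m -> 'I_n} => [set f x | x in 'I_m]%SET)
  (fun A => #|A| == m)) /=; last first.
  by move=> f /injectiveP fI; rewrite finset.card_imset// card_ord.
rewrite mulr_sumr; apply: eq_bigr => A /eqP cA.
rewrite (eq_bigr (fun=> \prod_(k in A) y ^+ k.+1)); last first.
  move=> f /andP[/injectiveP fI /eqP <-].
  by rewrite big_imset//= => ? ? _ _; exact: fI.
rewrite sumr_const mulr_natl; congr (_ *+ _).
have := card_inj_ffuns_on 'I_m (mem A); rewrite card_ord cA ffactnn => <-.
apply: eq_card => f; rewrite !inE [in RHS]andbC; apply: andb_id2l => /injectiveP fI.
apply/eqP/ffun_onP => [<- i|fA]; first exact: imset_f.
apply/eqP; rewrite eqEcard finset.card_imset// card_ord cA leqnn andbT.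
by apply/fintype.subsetP => _ /imsetP[i _ ->]; exact: fA.
Qed.

Lemma injective_sum_ge0 m n (y : R) : 0 <= y -> 0 <= injective_sum m n y.
Proof. by move=> y0; apply: sumr_ge0 => f _; apply: prodr_ge0 => j _; exact: exprn_ge0. Qed.

Lemma injective_sum_eq0 m n (y : R) : (n < m)%N -> injective_sum m n y = 0.
Proof.
move=> nm; apply: big1 => f /injectiveP /leq_card; rewrite !card_ord => mn.
by move: (leq_trans nm mn); rewrite ltnn.
Qed.

Lemma euler_prod_injective_sum n (y : R) :
  euler_prod n y = \sum_(m < n.+1) (-1) ^+ m * (injective_sum m n y / m`!%:R).
Proof.
rewrite /euler_prod big_mkord.
under eq_bigr do rewrite addrC.
rewrite bigA_distr /=.
rewrite (partition_big (fun A : {set 'I_n} => inord #|A| : 'I_n.+1) xpredT)//=.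
apply: eq_bigr => m _.
have F0 : m`!%:R != 0 :> R by rewrite pnatr_eq0 -lt0n fact_gt0.
rewrite injective_sum_subsets mulrAC divff// mul1r mulr_sumr.
apply: eq_big => [A|A].
  rewrite -val_eqE /= inordK// ltnS -[X in (_ <= X)%N](card_ord n); exact: max_card.
move=> /eqP <-; rewrite inordK; last by rewrite ltnS -[X in (_ <= X)%N](card_ord n); exact: max_card.
by rewrite -prodrN -big_mkcond /=.
Qed.

Lemma injective_sum_le m n (y : R) : 0 <= y < 1 ->
  injective_sum m n y <= (y / (1 - y)) ^+ m.
Proof.
move=> y01; have /andP[y0 y1] := y01.
apply: (@le_trans _ _ (\sum_(f : {ffun 'I_m -> 'I_n}) \prod_j y ^+ (f j).+1)).
  rewrite [leRHS](bigID (fun f : {ffun 'I_m -> 'I_n} => injectiveb f)) /= lerDl.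
  by apply: sumr_ge0 => f _; apply: prodr_ge0 => j _; exact: exprn_ge0.
rewrite -(bigA_distr_bigA (fun (i : 'I_m) (k : 'I_n) => y ^+ k.+1)) /=.
rewrite prodr_const card_ord; apply: lerXn2r; rewrite ?nnegrE.
- by apply: sumr_ge0 => k _; exact: exprn_ge0.
- by rewrite divr_ge0// subr_ge0 ltW.
by have := geometric_tail 0 n y01; rewrite big_mkord.
Qed.

Lemma injective_sum_nondecreasing m (y : R) : 0 <= y ->
  nondecreasing_seq (fun n => injective_sum m n y).
Proof.
move=> y0; apply/nondecreasing_seqP => n.
pose h (f : {ffun 'I_m -> 'I_n}) : {ffun 'I_m -> 'I_n.+1} :=
  [ffun i => widen_ord (leqnSn n) (f i)].
have hE f i : h f i = f i :> nat by rewrite ffunE.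
have hI : injective h.
  by move=> f g fg; apply/ffunP => i; apply: val_inj; rewrite /= -!hE fg.
pose F (f : {ffun 'I_m -> 'I_n.+1}) : R :=
  if injectiveb f then \prod_j y ^+ (f j).+1 else 0.
rewrite /injective_sum big_mkcond [leRHS]big_mkcond.
rewrite (eq_bigr (fun f => F (h f))).
  apply: (sumr_inj_le hI) => f; rewrite /F; case: ifP => // _.
  by apply: prodr_ge0 => j _; exact: exprn_ge0.
move=> f _; rewrite /F (_ : injectiveb (h f) = injectiveb f).
  by case: ifP => // _; apply: eq_bigr => j _; rewrite hE.
apply/injectiveP/injectiveP => fI i j fij; apply: fI.
  by apply: val_inj; rewrite /= !hE fij.
by apply: val_inj; rewrite /= -!hE fij.
Qed.

(** For [y = (r / t) ^ 2], the integral over all tuples outside the disc of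
    radius [t] of the correlation function of order [m]. *)
Definition correlation_sum m (y : R) : R := limn (fun n => injective_sum m n y).

Lemma cvg_injective_sum m (y : R) : 0 <= y < 1 ->
  injective_sum m n y @[n --> \oo] --> correlation_sum m y.
Proof.
move=> y01; have /andP[y0 y1] := y01.
apply: nondecreasing_is_cvgn; first exact: injective_sum_nondecreasing.
by exists ((y / (1 - y)) ^+ m) => _ [n _ <-]; exact: injective_sum_le.
Qed.

Lemma correlation_sum_le m (y : R) : 0 <= y < 1 ->
  correlation_sum m y <= (y / (1 - y)) ^+ m.
Proof.
move=> y01; apply: limr_le; first by apply/cvg_ex; eexists; exact: cvg_injective_sum.
by near=> n; exact: injective_sum_le.
Unshelve. all: by end_near. Qed.

(** The elementary symmetric sums of the finite products are bounded by the
    terms of an exponential series, whatever the number of factors, so that the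
    expansion passes to the limit term by term. *)
Lemma euler_truncation M (y : R) : 0 <= y < 1 ->
  `|euler y - \sum_(m < M) (-1) ^+ m * (correlation_sum m y / m`!%:R)| <=
  expR (y / (1 - y)) - series (exp_coeff (y / (1 - y))) M.
Proof.
move=> y01; have /andP[y0 y1] := y01; set S := y / (1 - y).
have S0 : 0 <= S by rewrite divr_ge0// subr_ge0 ltW.
have coef0 m : 0 <= exp_coeff S m by rewrite divr_ge0// exprn_ge0.
have fact0 m : 0 < m`!%:R :> R by rewrite ltr0n fact_gt0.
have bnd n : `|euler_prod n y - \sum_(m < M) (-1) ^+ m * (injective_sum m n y / m`!%:R)| <=
    expR S - series (exp_coeff S) M.
  (* there is no injection for m > n, so that the sum may run past M *)
  have -> : euler_prod n y =
      \sum_(0 <= m < M + n.+1) (-1) ^+ m * (injective_sum m n y / m`!%:R).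
    rewrite euler_prod_injective_sum -(big_mkord xpredT (fun m => (-1) ^+ m * (injective_sum m n y / m`!%:R))).
    rewrite [RHS](@big_cat_nat _ _ _ n.+1)//=; last exact: leq_addl.
    rewrite [X in _ = _ + X]big_nat_cond [X in _ = _ + X]big1 ?addr0// => m /andP[/andP[nm _] _].
    by rewrite injective_sum_eq0// mul0r mulr0.
  rewrite (@big_cat_nat _ _ _ M)//=; last exact: leq_addr.
  rewrite big_mkord addrAC subrr add0r.
  apply: le_trans (ler_norm_sum _ _ _) _.
  apply: (@le_trans _ _ (\sum_(M <= m < M + n.+1) exp_coeff S m)).
    apply: ler_sum => m _; rewrite normrM normrX normrN1 expr1n mul1r.
    rewrite ger0_norm; last by rewrite divr_ge0// injective_sum_ge0.
    by rewrite /exp_coeff /= ler_pM2r ?invr_gt0//; exact: injective_sum_le.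
  rewrite lerBrDl; have -> : series (exp_coeff S) M + \sum_(M <= m < M + n.+1) exp_coeff S m =
      series (exp_coeff S) (M + n.+1).
    by rewrite /series /= [RHS](@big_cat_nat _ _ _ M)//= leq_addr.
  apply: nondecreasing_cvgn_le; last exact: is_cvg_series_exp_coeff.
  by apply/nondecreasing_seqP => m; rewrite /series /= big_nat_recr//= lerDl.
have c : `|euler_prod n y - \sum_(m < M) (-1) ^+ m * (injective_sum m n y / m`!%:R)|
    @[n --> \oo] --> `|euler y - \sum_(m < M) (-1) ^+ m * (correlation_sum m y / m`!%:R)|.
  apply: cvg_norm; apply: cvgB; first by apply: cvg_euler; rewrite y0 ltW.
  elim: (M) => [|K IH].
    by under eq_fun do rewrite big_ord0; rewrite big_ord0; exact: cvg_cst.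
  under eq_fun do rewrite big_ord_recr /=; rewrite big_ord_recr /=.
  apply: cvgD => //; apply: cvgMl_tmp; apply: cvgMr_tmp; exact: cvg_injective_sum.
rewrite -(cvg_lim (@Rhausdorff R) c); apply: limr_le; first by apply/cvg_ex; eexists; exact: c.
by near=> n; exact: bnd.
Unshelve. all: by end_near. Qed.

Lemma sum_alternating_bin N M :
  \sum_(m < M.+1) (-1) ^+ m * 'C(N.+1, m)%:R = (-1) ^+ M * 'C(N, M)%:R :> R.
Proof.
elim: M => [|M IH]; first by rewrite big_ord1 !bin0.
by rewrite big_ord_recr IH /= binS natrD exprS; ring.
Qed.

(** The truncated alternating sum collapses to one binomial coefficient. *)
Lemma bonferroni (N M : nat) :
  `|(N == 0)%N%:R - \sum_(m < M) (-1) ^+ m * 'C(N, m)%:R| <= 'C(N, M)%:R :> R.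
Proof.
case: M => [|M].
  by rewrite big_ord0 subr0 bin0; case: (N == 0)%N; rewrite ?normr1 ?normr0.
case: N => [|N]; last first.
  rewrite sum_alternating_bin sub0r normrN normrM normrX normrN1 expr1n mul1r.
  by rewrite ger0_norm// ler_nat binS leq_addl.
rewrite big_ord_recl big1 ?addr0; first by rewrite expr0 mul1r bin0 subrr normr0.
by move=> i _; rewrite bin0n mulr0.
Qed.

Lemma measurable_ffact d (T : measurableType d) (c : T -> nat) m :
  measurable_fun setT (fun w => (c w)%:R : R) ->
  measurable_fun setT (fun w => ((c w) ^_ m)%:R : R).
Proof.
move=> mc; elim: m => [|m IH]; first exact: measurable_cst.
(* the truncated subtraction of natural numbers is a maximum with 0 *)
rewrite (_ : (fun w => _) = (fun w => ((c w) ^_ m)%:R * Num.max 0 ((c w)%:R - m%:R))).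
  apply: measurable_funM => //; apply: measurable_maxr; first exact: measurable_cst.
  by apply: measurable_funB => //; exact: measurable_cst.
apply/funext => w; rewrite ffactnSr natrM; congr (_ * _).
have [mc'|cm] := leqP m (c w).
  by rewrite natrB// max_r// subr_ge0 ler_nat.
by rewrite max_l ?subr_le0 ?ler_nat 1?ltnW//; move/ltnW: cm; rewrite -subn_eq0 => /eqP ->.
Qed.

(** Both the probability and the Euler product are approximated by the same
    alternating sums of factorial moments, with errors bounded by a term and by
    a tail of a convergent exponential series. *)
Lemma probability_no_point d (T : measurableType d) (P : probability T R)
    (c : T -> nat) (y : R) : 0 <= y < 1 ->
  measurable_fun setT (fun w => (c w)%:R : R) ->
  (forall m, \int[P]_w ((c w) ^_ m)%:R%:E = (correlation_sum m y)%:E)%E ->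
  P [set w | c w = 0%N] = (euler y)%:E.
Proof.
move=> y01 mc mom; have /andP[y0 y1] := y01; set S := y / (1 - y).
have S0 : 0 <= S by rewrite divr_ge0// subr_ge0 ltW.
have fact0 m : 0 < m`!%:R :> R by rewrite ltr0n fact_gt0.
have mf m := measurable_ffact m mc.
have binE w m : 'C(c w, m)%:R = ((c w) ^_ m)%:R / m`!%:R :> R.
  by rewrite -bin_ffact natrM mulfK// gt_eqF.
have mb m : measurable_fun setT (fun w => 'C(c w, m)%:R : R).
  by under eq_fun do rewrite binE; apply: measurable_funM => //; exact: measurable_cst.
have ib m : (\int[P]_w ('C(c w, m)%:R)%:E = (correlation_sum m y / m`!%:R)%:E)%E.
  transitivity (\int[P]_w ((m`!%:R^-1)%:E * (((c w) ^_ m)%:R)%:E))%E.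
    by apply: eq_integral => w _; rewrite binE mulrC EFinM.
  rewrite (ge0_integralZl _ measurableT).
  - by rewrite mom -EFinM mulrC.
  - by apply/measurable_EFinP; exact: mf.
  - by move=> w _; rewrite lee_fin.
  - by rewrite lee_fin invr_ge0 ltW.
have intb m : P.-integrable setT (EFin \o (fun w => 'C(c w, m)%:R)).
  apply/integrableP; split; first by apply/measurable_EFinP; exact: mb.
  rewrite (eq_integral (fun w => ('C(c w, m)%:R)%:E)); first by rewrite ib ltry.
  by move=> w _; rewrite /= ger0_norm.
have Rb m : \int[P]_w ('C(c w, m)%:R) = correlation_sum m y / m`!%:R.
  by rewrite /Rintegral ib.
have A0E : [set w | c w = 0%N] = [set w | (c w)%:R < 1 :> R].
  apply/seteqP; split => w /=; first by move=> ->.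
  by rewrite (ltr_nat _ _ 1) ltnS leqn0 => /eqP.
have mA : measurable [set w | c w = 0%N].
  by rewrite A0E; exact: measurable_lt_preimage.
pose A := [set w | c w = 0%N].
have AE w : \1_A w = (c w == 0)%N%:R :> R.
  rewrite indicE; congr (nat_of_bool _)%:R; apply/idP/idP; rewrite inE; first by move=> ->.
  by move/eqP.
have int0 : P.-integrable setT (EFin \o \1_A).
  exact: integrable_indic.
have R0 : \int[P]_w \1_A w = fine (P A).
  by rewrite /Rintegral integral_indic// setIT.
have RS M : P.-integrable setT (EFin \o (fun w => \sum_(m < M) (-1) ^+ m * 'C(c w, m)%:R))
    /\ \int[P]_w (\sum_(m < M) (-1) ^+ m * 'C(c w, m)%:R) =
    \sum_(m < M) (-1) ^+ m * (correlation_sum m y / m`!%:R).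
  elim: M => [|M [iM RM]].
    rewrite big_ord0; under eq_fun do rewrite big_ord0; split.
      exact: finite_measure_integrable_cst.
    by rewrite Rintegral_cst// mul0r.
  have iZ : P.-integrable setT (EFin \o (fun w => (-1) ^+ M * 'C(c w, M)%:R)).
    by have := integrableZl measurableT ((-1) ^+ M) (intb M).
  have E : (fun w => \sum_(m < M.+1) (-1) ^+ m * 'C(c w, m)%:R) =
      (fun w => \sum_(m < M) (-1) ^+ m * 'C(c w, m)%:R + (-1) ^+ M * 'C(c w, M)%:R :> R).
    by apply/funext => w; rewrite big_ord_recr.
  rewrite E; split; first by have := integrableD measurableT iM iZ.
  by rewrite (RintegralD measurableT iM iZ) (RintegralZl _ measurableT (intb M)) RM Rb big_ord_recr.
have ints M := (RS M).1; have Rs M := (RS M).2.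
have key M : `|fine (P [set w | c w = 0%N]) - euler y| <=
   exp_coeff S M + (expR S - series (exp_coeff S) M).
  have h1 : `|fine (P [set w | c w = 0%N]) -
      \sum_(m < M) (-1) ^+ m * (correlation_sum m y / m`!%:R)| <= exp_coeff S M.
    rewrite -R0 -Rs -(RintegralB measurableT int0 (ints M)).
    have i1 : P.-integrable setT (EFin \o (fun w => \1_A w -
        \sum_(m < M) (-1) ^+ m * 'C(c w, m)%:R)).
      by have := integrableB measurableT int0 (ints M).
    apply: le_trans (le_normr_Rintegral measurableT i1) _.
    apply: (@le_trans _ _ (\int[P]_w 'C(c w, M)%:R)).
      have i1' : P.-integrable setT (EFin \o (fun w => `|\1_A w -
          \sum_(m < M) (-1) ^+ m * 'C(c w, m)%:R|)).
        by have := integrable_abse i1.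
      apply: (le_Rintegral measurableT i1' (intb M)) => w _; rewrite AE; exact: bonferroni.
    rewrite Rb /exp_coeff /= ler_pM2r ?invr_gt0//; exact: correlation_sum_le.
  have h2 := euler_truncation M y01.
  apply: le_trans (ler_distD (\sum_(m < M) (-1) ^+ m * (correlation_sum m y / m`!%:R)) _ _) _.
  by rewrite lerD// distrC.
have c0 : exp_coeff S M + (expR S - series (exp_coeff S) M) @[M --> \oo] --> 0.
  rewrite -[X in _ --> X]addr0; apply: cvgD; first exact: cvg_exp_coeff.
  rewrite -(subrr (expR S)); apply: cvgB; first exact: cvg_cst.
  exact: is_cvg_series_exp_coeff.
have : `|fine (P [set w | c w = 0%N]) - euler y| <= 0.
  rewrite -(cvg_lim (@Rhausdorff R) c0); apply: limr_ge; first by apply/cvg_ex; eexists; exact: c0.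
  by near=> M; exact: key.
rewrite normr_le0 subr_eq0 => /eqP <-.
by rewrite fineK// fin_num_measure.
Unshelve. all: by end_near. Qed.

End inclusion_exclusion.

(** * Configurations with finitely many points *)

Section configurations.
Variable R : realType.
Implicit Types (N : R[i] -> nat) (A B : set R[i]).

(** Each point contributes at least one to the count, so that a finite count
    leaves a finite list of points. *)
Lemma number_of_points_seq N B : (forall z, (N z <= 1)%N) ->
  (number_of_points N B < +oo)%E ->
  exists s : seq R[i], [/\ uniq s,
    forall z, (z \in s) <-> B z /\ (0 < N z)%N &
    forall A, A `<=` B -> number_of_points N A = ((\sum_(z <- s) (z \in A))%N%:R%:E : \bar R)].
Proof.
move=> N1 Bfin; pose S := B `&` [set z | (0 < N z)%N].
have NE z : N z = ((0 < N z)%N : nat) by have := N1 z; case: (N z) => [|[]].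
have finS : finite_set S.
  apply: contrapT => infS; move: Bfin; rewrite ltNge => /negP; apply.
  rewrite -(infinite_card_dirac R infS) /number_of_points.
  rewrite [leLHS]esum_mkcond [leRHS]esum_mkcond; apply: le_esum => z _.
  case: ifPn => [zS|_]; last by case: ifP => // _; rewrite lee_fin.
  have [Bz Nz] : S z by rewrite inE in zS.
  by rewrite mem_set// diracE zS lee_fin ler1n.
exists (finmap.enum_fset (fset_set S)); split.
- exact: finmap.fset_uniq.
- by move=> z; rewrite (in_fset_set finS) inE.
move=> A AB.
transitivity (\esum_(z in S) ((z \in A : nat)%:R%:E : \bar R))%E.
  rewrite /number_of_points esum_mkcond [RHS]esum_mkcond; apply: eq_esum => z _.
  case: (boolP (z \in A)) => [zA|_]; last by case: ifP.
  case: (boolP (z \in S)) => [|zS]; first by rewrite inE NE => -[_ /= ->].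
  rewrite (_ : N z = 0%N)//; apply/eqP; rewrite -leqn0 leqNgt; apply/negP => Nz.
  move/negP: zS; apply; rewrite inE; split => //; apply: AB; by rewrite inE in zA.
rewrite esum_fset// fsbig_finite//= natr_sum -sumEFin//.
Qed.

(** Half-planes bounded by horizontal and vertical lines of rational position:
    countably many tests that together separate points. *)
Definition half_plane (k : nat) (z : R[i]) : bool :=
  if unpickle k is Some (q, b) then
    (if b : bool then complex.Re z else complex.Im z) < ratr (q : rat)
  else false.

Lemma half_plane_separation (z w : R[i]) : z != w ->
  exists k, half_plane k z != half_plane k w.
Proof.
have lt_sep (x y : R) : x != y -> exists q : rat, (x < ratr q) != (y < ratr q).
  rewrite neq_lt => /orP[xy|yx].
    have [q] := rat_in_itvoo xy; rewrite in_itv /= => /andP[xq qy].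
    by exists q; rewrite xq ltNge (ltW qy).
  have [q] := rat_in_itvoo yx; rewrite in_itv /= => /andP[yq qx].
  by exists q; rewrite yq ltNge (ltW qx).
rewrite eq_complex negb_and => /orP[/lt_sep|/lt_sep] [q Hq].
  by exists (pickle (q, true)); rewrite /half_plane pickleK.
by exists (pickle (q, false)); rewrite /half_plane pickleK.
Qed.

Lemma measurable_half_plane k : measurable [set z | half_plane k z].
Proof.
rewrite /half_plane; case: (unpickle k) => [[q b]|]; last by rewrite set_false.
have mb : measurable_fun setT (fun z : R[i] => if b then complex.Re z else complex.Im z).
  by case: b; [exact: measurable_Re|exact: measurable_Im].
exact: (measurable_lt_preimage (ratr q) mb).
Qed.

Definition code l (z : R[i]) : {ffun 'I_l -> bool} := [ffun k : 'I_l => half_plane k z].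

Lemma code_refine l (z w : R[i]) : code l.+1 z = code l.+1 w -> code l z = code l w.
Proof.
move=> /ffunP h; apply/ffunP => k.
by have := h (widen_ord (leqnSn l) k); rewrite !ffunE.
Qed.

Lemma code_refine_le l l' (z w : R[i]) : (l <= l')%N -> code l' z = code l' w ->
  code l z = code l w.
Proof.
move=> /subnK <-; elim: (l' - l)%N => // j IH; rewrite addSn => /code_refine; exact: IH.
Qed.

Lemma code_injective (z w : R[i]) : z != w -> exists l, code l z != code l w.
Proof.
move=> /half_plane_separation[k Hk]; exists k.+1; apply: contra Hk => /eqP/ffunP h.
by have := h ord_max; rewrite !ffunE /= => ->.
Qed.

Lemma code_injective_finite n (z : 'I_n -> R[i]) : injective z ->
  exists L, forall l, (L <= l)%N -> injective (fun i => code l (z i)).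
Proof.
move=> zI.
have ex (p : 'I_n * 'I_n) : exists l, p.1 != p.2 -> code l (z p.1) != code l (z p.2).
  have [e|ne] := eqVneq p.1 p.2; first by exists 0%N.
  have [|l Hl] := @code_injective (z p.1) (z p.2); first by apply: contra ne => /eqP/zI ->.
  by exists l.
have [L HL] := boolp.choice ex.
exists (\max_p L p) => l lL i j e; apply/eqP; apply: contraT => ij.
have := HL (i, j) ij; rewrite /= (@code_refine_le _ l _ _ _ e) ?eqxx//.
by apply: leq_trans lL; exact: (leq_bigmax (i, j)).
Qed.

Definition cell B l (c : {ffun 'I_l -> bool}) : set R[i] := B `&` [set z | code l z = c].

Lemma measurable_cell B l c : measurable B -> measurable (@cell B l c).
Proof.
move=> mB; apply: measurableI => //.
rewrite (_ : [set z | _] = \bigcap_(k in [set: 'I_l])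
   (if c k then [set z | half_plane k z] else ~` [set z | half_plane k z])); last first.
  apply/seteqP; split => [z /= zc k _|z /= h].
    by have := congr1 (fun f : {ffun _} => f k) zc; rewrite /= ffunE; case: (c k) => /= ->.
  apply/ffunP => k; rewrite ffunE; have := h k Logic.I; case: (c k) => /=.
    by move=> ->.
  by move=> /negP/negbTE.
apply: fin_bigcap_measurable; first exact: finite_finset.
by move=> k _; case: (c k); [|apply: measurableC]; exact: measurable_half_plane.
Qed.

Lemma measurable_code_prod m l (f : {ffun 'I_m -> {ffun 'I_l -> bool}}) :
  measurable_fun setT (fun x : m.-tuple R[i] =>
    (\prod_(i < m) (\1_[set z : R[i] | code l z = f i] (tnth x i))%:E : \bar R)%E).
Proof.
apply: (measurable_prod_tnth (g := fun i z => (\1_[set z : R[i] | code l z = f i] z)%:E)).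
move=> i; apply/measurable_EFinP; apply: measurable_indic.
by have := @measurable_cell setT l (f i) measurableT; rewrite /cell setTI.
Qed.

(** Expanding the product chooses a point for each index; the codes of the
    chosen points are then the only map [f] with a nonzero contribution. *)
Lemma sum_injective_codes (C : finType) m M (h : 'I_M -> C) :
  (\sum_(f : {ffun 'I_m -> C} | injectiveb f) \prod_i \sum_(k < M) (h k == f i) =
   \sum_(g : {ffun 'I_m -> 'I_M}) injectiveb [ffun i => h (g i)])%N.
Proof.
under eq_bigr do rewrite bigA_distr_bigA /=.
rewrite exchange_big /=; apply: eq_bigr => g _.
have P (f : {ffun 'I_m -> C}) : (\prod_(i < m) (h (g i) == f i))%N = (f == [ffun i => h (g i)]).
  case: eqP => [->|ne]; first by rewrite big1// => i _; rewrite ffunE eqxx.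
  have [i hi] : exists i, h (g i) != f i.
    apply/existsP; apply: contraT; rewrite negb_exists => /forallP e.
    by case: ne; apply/ffunP => i; rewrite ffunE; apply/esym/eqP; have := e i; rewrite negbK.
  by rewrite (bigD1 i)//= (negbTE hi) mul0n.
under eq_bigr do rewrite P.
rewrite big_mkcond (bigD1 [ffun i => h (g i)])//= eqxx big1 ?addn0.
  by case: (injectiveb _).
by move=> f /negbTE ->; case: ifP.
Qed.

End configurations.

(** * Factorial moments of the number of points *)

Section factorial_moments.
Variables (R : realType) (r : R).
Hypothesis r_gt0 : 0 < r.
Notation leb n := (lebesgue_Cn R n).
Notation K := (bergman_kernel r).

Let cvg_trunc_det_ereal m t (x : m.-tuple R[i]) : r < t -> outer_box t x ->
  (trunc_det r n x)%:E @[n --> \oo] --> (complex.Re (kernel_det K x))%:E.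
Proof.
move=> rt xt; apply: cvg_EFin; first by near=> n.
by apply: cvg_trunc_det => // i; exact: lt_le_trans (xt i).
Unshelve. all: by end_near. Qed.

Lemma measurable_kernel_det m t : r < t ->
  measurable_fun (@outer_box R m t) (fun x => (complex.Re (kernel_det K x))%:E).
Proof.
move=> rt; apply: (emeasurable_fun_cvg (fun n x => (trunc_det r n x)%:E)).
  move=> n; apply: (measurable_funS measurableT) => //.
  by apply/measurable_EFinP; exact: measurable_trunc_det.
by move=> x xt; exact: (cvg_trunc_det_ereal rt xt).
Qed.

(** Monotone convergence along the truncations of the kernel. *)
Lemma integral_kernel_det m t : r < t ->
  (\int[leb m]_(x in outer_box t) (complex.Re (kernel_det K x))%:E =
   (correlation_sum m ((r / t) ^+ 2))%:E)%E.
Proof.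
move=> rt; have t0 : 0 < t by exact: lt_trans rt.
have y01 : 0 <= (r / t) ^+ 2 < 1.
  by rewrite sqr_ge0 /= expr_lt1// ?divr_ge0 ?ltW// ltr_pdivrMr// mul1r.
have := @cvg_monotone_convergence _ _ _ (leb m) _ (@measurable_outer_box R m t)
  (fun n x => (trunc_det r n x)%:E).
set lim1 := (X in _ -> _ -> _ -> _ --> X) => H.
have c1 : (\int[leb m]_(x in outer_box t) (trunc_det r n x)%:E)%E @[n --> \oo] --> lim1.
  apply: H.
  - move=> n; apply: (measurable_funS measurableT) => //.
    by apply/measurable_EFinP; exact: measurable_trunc_det.
  - by move=> n x _; rewrite lee_fin trunc_det_ge0.
  - by move=> x _ a b ab; rewrite lee_fin; exact: trunc_det_nondecreasing.
have -> : (\int[leb m]_(x in outer_box t) (complex.Re (kernel_det K x))%:E)%E = lim1.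
  apply: eq_integral => x; rewrite inE => xt; apply/esym/cvg_lim => //.
  exact: (cvg_trunc_det_ereal rt xt).
have c2 : (\int[leb m]_(x in outer_box t) (trunc_det r n x)%:E)%E @[n --> \oo] -->
    (correlation_sum m ((r / t) ^+ 2))%:E.
  under eq_fun do rewrite integral_trunc_det//.
  by apply: cvg_EFin; [near=> n|exact: cvg_injective_sum].
by rewrite -(cvg_lim (@ereal_hausdorff R) c1) (cvg_lim (@ereal_hausdorff R) c2).
Unshelve. all: by end_near. Qed.

Variables (d : measure_display) (T : measurableType d) (P : probability T R).
Variable X : T -> R[i] -> nat.
Hypothesis detX : is_determinantal P (outer_domain r) K X.

Let measurable_number (A : set R[i]) : measurable A -> A `<=` outer_domain r ->
  measurable_fun setT (fun w => number_of_points (X w) A : \bar R).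
Proof. by case: detX => -[_ _ _ + _]; apply. Qed.

Let outer_sub t : r < t -> [set z : R[i] | t <= normc z] `<=` outer_domain r.
Proof. by move=> rt z /=; exact: lt_le_trans. Qed.

(** The cells of an injective family are disjoint, so that the correlation
    identity applies to each family; the families together exhaust the tuples
    whose points have different codes. *)
Lemma integral_distinct_cells m t l : (0 < m)%N -> r < t ->
  let B := [set z : R[i] | t <= normc z] in
  (\int[P]_w (\sum_(f : {ffun 'I_m -> {ffun 'I_l -> bool}} | injectiveb f)
      \prod_i number_of_points (X w) (cell B (f i))) =
   \int[leb m]_(x in outer_box t)
     ((injectiveb [ffun i => code l (tnth x i)])%:R * complex.Re (kernel_det K x))%:E)%E.
Proof.
move=> m0 rt B; have mB : measurable B by exact: measurable_normc_ge.
have mc c : measurable (@cell R B l c) by exact: measurable_cell.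
have cU c : @cell R B l c `<=` outer_domain r by move=> z [/(outer_sub rt)].
have mN c := measurable_number (mc c) (cU c).
have mbox := @measurable_outer_box R m t.
pose box (f : {ffun 'I_m -> {ffun 'I_l -> bool}}) : set (m.-tuple R[i]) :=
  [set x | forall i, cell B (f i) (tnth x i)].
have mboxf f : measurable (box f).
  rewrite (_ : box f = \bigcap_(i in [set: 'I_m])
      ((fun x : m.-tuple R[i] => tnth x i) @^-1` cell B (f i))); last first.
    by apply/seteqP; split => [x h i _|x h i]; apply: h.
  apply: fin_bigcap_measurable; first exact: finite_finset.
  by move=> i _; rewrite -[X in measurable X]setTI; exact: measurable_tnth.
have boxE f x : box f x <-> outer_box t x /\ f = [ffun i => code l (tnth x i)].
  split=> [h|[h -> i]]; last by split => /=; [exact: h|rewrite ffunE].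
  by split=> [i|]; [have [] := h i|apply/ffunP => i; have [_ /= <-] := h i; rewrite ffunE].
have D0 x : outer_box t x -> 0 <= complex.Re (kernel_det K x).
  by move=> xt; apply: kernel_det_ge0 => // i; exact: lt_le_trans (xt i).
pose s := [seq f : {ffun 'I_m -> {ffun 'I_l -> bool}} <- index_enum _ | injectiveb f].
rewrite (eq_integral (fun w => \sum_(f <- s)
   \prod_i number_of_points (X w) (cell B (f i)))%E); last first.
  by move=> w _; rewrite big_filter.
rewrite (ge0_integral_sum _ measurableT); last 2 first.
- by move=> f; apply: measurable_eprod => i; exact: mN.
- by move=> f w _; apply: prode_ge0 => i _; apply: esum_ge0 => z _; rewrite lee_fin.
rewrite big_filter.
transitivity (\sum_(f : {ffun 'I_m -> {ffun 'I_l -> bool}} | injectiveb f)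
    \int[leb m]_(x in outer_box t)
      ((f == [ffun i => code l (tnth x i)])%:R * complex.Re (kernel_det K x))%:E)%E.
  apply: eq_bigr => f /injectiveP fI.
  have [_ /(_ m (fun i => cell B (f i)) m0)] := detX.
  move=> /(_ (fun i => mc (f i)) (fun i => cU (f i))).
  have tI : trivIset setT (fun i : 'I_m => cell B (f i)).
    apply/trivIsetP => i j _ _ ij; apply/seteqP; split => // z [[_ /= zi] [_ /= zj]].
    by move/eqP: ij; apply; apply: fI; rewrite -zi -zj.
  move=> /(_ tI) [-> _]; rewrite -/(box f) [LHS]integral_mkcond [RHS]integral_mkcond.
  apply: eq_integral => x _; rewrite !patchE.
  case: (boolP (x \in box f)) => [|xf].
    by rewrite inE => /boxE[xt ->]; rewrite mem_set// eqxx mul1r.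
  case: (boolP (x \in outer_box t)) => // xt.
  case: eqP => [fE|_]; last by rewrite mul0r.
  by move/negP: xf; case; rewrite inE; apply/boxE; split => //; rewrite inE in xt.
have mD f : measurable_fun (outer_box t) (fun x : m.-tuple R[i] =>
    ((f == [ffun i => code l (tnth x i)])%:R * complex.Re (kernel_det K x))%:E).
  rewrite (_ : (fun x => _) = (fun x : m.-tuple R[i] =>
    (f == [ffun i => code l (tnth x i)])%:R%:E * (complex.Re (kernel_det K x))%:E)%E); last first.
    by apply/funext => x; rewrite EFinM.
  apply: emeasurable_funM; last exact: measurable_kernel_det.
  rewrite (_ : (fun x => _) = (fun x : m.-tuple R[i] => \prod_(i < m)
      (\1_[set z : R[i] | code l z = f i] (tnth x i))%:E)%E); last first.
    apply/funext => x; case: eqP => [fE|ne].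
      by rewrite big1// => i _; rewrite indicE mem_set//= fE ffunE.
    have [i hi] : exists i, code l (tnth x i) <> f i.
      apply/existsNP => h; apply: ne; apply/ffunP => i; rewrite ffunE; exact/esym/h.
    by rewrite (bigD1 i)//= indicE memNset// mul0e.
  by apply: (measurable_funS measurableT) => //; exact: measurable_code_prod.
rewrite -big_filter -(ge0_integral_sum _ mbox).
- apply: eq_integral => x _; rewrite sumEFin; congr (_%:E).
  rewrite -mulr_suml; congr (_ * _); rewrite big_filter.
  rewrite big_mkcond (bigD1 [ffun i => code l (tnth x i)])//= eqxx big1 ?addr0.
    by case: (injectiveb _).
  by move=> f /negbTE ->; case: ifP.
- exact: mD.
- by move=> f x xt; rewrite lee_fin mulr_ge0//; exact: D0.
Qed.

(** The first moment, a correlation integral of order one, is finite. *)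
Lemma outer_points_fin_ae t : r < t ->
  {ae P, forall w, (number_of_points (X w) [set z | (t <= normc z)%R] < +oo)%E}.
Proof.
move=> rt; pose B := [set z : R[i] | t <= normc z].
have mB : measurable B by exact: measurable_normc_ge.
have mN := measurable_number mB (outer_sub rt).
have N0 w : (0 <= number_of_points (X w) B)%E by apply: esum_ge0 => z _; rewrite lee_fin.
have [_ /(_ 1%N (fun=> B) isT (fun=> mB) (fun=> outer_sub rt))] := detX.
have tI : trivIset setT (fun _ : 'I_1 => B).
  by apply/trivIsetP => i j _ _; rewrite (ord1 i) (ord1 j) eqxx.
move=> /(_ tI) [H _].
have E : (\int[P]_w number_of_points (X w) B = (correlation_sum 1 ((r / t) ^+ 2))%:E)%E.
  rewrite -integral_kernel_det// -[RHS]H; apply: eq_integral => w _.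
  by rewrite big_ord_recl big_ord0 mule1.
have : P.-integrable setT (fun w => number_of_points (X w) B).
  apply/integrableP; split => //.
  rewrite (eq_integral (fun w => number_of_points (X w) B)); first by rewrite E ltry.
  by move=> w _; rewrite gee0_abs.
move=> /(integrable_ae measurableT); apply: filterS => w /(_ Logic.I).
by rewrite ge0_fin_numE.
Qed.

Variable G : set T.
Hypothesis mG : measurable G.
Hypothesis G_full : P (~` G) = 0%E.
Hypothesis simpleG : forall w, G w -> forall z, (X w z <= 1)%N.

Let integral_G (f : T -> \bar R) : measurable_fun setT f -> (forall w, (0 <= f w)%E) ->
  (\int[P]_w f w = \int[P]_(w in G) f w)%E.
Proof.
move=> mf f0; rewrite (ge0_negligible_integral (measurableC mG) measurableT mf)//.
by rewrite setTD setCK.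
Qed.

Section fixed_radius.
Variable t : R.
Hypothesis rt : r < t.
Notation B := [set z : R[i] | t <= normc z].
Hypothesis finG : forall w, G w -> (number_of_points (X w) B < +oo)%E.

Let mB : measurable B.
Proof. exact: measurable_normc_ge. Qed.

Let y01 : 0 <= (r / t) ^+ 2 < 1.
Proof.
have t0 : 0 < t by exact: lt_trans rt.
by rewrite sqr_ge0 /= expr_lt1// ?divr_ge0 ?ltW// ltr_pdivrMr// mul1r.
Qed.

(** Set to 0 off [G], which makes it a measurable function with natural values
    everywhere. *)
Definition outer_count w : nat :=
  if w \in G then Num.truncn (fine (number_of_points (X w) B)) else 0.

Lemma outer_countP w : G w -> exists s : seq R[i], [/\ uniq s, outer_count w = size s,
    forall z, (z \in s) <-> B z /\ (0 < X w z)%N &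
    forall A, A `<=` B -> number_of_points (X w) A = ((\sum_(z <- s) (z \in A))%N%:R%:E : \bar R)].
Proof.
move=> Gw; have [s [us ms ns]] := number_of_points_seq (simpleG Gw) (finG Gw).
exists s; split => //; rewrite /outer_count mem_set// ns//= natrK.
rewrite -sum1_size big_seq [RHS]big_seq; apply: eq_bigr => z zs.
by rewrite mem_set//; have [] := (ms z).1 zs.
Qed.

Lemma measurable_outer_count : measurable_fun setT (fun w => (outer_count w)%:R : R).
Proof.
rewrite (_ : (fun w => _) = (fun w => fine (number_of_points (X w) B) * \1_G w)).
  apply: measurable_funM; last exact: measurable_indic.
  apply: measurableT_comp; first exact: fine_measurable.
  exact: measurable_number mB (outer_sub rt).
apply/funext => w; rewrite indicE; case: (boolP (w \in G)) => [|wG]; last first.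
  by rewrite mulr0 /outer_count (negbTE wG).
rewrite inE => Gw; have [s [us cs ms ns]] := outer_countP Gw.
rewrite mulr1 ns//= cs; congr (_%:R).
rewrite -sum1_size big_seq [RHS]big_seq; apply: eq_bigr => z zs.
by rewrite mem_set//; have [] := (ms z).1 zs.
Qed.

Let tuples m l w : \bar R :=
  (\sum_(f : {ffun 'I_m -> {ffun 'I_l -> bool}} | injectiveb f)
      \prod_i number_of_points (X w) (cell B (f i)))%E.

Let tuplesE m w : G w -> exists2 z : 'I_(outer_count w) -> R[i], injective z &
  forall l, tuples m l w =
    ((\sum_(g : {ffun 'I_m -> 'I_(outer_count w)}) injectiveb [ffun i => code l (z (g i))])%N%:R)%:E.
Proof.
move=> Gw; have [s [us cs ms ns]] := outer_countP Gw; rewrite cs.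
exists (tnth (in_tuple s)) => [i j|l].
  by rewrite !(tnth_nth 0) => /eqP; rewrite nth_uniq// => /eqP/val_inj.
rewrite -(sum_injective_codes m (fun k => code l (tnth (in_tuple s) k))) /tuples.
rewrite natr_sum -sumEFin; apply: eq_bigr => f _.
rewrite natr_prod -prodEFin; apply: eq_bigr => i _.
rewrite ns; last by move=> z [].
rewrite big_tnth; congr (_%:R%:E); apply: eq_bigr => k _.
congr nat_of_bool; apply/idP/eqP; rewrite inE; first by case.
move=> h; split => //; exact: ((ms _).1 (mem_tnth k (in_tuple s))).1.
Qed.

Let measurable_tuples m l : measurable_fun setT (tuples m l).
Proof.
rewrite /tuples; under eq_fun do rewrite -big_filter.
apply: emeasurable_sum => f; apply: measurable_eprod => i.
apply: measurable_number; first exact: measurable_cell.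
by move=> z [/(outer_sub rt)].
Qed.

Let tuples_ge0 m l w : (0 <= tuples m l w)%E.
Proof.
apply: sume_ge0 => f _; apply: prode_ge0 => i _.
by apply: esum_ge0 => z _; rewrite lee_fin.
Qed.

Let measurable_ffact m : measurable_fun setT (fun w => (outer_count w ^_ m)%:R%:E : \bar R).
Proof. exact/measurable_EFinP/measurable_ffact/measurable_outer_count. Qed.

Let cvg_tuples m : (\int[P]_w tuples m l w)%E @[l --> \oo] -->
  (\int[P]_w ((outer_count w) ^_ m)%:R%:E)%E.
Proof.
have := @cvg_monotone_convergence _ _ _ P _ mG (tuples m).
rewrite [X in _ -> _ -> _ -> _ --> X](_ : _ = \int[P]_w ((outer_count w) ^_ m)%:R%:E)%E; last first.
  rewrite (integral_G (measurable_ffact m)); last by move=> w; rewrite lee_fin.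
  apply: eq_integral => w; rewrite inE => Gw; apply/cvg_lim => //.
  have [z zI E] := tuplesE m Gw; have [L HL] := code_injective_finite zI.
  apply: cvg_near_cst; near=> l.
  have lL : (L <= l)%N by near: l; exact: nbhs_infty_ge.
  rewrite E; congr (_%:R%:E).
  have -> : (outer_count w ^_ m)%N = #|[set g : {ffun 'I_m -> 'I_(outer_count w)} | injectiveb g]%SET|.
    by rewrite card_inj_ffuns !card_ord.
  rewrite -sum1dep_card [RHS]big_mkcond; apply: eq_bigr => g _.
  rewrite (_ : injectiveb [ffun i => code l (z (g i))] = injectiveb g); first by case: (injectiveb g).
  apply/injectiveP/injectiveP => gI i j.
    by move=> e; apply: gI; rewrite !ffunE e.
  by rewrite !ffunE => /(HL l lL); exact: gI.
move=> H; have {H} : (\int[P]_(w in G) tuples m l w)%E @[l --> \oo] -->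
    (\int[P]_w ((outer_count w) ^_ m)%:R%:E)%E.
  apply: H.
  - by move=> l; apply: (measurable_funS measurableT).
  - by move=> l w _.
  move=> w Gw l l' ll'; have [z zI E] := tuplesE m Gw; rewrite !E lee_fin ler_nat.
  apply: leq_sum => g _; case: (boolP (injectiveb [ffun i => code l (z (g i))])) => // /injectiveP h.
  rewrite lt0b; apply/injectiveP => i j; rewrite !ffunE => /(code_refine_le ll') e.
  by apply: h; rewrite !ffunE.
by under eq_fun do rewrite -(integral_G (measurable_tuples m _) (tuples_ge0 m _)).
Unshelve. all: by end_near. Qed.

Let distinct m l (x : m.-tuple R[i]) : bool := injectiveb [ffun i => code l (tnth x i)].

Let distinct_le m l l' (x : m.-tuple R[i]) : (l <= l')%N -> distinct l x -> distinct l' x.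
Proof.
move=> ll' /injectiveP h; apply/injectiveP => i j; rewrite !ffunE => /(code_refine_le ll') e.
by apply: h; rewrite !ffunE.
Qed.

(** The kernel determinant vanishes on the diagonals, so that nothing is lost
    by restricting to tuples that the codes eventually separate. *)
Let cvg_distinct m (x : m.-tuple R[i]) :
  ((distinct l x)%:R * complex.Re (kernel_det K x))%:E @[l --> \oo] -->
  (complex.Re (kernel_det K x))%:E.
Proof.
have [xI|] := pselect (injective (tnth x)).
  have [L HL] := code_injective_finite xI.
  apply: cvg_near_cst; near=> l; have lL : (L <= l)%N by near: l; exact: nbhs_infty_ge.
  have -> : distinct l x.
    by apply/injectiveP => i j; rewrite !ffunE => /(HL l lL).
  by rewrite mul1r.
move=> nI; have [i [j [xij ij]]] : exists i j, tnth x i = tnth x j /\ i != j.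
  apply: contrapT => h; apply: nI => i j xij; apply/eqP; apply: contraT => ij.
  by case: h; exists i, j.
by rewrite (kernel_det_diag _ ij xij); under eq_fun do rewrite mulr0; exact: cvg_cst.
Unshelve. all: by end_near. Qed.

Let measurable_distinct m l : measurable_fun (@outer_box R m t)
  (fun x => ((distinct l x)%:R * complex.Re (kernel_det K x))%:E).
Proof.
rewrite (_ : (fun x => _) = (fun x : m.-tuple R[i] =>
    (distinct l x)%:R%:E * (complex.Re (kernel_det K x))%:E)%E); last first.
  by apply/funext => x; rewrite EFinM.
apply: emeasurable_funM; last exact: measurable_kernel_det.
pose C := {ffun 'I_l -> bool}.
rewrite (_ : (fun x => _) = (fun x : m.-tuple R[i] =>
   \sum_(f : {ffun 'I_m -> C}) (injectiveb f)%:R%:E * \prod_(i < m)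
      (\1_[set z : R[i] | code l z = f i] (tnth x i))%:E)%E); last first.
  apply/funext => x; rewrite (bigD1 [ffun i => code l (tnth x i)])//= [X in _ + X]big1 ?addr0.
    rewrite [X in (_ * X)%E]big1 ?mule1// => i _.
    by rewrite indicE mem_set//= ffunE.
  move=> f fx; have [i hi] : exists i, code l (tnth x i) <> f i.
    apply/existsNP => h; move/eqP: fx; apply; apply/ffunP => i; rewrite ffunE; exact/esym/h.
  by rewrite (bigD1 i)//= indicE memNset// mul0e mule0.
apply: (measurable_funS measurableT) => //; apply: emeasurable_sum => f.
apply: emeasurable_funM; first exact: measurable_cst.
exact: measurable_code_prod.
Qed.

Let cvg_distinct_integral m : (\int[leb m]_(x in outer_box t)
    ((distinct l x)%:R * complex.Re (kernel_det K x))%:E)%E @[l --> \oo] -->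
  (correlation_sum m ((r / t) ^+ 2))%:E.
Proof.
have D0 (x : m.-tuple R[i]) : outer_box t x -> 0 <= complex.Re (kernel_det K x).
  by move=> xt; apply: kernel_det_ge0 => // i; exact: lt_le_trans (xt i).
have := @cvg_monotone_convergence _ _ _ (leb m) _ (@measurable_outer_box R m t)
  (fun l x => ((distinct l x)%:R * complex.Re (kernel_det K x))%:E).
rewrite [X in _ -> _ -> _ -> _ --> X](_ : _ = (correlation_sum m ((r / t) ^+ 2))%:E); last first.
  rewrite -integral_kernel_det//; apply: eq_integral => x _; apply/cvg_lim => //.
apply.
- by move=> l; exact: measurable_distinct.
- by move=> l x xt; rewrite lee_fin mulr_ge0//; exact: D0.
move=> x xt l l' ll'; rewrite lee_fin; apply: ler_wpM2r; first exact: D0.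
by rewrite ler_nat; case: (boolP (distinct l x)) => // /(distinct_le ll') ->.
Qed.

(** Refining the codes in [integral_distinct_cells], both sides increase to
    their limits. *)
Lemma factorial_moment m :
  (\int[P]_w ((outer_count w) ^_ m)%:R%:E = (correlation_sum m ((r / t) ^+ 2))%:E)%E.
Proof.
case: m => [|m].
  have -> : correlation_sum 0 ((r / t) ^+ 2) = 1.
    rewrite /correlation_sum (_ : (fun n => _) = (fun=> 1)) ?lim_cst//.
    apply/funext => n; rewrite injective_sum_subsets mul1r.
    rewrite (big_pred1 finset.set0) ?finset.big_set0// => A.
    by rewrite finset.cards_eq0.
  rewrite (eq_integral (fun=> 1%E)) => [|w _]; last by rewrite ffactn0.
  by rewrite integral_cst_probability.
have h1 := @cvg_tuples m.+1; have h2 := @cvg_distinct_integral m.+1.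
rewrite -(cvg_lim (@ereal_hausdorff R) h1) -(cvg_lim (@ereal_hausdorff R) h2).
have E : (fun l => (\int[P]_w tuples m.+1 l w)%E) = (fun l => (\int[leb m.+1]_(x in outer_box t)
    ((distinct l x)%:R * complex.Re (kernel_det K x))%:E)%E).
  by apply/funext => l; exact: integral_distinct_cells.
by rewrite E.
Qed.

Lemma probability_no_outer_point :
  P [set w | outer_count w = 0%N] = (euler ((r / t) ^+ 2))%:E.
Proof.
apply: (probability_no_point y01 measurable_outer_count); exact: factorial_moment.
Qed.

End fixed_radius.

End factorial_moments.

(** * The largest modulus of the Bergman process *)

(** Left rays are stable under intersection and generate the Borel sets. *)
Lemma law_unique (R : realType) d1 d2 (T1 : measurableType d1) (T2 : measurableType d2)
    (P1 : probability T1 R) (P2 : probability T2 R) (f : T1 -> R) (g : T2 -> R) :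
  measurable_fun setT f -> measurable_fun setT g ->
  (forall t, P1 [set w | f w < t] = P2 [set w | g w < t]) ->
  forall A : set R, measurable A -> P1 (f @^-1` A) = P2 (g @^-1` A).
Proof.
move=> mf mg fg A mA.
change (pushforward P1 (f : T1 -> measurableTypeR R) A =
  pushforward P2 (g : T2 -> measurableTypeR R) A).
apply: (@measure_unique _ R (measurableTypeR R) (@RGenInftyO.G R)
  (fun k => `]-oo, k%:R[%classic)) => //.
- exact: RGenInftyO.measurableE.
- move=> _ _ [x ->] [y ->]; exists (Num.min x y).
  by apply/seteqP; split => z /=; rewrite !in_itv /= lt_min => /andP.
- by move=> k; exists k%:R.
- rewrite -subTset => x _; exists (Num.truncn x).+1 => //=; rewrite in_itv /=.
  exact: truncnS_gt.
- move=> _ [x ->]; rewrite /pushforward /=.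
  have E (U : Type) (h : U -> R) : h @^-1` `]-oo, x[ = [set w | h w < x].
    by apply/seteqP; split => w /=; rewrite in_itv.
  change (P1 (f @^-1` `]-oo, x[) = P2 (g @^-1` `]-oo, x[)); by rewrite !E.
- move=> k; apply: (le_lt_trans (probability_le1 P1 _)); last exact: ltry.
  by rewrite -[X in measurable X]setTI; apply: mf => //; exact: measurable_itv.
Qed.

Lemma exists_argmax (R : realDomainType) (S : eqType) (f : S -> R) (s : seq S) :
  s != [::] -> exists2 z, z \in s & forall z', z' \in s -> f z' <= f z.
Proof.
elim: s => // a [|b s] IH _; first by exists a; rewrite ?mem_head// => z'; rewrite inE => /eqP ->.
have [z zs Hz] := IH isT; case: (leP (f z) (f a)) => za.
  exists a; first exact: mem_head.
  by move=> z'; rewrite inE => /orP[/eqP ->//|/Hz /le_trans]; apply.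
exists z; first by rewrite inE zs orbT.
by move=> z'; rewrite inE => /orP[/eqP ->|/Hz//]; exact: ltW.
Qed.

Section bergman_max_modulus.
Variables (R : realType) (r : R).
Hypothesis r_gt0 : 0 < r.
Variables (d : measure_display) (T : measurableType d) (P : probability T R).
Variable X : T -> R[i] -> nat.
Hypothesis bergX : is_bergman_process r P X.

Let detX : is_determinantal P (outer_domain r) (bergman_kernel r) X.
Proof. exact: bergX.1. Qed.

Let radius k : R := r + k.+1%:R^-1.

Let radius_gt k : r < radius k.
Proof. by rewrite ltrDl invr_gt0. Qed.

Let radius_le t : r < t -> exists k, radius k <= t.
Proof.
move=> rt; have e0 : 0 < t - r by rewrite subr_gt0.
exists (Num.truncn (t - r)^-1); rewrite /radius -lerBrDl.
rewrite -[leRHS]invrK lef_pV2 ?posrE ?invr_gt0//.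
exact/ltW/truncnS_gt.
Qed.

Notation outer t := [set z : R[i] | t <= normc z].

Let exists_good_set : exists G : set T, [/\ measurable G, P (~` G) = 0%E,
  forall w, G w -> forall z, (X w z <= 1)%N &
  forall w, G w -> forall t, r < t -> (number_of_points (X w) (outer t) < +oo)%E].
Proof.
have ae_fin : {ae P, forall w, forall k,
    (number_of_points (X w) (outer (radius k)) < +oo)%E}.
  by apply: ae_foralln => k; exact: (outer_points_fin_ae r_gt0 detX (radius_gt k)).
have ae1 : {ae P, forall w, (forall z, (X w z <= 1)%N) /\
    forall k, (number_of_points (X w) (outer (radius k)) < +oo)%E}.
  by apply: filterS2 bergX.2 ae_fin => w.
case: ae1 => N [mN PN sub]; exists (~` N).
have good w : (~` N) w -> (forall z, (X w z <= 1)%N) /\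
    forall k, (number_of_points (X w) (outer (radius k)) < +oo)%E.
  by move=> Nw; apply: contrapT => h; apply: Nw; apply: sub.
split; [exact: measurableC|by rewrite setCK|by move=> w /good[]|].
move=> w /good[_ h] t rt; have [k kt] := radius_le rt.
apply: le_lt_trans (h k); rewrite /number_of_points.
rewrite [leLHS]esum_mkcond [leRHS]esum_mkcond; apply: le_esum => z _.
case: ifPn => [|_]; last by case: ifP => // _; rewrite lee_fin.
by rewrite inE /= => tz; rewrite mem_set//= (le_trans kt).
Qed.

(** On the good set the maximum is below [t] exactly when no point lies outside
    the disc of radius [t]. Almost surely there is some point, since the
    probability of having none outside the disc of radius [s] vanishes as [s]
    decreases to [r]. *)
Lemma bergman_max_modulus : exists M : {RV P >-> R},
  {ae P, forall w, is_max [set normc z | z in [set z | (0 < X w z)%N]] (M w)} /\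
  forall t, P [set w | M w < t] = (if r <= t then euler ((r / t) ^+ 2) else 0)%:E.
Proof.
have [G [mG PG simpleG finG]] := exists_good_set.
pose c t w := outer_count X G t w.
have finGt t (rt : r < t) w (Gw : G w) := finG w Gw t rt.
have Pc t : r < t -> P [set w | c t w = 0%N] = (euler ((r / t) ^+ 2))%:E.
  move=> rt; exact: (probability_no_outer_point r_gt0 detX mG PG simpleG rt (finGt t rt)).
have mc t : r < t -> measurable [set w | c t w = 0%N].
  move=> rt; have mo := measurable_outer_count detX mG simpleG rt (finGt t rt).
  rewrite (_ : [set w | _] = [set w | (c t w)%:R < 1 :> R]).
    exact: measurable_lt_preimage.
  apply/seteqP; split => w /=; first by move=> ->.
  by rewrite (ltr_nat _ _ 1) ltnS leqn0 => /eqP.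
have cP t w : r < t -> G w -> c t w = 0%N <-> forall z, (0 < X w z)%N -> normc z < t.
  move=> rt Gw; have [s [us cs ms _]] := outer_countP simpleG (finGt t rt) Gw.
  rewrite /c cs; split => [/size0nil s0 z Xz|h].
    by rewrite ltNge; apply/negP => tz; have := (ms z).2 (conj tz Xz); rewrite s0.
  apply/eqP; rewrite size_eq0; apply/eqP; case: s us cs ms => // a s _ _ ms.
  have [/= ta Xa] := (ms a).1 (mem_head a s).
  by move: (h a Xa); rewrite ltNge ta.
have supp w z : (0 < X w z)%N -> r < normc z.
  by case: detX => -[_ h _ _] _; exact: h.
pose H := G `&` \bigcup_k (~` [set w | c (radius k) w = 0%N]).
have mH : measurable H.
  by apply: measurableI => //; apply: bigcup_measurable => k _; apply: measurableC; exact: mc.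
have PH : P (~` H) = 0%E.
  apply/eqP; rewrite eq_le measure_ge0 andbT; apply/lee_addgt0Pr => e e0; rewrite add0e.
  have [s rs se] := exists_small_euler r_gt0 e0.
  have : (P (~` H) <= P ([set w | c s w = 0%N] `|` ~` G))%E.
    apply: le_measure; rewrite ?inE.
    - exact: measurableC.
    - by apply: measurableU; [exact: mc|exact: measurableC].
    move=> w nH; have [Gw|] := pselect (G w); last by right.
    left; apply/(cP _ _ rs Gw) => z Xz; exfalso; apply: nH; split => //.
    have [k kz] := radius_le (supp _ _ Xz); exists k => //= ck.
    by have := (cP _ _ (radius_gt k) Gw).1 ck z Xz; rewrite ltNge kz.
  move=> /le_trans; apply; rewrite (measureU0 (mc _ rs) (measurableC mG) PG).
  have h : (P [set w | c s w = 0%N] <= e%:E)%E by rewrite Pc// lee_fin.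
  exact: h.
pose mods w : set R := [set normc z | z in [set z | (0 < X w z)%N]].
have exM w : H w -> exists m, is_max (mods w) m.
  move=> [Gw [k _ /= ck]].
  have [s [us cs ms _]] := outer_countP simpleG (finGt _ (radius_gt k)) Gw.
  have s0 : s != [::] by rewrite -size_eq0 -cs; apply/eqP.
  have [z zs Hz] := exists_argmax (@normc R) s0; have [/= kz Xz] := (ms z).1 zs.
  exists (normc z); split; first by exists z.
  move=> _ [z' Xz' <-]; have [kz'|z'k] := leP (radius k) (normc z').
    by apply: Hz; apply/ms.
  exact: le_trans (ltW z'k) kz.
pose M w : R := if w \in H then xget 0 [set m | is_max (mods w) m] else 0.
have Mmax w : H w -> is_max (mods w) (M w).
  move=> Hw; rewrite /M mem_set//.
  by have [m hm] := exM w Hw; apply: (@xgetPex _ 0 [set m | is_max (mods w) m]); exists m.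
have ME t : [set w | M w < t] =
    (if r < t then H `&` [set w | c t w = 0%N] else set0) `|`
    (if 0 < t then ~` H else set0).
  have MH w : H w -> M w < t <-> r < t /\ c t w = 0%N.
    move=> Hw; have [[z0 Xz0 Mz0] ub] := Mmax w Hw; rewrite -Mz0; split => [zt|[rt]].
      have rt : r < t by exact: lt_trans (supp _ _ Xz0) zt.
      split => //; apply/(cP _ _ rt Hw.1) => z Xz; apply: le_lt_trans zt.
      by rewrite Mz0; apply: ub; exists z.
    by move=> /(cP _ _ rt Hw.1); apply.
  have MnH w : ~ H w -> M w = 0 by move=> nH; rewrite /M memNset.
  apply/seteqP; split => w /=.
    have [Hw|nH] := pselect (H w).
      by move=> /(MH w Hw)[-> ct]; left.
    by rewrite MnH// => ->; right.
  move=> [|].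
    by case: ifP => // rt [Hw ct]; apply/(MH w Hw).
  by case: ifP => // t0 nH; rewrite MnH.
have mM : measurable_fun setT M.
  apply: (@measurability _ _ _ (measurableTypeR R) setT M (@RGenInftyO.G R)).
    exact: RGenInftyO.measurableE.
  move=> _ [_ [t ->] <-]; rewrite setTI.
  rewrite (_ : _ @^-1` _ = [set w | M w < t]); last first.
    by apply/seteqP; split => w /=; rewrite in_itv.
  rewrite ME; apply: measurableU; case: ifP => // h.
    by apply: measurableI => //; exact: mc.
  exact: measurableC.
pose M' : {RV P >-> R} := HB.pack M (isMeasurableFun.Build _ _ _ _ M mM).
exists M'; split.
  exists (~` H); split => //; first exact: measurableC.
  by move=> w /= h Hw; apply: h; exact: Mmax.
move=> t; rewrite -[[set w | M' w < t]]/[set w | M w < t] ME.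
have [rt|tr] := ltP r t.
  have t0 : 0 < t by exact: lt_trans rt.
  rewrite t0 (ltW rt).
  have -> : (H `&` [set w | c t w = 0%N]) `|` ~` H = [set w | c t w = 0%N] `|` ~` H.
    apply/seteqP; split => w /=; first by move=> [[_ ->]|]; [left|right].
    by have [Hw|] := pselect (H w); [move=> [->|]; [left|right]|right].
  by rewrite (measureU0 (mc _ rt) (measurableC mH) PH); exact: Pc.
rewrite set0U; have -> : (if r <= t then euler ((r / t) ^+ 2) else 0) = 0.
  case: ifP => // rt; have -> : t = r by apply/eqP; rewrite eq_le tr.
  by rewrite divff ?gt_eqF// expr1n euler1.
by case: ifP => _; rewrite ?measure0.
Qed.

End bergman_max_modulus.

(** * The limit law of the maximum modulus *)

Theorem corollary1p4 (R : realType) (nu : probability R[i] R) (r : R)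
    (nu_rotation : rotation_invariant nu)
    (nu_compact : compact (measure_support nu))
    (nu_log : (\int[nu]_z `| log_modulus z | < +oo)%E)
    (r_outer : is_max [set normc z | z in measure_support nu] r) :
  exists (d0 : measure_display) (T0 : measurableType d0)
    (P0 : probability T0 R) (xinf : {RV P0 >-> R}),
  [/\ forall w, 1 <= xinf w,
      forall t : R, 1 <= t ->
        \prod_(1 <= k < n.+1) (1 - t ^- (2 * k)) @[n --> \oo]
          --> fine (P0 [set w | xinf w < t]),
      forall (d : nat -> measure_display) (T : forall n, measurableType (d n))
          (P : forall n, probability (T n) R)
          (X : forall n, {RV (P n) >-> n.-tuple R[i]}),
        (forall n, (0 < n)%N -> is_jellium nu (X n)) ->
        cvg_in_law P (fun n w => max_modulus (X n w))
          P0 (fun w => r * xinf w) &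
      forall (d : measure_display) (T : measurableType d)
          (P : probability T R) (X : T -> R[i] -> nat),
        is_bergman_process r P X ->
        exists M : {RV P >-> R},
          {ae P, forall w, is_max [set normc z | z in [set z | (0 < X w z)%N]]
                             (M w)} /\
          forall A : set R, measurable A ->
            distribution P M A = P0 [set w | A (r * xinf w)] ].
Proof.
have r_gt0 := outer_radius_gt0 nu_log r_outer.
have [d0 [T0 [P0 [xinf [x_ge1 x_law]]]]] := exists_euler_variable R.
exists d0, T0, P0, xinf; split => //.
- move=> t t1; rewrite x_law//=.
  have t0 : 0 < t by exact: lt_le_trans t1.
  have -> : (fun n => \prod_(1 <= k < n.+1) (1 - t ^- (2 * k))) =
      (fun n => euler_prod n (t ^- 2)).
    apply/funext => n; rewrite big_add1 /=; apply: eq_bigr => k _.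
    by rewrite exprM exprVn.
  apply: cvg_euler; rewrite invr_ge0 exprn_ge0 ?(ltW t0)//=.
  by rewrite invf_le1 ?exprn_gt0// exprn_ege1.
- by move=> d T P X jX; exact: (cvg_in_law_jellium nu_rotation nu_log r_outer x_ge1 x_law jX).
- move=> d T P X bX; have [M [M_max M_law]] := bergman_max_modulus r_gt0 bX.
  exists M; split => // A mA.
  apply: (@law_unique _ _ _ _ _ P P0 M (fun w => r * xinf w)) => //.
  + exact: measurable_funM.
  + move=> t; transitivity ((if r <= t then euler ((r / t) ^+ 2) else 0)%:E).
      exact: M_law.
    case: ifPn => [rt|]; first by rewrite (scaled_law r_gt0 x_law).
    by rewrite -ltNge => /ltW tr; rewrite (scaled_law0 r_gt0 _ x_ge1 tr).
Qed.
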